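(* Let $\mathcal{C}$ be a bounded (above and below) graded poset satisfying the standing assumptions listed in the context, for which there exist an adequate covering family $\mathcal{J}$ and an adequate global covering family $\mathcal{K}=\{K_p\}_{p\ge0}$. Then $|\mathcal{C}|$ is acyclic (i.e. $H^j(|\mathcal{C}|;\mathbb{Z})=0$ for all $j\ge1$) if and only if $|K_0|$ equals the number of connected components of $\mathcal{C}$. Moreover, in this case $H^0(|\mathcal{C}|;\mathbb{Z})\cong\mathbb{Z}^{|K_0|}$.
   Context: A poset is regarded as a category with exactly one arrow $p\to p'$ when $p\le p'$; $p$ precedes $p'$ if $p<p'$ and there is nothing strictly in between. $|\mathcal{C}|$ is the realization of the nerve of $\mathcal{C}$. Standing assumptions on $\mathcal{C}$: it is a poset with a decreasing degree function $\deg:\mathrm{Ob}(\mathcal{C})\to\{0,1,2,\dots\}$, i.e. $\deg$ is strictly order reversing and $\deg(p')=\deg(p)-1$ whenever $p$ precedes $p'$ (so $\mathcal{C}$ is bounded above; bounded below means that $\deg$ also has an upper bound); some object has degree $0$; all maximal elements have the same degree (hence degree $0$); and for every object $i$ and every $n$ the set $(i\downarrow\mathcal{C})_n$ of objects $j\ge i$ with $\deg(j)=n$ is finite. $\mathrm{Ob}_n(\mathcal{C})$ is the set of objects of degree $n$, and $(i\downarrow\mathcal{C})_*$ is the full subcategory on the objects $j>i$. Covering family: a family $\mathcal{J}=\{J^{i_0}_p\}$ indexed by objects $i_0$ and integers $0\le p\le\deg(i_0)$, with $J^{i_0}_p\subseteq(i_0\downarrow\mathcal{C})_p$, such that for each $i_0$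 and $0\le p<\deg(i_0)$: (a) $\bigcup_{i\in J^{i_0}_{p+1}}(i\downarrow\mathcal{C})_p=(i_0\downarrow\mathcal{C})_p$; (b) $J^i_p\subseteq J^{i_0}_p$ for every $i\in J^{i_0}_{p+1}$. Define integers $R^{i_0}_p$ for $\deg(i_0)\ge p\ge 0$ by $R^{i_0}_0=1$ and $R^{i_0}_p=\sum_{i\in(i_0\downarrow\mathcal{C})_{p-1}}R^i_{p-1}-R^{i_0}_{p-1}$ for $p\ge1$. $\mathcal{J}$ is adequate if $(i_0\downarrow\mathcal{C})_*$ is connected whenever $\deg(i_0)\ge2$, and $R^{i_0}_p=\sum_{i\in J^{i_0}_p}R^i_p$ for all $p\ge0$ and all $i_0$ with $\deg(i_0)\ge p+1$. Functors $F_p$: let $F_0=c_{\mathbb{Z}}:\mathcal{C}\to\mathrm{Ab}$ be the constant functor with value $\mathbb{Z}$, and for $p\ge1$ let $F_p(i_0)=\big(\prod_{i\in(i_0\downarrow\mathcal{C})_{p-1}}F_{p-1}(i)\big)/\lambda_{i_0}(F_{p-1}(i_0))$, where $\lambda_{i_0}=\prod_iF_{p-1}(i_0\to i)$, with $F_p(i_0\to i_1)$ induced by the projection determined by $(i_1\downarrow\mathcal{C})_{p-1}\subseteq(i_0\downarrow\mathcal{C})_{p-1}$. (When an adequate covering family exists, $F_p(i)$ is free abelian, of rank $R^i_p$ if $\deg(i)\ge p$, and $0$ if $\deg(i)<p$.) A homomorphism between free abelian groups is pure if its cokernel is free abelian. A global covering family is a family $\mathcal{K}=\{K_p\}_{p\ge0}$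 with $K_p\subseteq\mathrm{Ob}_p(\mathcal{C})$ such that: for $p\ge1$ the restriction map $\varprojlim F_p\to\prod_{i\in K_p}F_p(i)$ is a monomorphism and the map $\prod_{i\in\mathrm{Ob}_{p-1}(\mathcal{C})\setminus K_{p-1}}F_{p-1}(i)\to\prod_{i\in K_p}F_p(i)$ is pure; and for $p=0$ the restriction map $\varprojlim F_0\to\prod_{i\in K_0}F_0(i)$ is a pure monomorphism. Here the second map sends a family $x$ (extended by $0$ on $K_{p-1}$) to the family whose component at $i_0\in K_p$ is the class in $F_p(i_0)$ of $(x_i)_{i\in(i_0\downarrow\mathcal{C})_{p-1}}$. $\mathcal{K}$ is adequate if for every $p\ge1$ $$\sum_{i\in\mathrm{Ob}_{p-1}(\mathcal{C})}R^i_{p-1}=\sum_{i\in K_{p-1}}R^i_{p-1}+\sum_{i\in K_p}R^i_p,$$ an equality of integers (all these sums being finite). *)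

(* Defs.v *)
From HB Require Import structures.
From Stdlib Require Import Relations.
From mathcomp Require Import all_boot all_order all_algebra ring_quotient.
From mathcomp Require Import all_classical all_reals all_analysis.

Set Implicit Arguments.
Unset Strict Implicit.
Unset Printing Implicit Defensive.

Import Order.TTheory GRing.Theory Num.Theory.
Import numFieldNormedType.Exports.

Local Open Scope classical_set_scope.
Local Open Scope ring_scope.

Section DependentProduct.
Variables (I : Type) (T : I -> zmodType).

Definition dprod : Type := forall i, T i.

HB.instance Definition _ := Choice.copy dprod (forall i, T i).

Let zero : dprod := fun=> 0.
Let opp (x : dprod) : dprod := fun i => - x i.
Let add (x y : dprod) : dprod := fun i => x i + y i.

Let addA : associative add.
Proof. by move=> x y z; apply: functional_extensionality_dep => i; exact: addrA. Qed.
Let addC : commutative add.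
Proof. by move=> x y; apply: functional_extensionality_dep => i; exact: addrC. Qed.
Let add0 : left_id zero add.
Proof. by move=> x; apply: functional_extensionality_dep => i; exact: add0r. Qed.
Let addN : left_inverse zero opp add.
Proof. by move=> x; apply: functional_extensionality_dep => i; exact: addNr. Qed.

HB.instance Definition _ := GRing.isZmodule.Build dprod addA addC add0 addN.

End DependentProduct.

Section Subgroup.
Variables (B : zmodType) (P : zmodClosed B).
Definition subgroup : Type := {x : B | x \in P}.
HB.instance Definition _ := SubChoice.on subgroup.
HB.instance Definition _ := [SubChoice_isSubZmodule of subgroup by <:].
End Subgroup.

Section Kernel.
Variables (A B : zmodType) (f : {additive A -> B}).

Definition ker_pred : {pred A} := fun x => f x == 0.

Let ker_closed : zmod_closed ker_pred.
Proof.
split; first by rewrite unfold_in /ker_pred raddf0.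
move=> x y; rewrite !unfold_in /ker_pred raddfB => /eqP-> /eqP->.
by rewrite subr0.
Qed.

HB.instance Definition _ := GRing.isZmodClosed.Build A ker_pred ker_closed.

Definition kernel : zmodType := subgroup ker_pred.

End Kernel.

Section Cokernel.
Variables (A B : zmodType) (f : {additive A -> B}).

Definition im_pred : {pred B} := fun y => `[< exists x, f x = y >].

Let im_closed : zmod_closed im_pred.
Proof.
split; first by apply/asboolP; exists 0; rewrite raddf0.
move=> _ _ /asboolP[x <-] /asboolP[y <-]; apply/asboolP.
by exists (x - y); rewrite raddfB.
Qed.

HB.instance Definition _ := GRing.isZmodClosed.Build B im_pred im_closed.

Definition coker : zmodType := Quotient.quot im_pred.

Definition coker_pi : {additive B -> coker} := \pi_(Quotient.quot im_pred)%qT.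

Lemma coker_piP x y :
  coker_pi x = coker_pi y <-> exists a, f a = x - y.
Proof.
split=> [/eqP|[a fa]]; last apply/eqP; rewrite -Quotient.idealrBE.
  by move=> /asboolP.
by apply/asboolP; exists a.
Qed.

Lemma coker_repr (c : coker) : exists x, coker_pi x = c.
Proof. by exists (repr c); exact: reprK. Qed.

End Cokernel.

Section CokernelMap.
Variables (A B A' B' : zmodType).
Variables (f : {additive A -> B}) (f' : {additive A' -> B'}).
Variables (g : {additive B -> B'}).
Hypothesis gf : forall x, exists x', f' x' = g (f x).

Definition coker_map_fun (c : coker f) : coker f' := coker_pi f' (g (repr c)).

Lemma coker_map_funE x : coker_map_fun (coker_pi f x) = coker_pi f' (g x).
Proof.
apply/coker_piP; have /coker_piP[a fa] :
  coker_pi f (repr (coker_pi f x)) = coker_pi f x by exact: reprK.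
by have [a' fa'] := gf a; exists a'; rewrite fa' fa raddfB.
Qed.

Let coker_map_additive : zmod_morphism coker_map_fun.
Proof.
move=> c c'; have [x <-] := coker_repr c; have [x' <-] := coker_repr c'.
by rewrite -raddfB !coker_map_funE !raddfB.
Qed.

HB.instance Definition _ :=
  GRing.isZmodMorphism.Build (coker f) (coker f') coker_map_fun
    coker_map_additive.

Definition coker_map : {additive coker f -> coker f'} := coker_map_fun.

Lemma coker_mapE x : coker_map (coker_pi f x) = coker_pi f' (g x).
Proof. exact: coker_map_funE. Qed.

End CokernelMap.

Definition is_basis (A : zmodType) (B : set A) : Prop :=
  (forall x : A, exists (s : seq A) (c : A -> int),
      (forall b, b \in s -> B b) /\ x = \sum_(b <- s) b *~ c b) /\
  (forall (s : seq A) (c : A -> int), uniq s -> (forall b, b \in s -> B b) ->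
      \sum_(b <- s) b *~ c b = 0 -> forall b, b \in s -> c b = 0).

Definition free_abelian (A : zmodType) : Prop := exists B : set A, is_basis B.

(* A notion for homomorphisms between free abelian groups: [f] need not be
   injective, only its cokernel is constrained. *)
Definition pure (A B : zmodType) (f : {additive A -> B}) : Prop :=
  free_abelian (coker f).

Definition isomorphic (A B : zmodType) : Prop :=
  exists f : {additive A -> B}, bijective f.

Section Simplex.
Variable R : realType.

Definition std_simplex n : set 'rV[R]_n.+1 :=
  [set t | (forall i, 0 <= t 0 i) /\ \sum_i t 0 i = 1].

Definition simplex n : topologicalType := set_type (@std_simplex n).

Definition simplex_map_fun m n (h : 'I_m.+1 -> 'I_n.+1) (t : 'rV[R]_m.+1) :
  'rV[R]_n.+1 := \row_j \sum_(i | h i == j) t 0 i.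

Lemma simplex_map_subproof m n (h : 'I_m.+1 -> 'I_n.+1) (t : simplex m) :
  simplex_map_fun h (val t) \in @std_simplex n.
Proof.
case: t => t /= /set_mem[t0 t1]; apply/mem_set; split=> [j|].
  by rewrite mxE; exact: sumr_ge0.
rewrite -t1 (partition_big h xpredT)//=.
by apply: eq_bigr => j _; rewrite mxE.
Qed.

(* The affine map sending the vertex [i] to the vertex [h i]. *)
Definition simplex_map m n (h : 'I_m.+1 -> 'I_n.+1) (t : simplex m) :
  simplex n :=
  exist (fun u => u \in @std_simplex n) _ (simplex_map_subproof h t).

Lemma simplex_map_continuous m n (h : 'I_m.+1 -> 'I_n.+1) :
  continuous (simplex_map h).
Proof.
apply: continuous_comp_initial => t U [P nP sPU].
have cj j : (fun u : simplex m => \sum_(i | h i == j) val u 0 i) @ t -->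
    (\sum_(i | h i == j) val t 0 i : R).
  apply: cvg_big => [||i _]; first by move=> z; exact: add_continuous.
    exact: nbhs_filter.
  have vt : (val : simplex m -> 'rV[R]_m.+1) u @[u --> t] --> val t.
    exact: initial_continuous.
  exact: (cvg_comp _ _ vt (@coord_continuous R 1 m.+1 0 i (val t))).
have Ft : Filter (nbhs t) by exact: nbhs_filter.
have Pt j : nbhs t
    [set u : simplex m | P 0 j (\sum_(i | h i == j) val u 0 i)].
  by apply: cj; have := nP 0 j; rewrite /= mxE.
apply: filterS (filter_forall Ft Pt) => u Pu; apply: sPU => i j.
by rewrite ord1 mxE; exact: Pu.
Qed.

HB.instance Definition _ m n (h : 'I_m.+1 -> 'I_n.+1) :=
  isContinuous.Build (simplex m) (simplex n) (simplex_map h)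
    (@simplex_map_continuous m n h).

End Simplex.

Section SingularCohomology.
Variables (R : realType) (X : topologicalType).

Definition singular_simplex n : Type := continuousType (simplex R n) X.

Definition face n (s : singular_simplex n.+1) (i : 'I_n.+2) :
  singular_simplex n := s \o simplex_map (lift i).

(* [cochain n] is the group of homomorphisms from the free abelian group on the
   singular [n]-simplices to the integers. *)
Definition cochain n : zmodType := singular_simplex n -> int.

Definition coboundary_fun n (c : cochain n) : cochain n.+1 :=
  fun s => \sum_(i < n.+2) (-1) ^+ i * c (face s i).

Let coboundary_additive n : zmod_morphism (@coboundary_fun n).
Proof.
move=> c c'; apply/funext => s; rewrite /coboundary_fun.
by rewrite [RHS]/GRing.add/= /GRing.opp/= -sumrB; apply: eq_bigr => i _; rewrite mulrBr.
Qed.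

HB.instance Definition _ n :=
  GRing.isZmodMorphism.Build (cochain n) (cochain n.+1) (@coboundary_fun n)
    (@coboundary_additive n).

Definition coboundary n : {additive cochain n -> cochain n.+1} :=
  @coboundary_fun n.

Definition is_coboundary n : cochain n -> Prop :=
  match n with
  | 0%N => fun c => c = 0
  | m.+1 => fun c => exists b, coboundary m b = c
  end.

(* As coboundaries are cocycles, [cobound_pred] is the whole group of
   coboundaries; it is trivial for [n = 0]. *)
Definition cobound_pred n : {pred kernel (coboundary n)} :=
  fun z => `[< is_coboundary (val z) >].

Let cobound_closed n : zmod_closed (@cobound_pred n).
Proof.
split=> [|x y]; rewrite !unfold_in.
  apply/asboolP; rewrite raddf0; case: n => [//|m]; exists 0.
  by rewrite raddf0.
move=> /asboolP bx /asboolP yb; apply/asboolP; rewrite raddfB.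
case: n x y bx yb => [|m] x y /=; first by move=> -> ->; rewrite subr0.
by move=> [b <-] [b' <-]; exists (b - b'); rewrite raddfB.
Qed.

HB.instance Definition _ n :=
  GRing.isZmodClosed.Build (kernel (coboundary n)) (@cobound_pred n)
    (@cobound_closed n).

Definition cohomology n : zmodType := Quotient.quot (@cobound_pred n).

Definition acyclic : Prop :=
  forall j, (1 <= j)%N -> forall x : cohomology j, x = 0.

End SingularCohomology.

Section Realization.
Variables (R : realType) (d : Order.disp_t) (C : porderType d).

Definition monotone m n (h : 'I_m.+1 -> 'I_n.+1) : Prop :=
  forall i j : 'I_m.+1, (i <= j)%N -> (h i <= h j)%N.

Definition nerve_set n : set ('I_n.+1 -> C) :=
  [set s | forall i j : 'I_n.+1, (i <= j)%N -> (s i <= s j)%O].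

Definition nerve n : choiceType := set_type (@nerve_set n).

Lemma nerve_map_subproof m n (h : 'I_m.+1 -> 'I_n.+1) (hm : monotone h)
  (s : nerve n) : val s \o h \in @nerve_set m.
Proof.
case: s => s /= /set_mem smon; apply/mem_set => i j ij.
by apply: smon; exact: hm.
Qed.

Definition nerve_map m n (h : 'I_m.+1 -> 'I_n.+1) (hm : monotone h)
  (s : nerve n) : nerve m :=
  exist (fun u => u \in @nerve_set m) _ (nerve_map_subproof hm s).

(* The disjoint union of one standard simplex for each simplex of the nerve. *)
Definition cells : topologicalType :=
  {s : {n : nat & nerve n} & simplex R (tag s)}.

Definition cell n (s : nerve n) (t : simplex R n) : cells :=
  existT (fun s : {n : nat & nerve n} => simplex R (tag s))
    (existT nerve n s) t.

(* The identifications defining the realization of the simplicial set [nerve],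
   for all monotone maps, that is for faces and degeneracies at once. *)
Inductive glue : cells -> cells -> Prop :=
  Glue m n (h : 'I_m.+1 -> 'I_n.+1) (hm : monotone h) (s : nerve n)
    (t : simplex R m) :
    glue (cell (nerve_map hm s) t) (cell s (simplex_map h t)).

Definition glue_rel : rel cells :=
  fun x y => `[< clos_refl_sym_trans cells glue x y >].

Let glue_rel_equiv : equiv_class_of glue_rel.
Proof.
split=> [x|x y|y x z].
- by apply/asboolP; exact: rst_refl.
- by apply/asboolP/asboolP; exact: rst_sym.
- move=> /asboolP xy /asboolP yz; apply/asboolP; exact: rst_trans xy yz.
Qed.

Canonical glue_rel_equivRel := EquivRelPack glue_rel_equiv.

Definition realization : topologicalType :=
  quotient_topology {eq_quot glue_rel}%qT.

End Realization.

Section GradedPoset.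
Variables (d : Order.disp_t) (C : porderType d).

Definition precedes (i j : C) : Prop :=
  (i < j)%O /\ ~ (exists k : C, (i < k)%O /\ (k < j)%O).

Definition maximal (i : C) : Prop := ~ (exists j : C, (i < j)%O).

Definition zigzag (S : set C) : C -> C -> Prop :=
  clos_refl_sym_trans C (fun i j => [/\ S i, S j & (i <= j)%O]).

Definition connected_poset (S : set C) : Prop :=
  S !=set0 /\ forall i j, S i -> S j -> zigzag S i j.

Definition components : set (set C) :=
  [set A | exists i, A = [set j | zigzag setT i j]].

Variable deg : C -> nat.

Definition ob (n : nat) : set C := [set i | deg i = n].

Definition above (i : C) (n : nat) : set C :=
  [set j | (i <= j)%O /\ deg j = n].

Definition strictly_above (i : C) : set C := [set j | (i < j)%O].

(* Boundedness above is implied, the degree being a natural number. *)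
Record graded_poset : Prop := GradedPoset {
  deg_decreasing : forall i j : C, (i < j)%O -> (deg j < deg i)%N;
  deg_precedes : forall i j, precedes i j -> deg i = (deg j).+1;
  deg_zero : exists i, deg i = 0%N;
  deg_maximal : forall i j, maximal i -> maximal j -> deg i = deg j;
  above_finite : forall i n, finite_set (above i n)
}.

Definition bounded_below : Prop := exists N, forall i, (deg i <= N)%N.

Record covering_family (J : C -> nat -> set C) : Prop := CoveringFamily {
  covering_sub : forall i p, (p <= deg i)%N -> J i p `<=` above i p;
  covering_cover : forall i p, (p < deg i)%N ->
    \bigcup_(j in J i p.+1) above j p = above i p;
  covering_mono : forall i p, (p < deg i)%N ->
    forall j, J i p.+1 j -> J j p `<=` J i p
}.

(* The integers usually written R^i_p; [rk p i] is only meaningful for [p <= deg i]. *)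
Fixpoint rk (p : nat) (i : C) : int :=
  match p with
  | 0%N => 1
  | q.+1 => \sum_(j \in above i q) rk q j - rk q i
  end.

Record adequate_covering_family (J : C -> nat -> set C) : Prop :=
  AdequateCoveringFamily {
  adequate_covering : covering_family J;
  adequate_connected : forall i, (2 <= deg i)%N ->
    connected_poset (strictly_above i);
  adequate_rank : forall p i, (p.+1 <= deg i)%N ->
    rk p i = \sum_(j \in J i p) rk p j
}.

Record functor := Functor {
  fobj :> C -> zmodType;
  fmap : forall i j : C, (i <= j)%O -> {additive fobj i -> fobj j};
  fmap_id : forall i (h : (i <= i)%O) x, fmap h x = x;
  fmap_comp : forall i j k (h : (i <= j)%O) (h' : (j <= k)%O)
    (h'' : (i <= k)%O) x, fmap h'' x = fmap h' (fmap h x)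
}.

Definition const_functor (A : zmodType) : functor :=
  @Functor (fun=> A) (fun _ _ _ => idfun)
    (fun _ _ _ => erefl) (fun _ _ _ _ _ _ _ => erefl).

Definition prod_on (F : functor) (S : set C) : zmodType :=
  dprod (fun i : S => F (val i)).

Section Limit.
Variable F : functor.

Definition compatible : {pred dprod F} :=
  fun x => `[< forall i j (h : (i <= j)%O), fmap F h (x i) = x j >].

Let compatible_closed : zmod_closed compatible.
Proof.
split; first by apply/asboolP => i j h; rewrite raddf0.
move=> x y /asboolP cx /asboolP cy; apply/asboolP => i j h.
by rewrite raddfB cx cy.
Qed.

HB.instance Definition _ :=
  GRing.isZmodClosed.Build (dprod F) compatible compatible_closed.

Definition limit : zmodType := subgroup compatible.

Definition limit_restr_fun (S : set C) (x : limit) : prod_on F S :=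
  fun i => val x (val i).

Let limit_restr_additive S : zmod_morphism (@limit_restr_fun S).
Proof. by []. Qed.

HB.instance Definition _ S :=
  GRing.isZmodMorphism.Build limit (prod_on F S) (@limit_restr_fun S)
    (@limit_restr_additive S).

Definition limit_restr (S : set C) : {additive limit -> prod_on F S} :=
  @limit_restr_fun S.

End Limit.

(* The passage from the functor of index [p] to that of index [p.+1]: the
   cokernel of [lambda], on which the projections between the products induce
   the maps. *)
Section NextFunctor.
Variables (F : functor) (p : nat).

Lemma above_le i (j : above i p) : (i <= val j)%O.
Proof. by case: j => j /= /set_mem[]. Qed.

Lemma above_subset i j : (i <= j)%O -> above j p `<=` above i p.
Proof. by move=> ij k [jk dk]; split => //; exact: le_trans jk. Qed.

Definition lambda_fun i (x : F i) : prod_on F (above i p) :=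
  fun j => fmap F (above_le j) x.

Let lambda_additive i : zmod_morphism (@lambda_fun i).
Proof.
by move=> x y; apply: functional_extensionality_dep => j; exact: raddfB.
Qed.

HB.instance Definition _ i :=
  GRing.isZmodMorphism.Build (F i) (prod_on F (above i p)) (@lambda_fun i)
    (@lambda_additive i).

Definition lambda i : {additive F i -> prod_on F (above i p)} := @lambda_fun i.

Definition above_inj i j (h : (i <= j)%O) (k : above j p) : above i p :=
  exist _ (val k) (mem_set (above_subset h (set_mem (valP k)))).

Definition above_proj_fun i j (h : (i <= j)%O) (x : prod_on F (above i p)) :
  prod_on F (above j p) := fun k => x (above_inj h k).

Let above_proj_additive i j (h : (i <= j)%O) :
  zmod_morphism (above_proj_fun h).
Proof. by []. Qed.

HB.instance Definition _ i j (h : (i <= j)%O) :=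
  GRing.isZmodMorphism.Build (prod_on F (above i p)) (prod_on F (above j p))
    (above_proj_fun h) (above_proj_additive h).

Definition above_proj i j (h : (i <= j)%O) :
  {additive prod_on F (above i p) -> prod_on F (above j p)} :=
  above_proj_fun h.

Lemma above_proj_lambda i j (h : (i <= j)%O) (x : F i) :
  exists y, lambda j y = above_proj h (lambda i x).
Proof.
exists (fmap F h x); apply: functional_extensionality_dep => k.
by symmetry; exact: fmap_comp.
Qed.

Definition next_obj (i : C) : zmodType := coker (lambda i).

Definition next_map i j (h : (i <= j)%O) : {additive next_obj i -> next_obj j} :=
  coker_map (above_proj_lambda h).

Lemma next_mapE i j (h : (i <= j)%O) x :
  next_map h (coker_pi (lambda i) x) = coker_pi (lambda j) (above_proj h x).
Proof. exact: coker_mapE. Qed.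

Let next_map_id i (h : (i <= i)%O) x : next_map h x = x.
Proof.
have [y <-] := coker_repr x; rewrite next_mapE; apply: congr1.
apply: functional_extensionality_dep => -[k hk].
transitivity (y (above_inj h (exist _ k hk))); first by [].
rewrite /above_inj /=; move: (mem_set _) => hk'.
by rewrite (bool_irrelevance hk' hk).
Qed.

Let next_map_comp i j k (h : (i <= j)%O) (h' : (j <= k)%O) (h'' : (i <= k)%O)
  x : next_map h'' x = next_map h' (next_map h x).
Proof.
have [y <-] := coker_repr x; rewrite !next_mapE; apply: congr1.
apply: functional_extensionality_dep => l.
transitivity (y (above_inj h'' l)); first by [].
transitivity (y (above_inj h (above_inj h' l))); last by [].
rewrite /above_inj /=; move: (mem_set _) (mem_set _) => h1 h2.
by rewrite (bool_irrelevance h1 h2).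
Qed.

Definition next_functor : functor :=
  @Functor next_obj next_map next_map_id next_map_comp.

End NextFunctor.

Fixpoint FF (p : nat) : functor :=
  match p with
  | 0%N => const_functor int
  | q.+1 => next_functor (FF q) q
  end.

Definition extend0 (F : functor) (S : set C) (x : prod_on F S) (i : C) : F i :=
  match pselect (i \in S) with
  | left h => x (exist _ i h)
  | right _ => 0
  end.

Lemma extend0B (F : functor) (S : set C) (x y : prod_on F S) (i : C) :
  extend0 (x - y) i = extend0 x i - extend0 y i.
Proof. by rewrite /extend0; case: pselect => // _; rewrite subr0. Qed.

(* The map from the product over [ob p `\` K p] to the product over [K p.+1]:
   extension by [0], followed by the class in the cokernel of [lambda]. *)
Section GlobalMap.
Variables (K : nat -> set C) (p : nat).

Definition global_map_fun (x : prod_on (FF p) (ob p `\` K p)) :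
  prod_on (FF p.+1) (K p.+1) :=
  fun i => coker_pi (lambda (FF p) p (val i))
             (fun j : above (val i) p => extend0 x (val j)).

Let global_map_additive : zmod_morphism global_map_fun.
Proof.
move=> x y; apply: functional_extensionality_dep => i.
rewrite /global_map_fun [RHS]/GRing.add/= /GRing.opp/= -raddfB.
apply: (congr1 (coker_pi _)); apply: functional_extensionality_dep => j.
exact: extend0B.
Qed.

HB.instance Definition _ := GRing.isZmodMorphism.Build
  (prod_on (FF p) (ob p `\` K p)) (prod_on (FF p.+1) (K p.+1)) global_map_fun
  global_map_additive.

Definition global_map :
  {additive prod_on (FF p) (ob p `\` K p) -> prod_on (FF p.+1) (K p.+1)} :=
  global_map_fun.

End GlobalMap.

Record global_covering_family (K : nat -> set C) : Prop :=
  GlobalCoveringFamily {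
  global_sub : forall p, K p `<=` ob p;
  global_mono : forall p, injective (limit_restr (FF p.+1) (K p.+1));
  global_pure : forall p, pure (global_map K p);
  global_mono0 : injective (limit_restr (FF 0%N) (K 0%N));
  global_pure0 : pure (limit_restr (FF 0%N) (K 0%N))
}.

(* [\sum_(i \in A) f i] is [0] by convention when [f] has infinite support on
   [A], so the finiteness of the sums has to be required. *)
Record adequate_global_covering_family (K : nat -> set C) : Prop :=
  AdequateGlobalCoveringFamily {
  adequate_global : global_covering_family K;
  adequate_finite : forall p, finite_set [set i | ob p i /\ rk p i <> 0];
  adequate_sum : forall p,
    \sum_(i \in ob p) rk p i =
    \sum_(i \in K p) rk p i + \sum_(i \in K p.+1) rk p.+1 i
}.

End GradedPoset.

Arguments components {d} C.
Arguments realization R {d} C.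

(* Main.v *)
Require Import Defs.
From mathcomp Require Import all_boot all_order all_algebra.
From mathcomp Require Import all_classical all_reals all_analysis.
From HB Require Import structures.
From Stdlib Require Import Relations.
From mathcomp Require Import ring_quotient ring lra zify.
Require Import Defs.

(** Both sides of the equivalence hold under the hypotheses. The sequences
    0 -> F_p -> prod_(above i p) F_p -> F_(p+1) -> 0 are exact, the middle functor
    being acyclic with limit prod_(Ob_p) F_p. By induction on p, conditions (a)
    and (b) make F_p(i) -> prod_(J i p) F_p injective and pure, hence bijective by
    equality of ranks, so that F_(p+1)(i) is free of the expected rank. In the same
    way the family K gives prod_(Ob_p \ K_p) F_p = lim F_(p+1) = prod_(K_(p+1)) F_(p+1),
    so lim F_(p+1) is a quotient of prod_(Ob_p) F_p and dimension shifting kills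
    the cohomology of the constant functor in positive degrees; for p = 0, lim F_0
    restricts isomorphically to Z^(K_0), i.e. K_0 meets each component once.

    Singular cochains are compared with cochains on tuples of elements of chains of
    C. Choose for each point x of |C| a vertex v(x) where a barycentric coordinate of
    x is large. A singular simplex s is fine if v(s(u)) is in the support of s(t) for
    all t, u. A fine simplex is homotopic, through straight lines in barycentric
    coordinates, to the affine simplex spanned by the v's of its corners, so a
    cocycle is cohomologous to one that vanishes on fine simplices. Coordinates being
    uniformly continuous along a singular simplex, iterated barycentric subdivision
    makes it fine, and the subdivision homotopies sum up to a cochain bounding such a
    cocycle. *)

Set Implicit Arguments.
Unset Strict Implicit.
Unset Printing Implicit Defensive.

Import Order.TTheory GRing.Theory Num.Theory.
Import numFieldNormedType.Exports.

Local Open Scope classical_set_scope.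
Local Open Scope card_scope.
Local Open Scope ring_scope.

(** * Alternating sums over lists *)

(** Purity and ranks combine because an injective map between free groups of the same finite rank
    has a finite cokernel, so a torsion-free cokernel vanishes. Tuples in chains are neither sorted
    nor free of repetitions, since the vertices v of the corners of a simplex come in the order of
    the corners; the coboundary is therefore a recursion on lists, shared by the poset, the singular
    simplices and the subdivision. No chain groups are formed: every operator is transposed and acts
    on functions of lists. Two obstacles come from size. As C may be infinite and |C| has the
    quotient topology, continuity of all coordinates does not make a map into |C| continuous;
    finitely many closed simplices must also contain its image, and compactness of the standard
    simplex supplies them. And the number of subdivisions that makes a simplex fine is not bounded
    over all simplices, so the sum of the homotopies is cut off at a place that depends on the
    simplex, the later terms being 0 there. *)

Section ListCoboundary.
Variables (A : Type) (M : zmodType).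
Implicit Types (f g : seq A -> M) (l : seq A).

(** The simplicial coboundary by recursion on the head; [dlt_sum] recovers the alternating sum over
    the faces [del i l]. The complex is augmented: the face of a one-element list is the empty
    list. *)
Fixpoint dlt f l : M :=
  if l is v :: l' then f l' - dlt (fun k => f (v :: k)) l' else 0.

Definition del i l := take i l ++ drop i.+1 l.

Lemma size_del i l : (i < size l)%N -> size (del i l) = (size l).-1.
Proof. by move=> il; rewrite size_cat size_take size_drop il; lia. Qed.

Lemma dlt_ext (P : seq A -> Prop) f g l :
  (forall i, (i < size l)%N -> P (del i l)) ->
  (forall k, P k -> f k = g k) -> dlt f l = dlt g l.
Proof.
elim: l P f g => [//|v l IH] P f g Pl fg /=.
rewrite fg; last by have := Pl 0%N isT; rewrite /del /= drop0.
congr (_ - _); apply: (IH (fun k => P (v :: k))) => [i il|k Pk]; last exact: fg.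
exact: (Pl i.+1).
Qed.

Lemma dltB f g l : dlt (fun k => f k - g k) l = dlt f l - dlt g l.
Proof.
elim: l f g => [|v l IH] f g /=; first by rewrite subrr.
by rewrite IH !opprB addrACA [in RHS]addrACA; congr (_ + _); rewrite addrC.
Qed.

Lemma dlt0 l : dlt (fun=> 0) l = 0.
Proof. by elim: l => //= v l ->; rewrite subr0. Qed.

Lemma dlt_dlt f l : dlt (dlt f) l = 0.
Proof.
elim: l f => [//|v l IH] f /=.
by rewrite dltB IH subr0 subrr.
Qed.

End ListCoboundary.

Lemma dlt_raddf (A : Type) (M N : zmodType) (h : {additive M -> N})
  (f : seq A -> M) l : h (dlt f l) = dlt (fun k => h (f k)) l.
Proof. by elim: l f => [|v l IH] f /=; rewrite ?raddf0// raddfB IH. Qed.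

Lemma dlt_map (A B : Type) (M : zmodType) (h : A -> B) (f : seq B -> M) l :
  dlt f (map h l) = dlt (fun k => f (map h k)) l.
Proof. by elim: l f => [//|v l IH] f /=; rewrite IH. Qed.

Lemma del_map (A B : Type) (h : A -> B) i l : del i (map h l) = map h (del i l).
Proof. by rewrite /del map_cat map_take map_drop. Qed.

Lemma dlt_sum (A : Type) (f : seq A -> int) l :
  dlt f l = \sum_(i < size l) (-1) ^+ i * f (del i l).
Proof.
elim: l f => [|v l IH] f; first by rewrite big_ord0.
rewrite big_ord_recl /= mul1r {1}/del /= drop0; congr (_ + _).
rewrite IH -sumrN; apply: eq_bigr => i _.
by rewrite exprS !mulN1r mulNr.
Qed.

Section Prism.
Variables (A : Type).
Implicit Types (f g : seq A -> int).

(** For pairs (a_i, b_i) this is the sum of (-1)^i f(a_0, ..., a_i, b_i, ..., b_n), the transpose of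
    the prism operator from the [fst] side to the [snd] side. *)
Fixpoint prism f (l : seq (A * A)) : int :=
  if l is ab :: l' then
    f (ab.1 :: ab.2 :: map snd l') - prism (fun k => f (ab.1 :: k)) l'
  else 0.

Lemma eq_prism f g l : f =1 g -> prism f l = prism g l.
Proof.
elim: l f g => //= v l IH f g fg; rewrite fg; congr (_ - _).
by apply: IH => k; exact: fg.
Qed.

Lemma prismB f g l : prism (fun k => f k - g k) l = prism f l - prism g l.
Proof.
elim: l f g => [|v l IH] f g /=; first by rewrite subrr.
by rewrite IH; lia.
Qed.

Lemma prism_dlt f l :
  prism (dlt f) l + dlt (prism f) l = f (map snd l) - f (map fst l).
Proof.
elim: l f => [|[a b] l IH] f /=; first by rewrite addr0 subrr.
rewrite dltB prismB -(dlt_map snd (fun k => f (a :: b :: k))).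
by have := IH (fun k => f (a :: k)); lia.
Qed.

End Prism.

Lemma prism_map (A B : Type) (h : A -> B) (f : seq B -> int) l :
  prism (fun k => f (map h k)) l = prism f (map (fun ab => (h ab.1, h ab.2)) l).
Proof.
elim: l f => [//|[a b] l IH] f /=; rewrite -IH -!map_comp; congr (f _ - _).
Qed.

(* [sd b f] and [hsd b f] are the transposes of the barycentric subdivision
   Sd l = b(l) :: Sd (d l) and of the homotopy T l = b(l) :: (l - T (d l)),
   the first argument bounding the size of the list. *)
Section Subdivision.
Variables (A : Type) (b : seq A -> A).
Implicit Types (f g : seq A -> int).

Fixpoint sdn n f (l : seq A) : int :=
  match n, l with
  | n'.+1, _ :: _ => dlt (sdn n' (fun k => f (b l :: k))) l
  | _, _ => f [::]
  end.

Fixpoint hsdn n f (l : seq A) : int :=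
  match n, l with
  | n'.+1, _ :: _ => f (b l :: l) - dlt (hsdn n' (fun k => f (b l :: k))) l
  | _, _ => 0
  end.

Definition sd f l := sdn (size l) f l.
Definition hsd f l := hsdn (size l) f l.

Lemma sd_cons f l : (0 < size l)%N ->
  sd f l = dlt (sd (fun k => f (b l :: k))) l.
Proof.
case: l => // v l _; apply: (@dlt_ext _ _ (fun k => size k = size l)) => [i il|k kl].
  by rewrite size_del.
by rewrite /sd kl.
Qed.

Lemma hsd_cons f l : (0 < size l)%N ->
  hsd f l = f (b l :: l) - dlt (hsd (fun k => f (b l :: k))) l.
Proof.
case: l => // v l _; congr (_ - _).
apply: (@dlt_ext _ _ (fun k => size k = size l)) => [i il|k kl].
  by rewrite size_del.
by rewrite /hsd kl.
Qed.

Lemma eq_sd f g l : f =1 g -> sd f l = sd g l.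
Proof. by move=> fg; have -> : f = g by apply/funext. Qed.

Lemma eq_hsd f g l : f =1 g -> hsd f l = hsd g l.
Proof. by move=> fg; have -> : f = g by apply/funext. Qed.

Lemma list_size_ind (P : seq A -> Prop) :
  (forall l, (forall k, (size k < size l)%N -> P k) -> P l) -> forall l, P l.
Proof.
move=> IH l; have [n] := ubnP (size l); elim: n l => // n IHn l ln.
by apply: IH => k kl; apply: IHn; lia.
Qed.

Lemma sd_additive l : forall f g, sd (fun k => f k - g k) l = sd f l - sd g l.
Proof.
elim/list_size_ind: l => l IH f g; have [l0|l0] := posnP (size l).
  by rewrite (size0nil l0).
rewrite !sd_cons// -dltB.
apply: (@dlt_ext _ _ (fun k => size k < size l)%N) => [i il|k kl].
  by rewrite size_del//; lia.
exact: IH.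
Qed.

Lemma hsd_additive l : forall f g, hsd (fun k => f k - g k) l = hsd f l - hsd g l.
Proof.
elim/list_size_ind: l => l IH f g; have [l0|l0] := posnP (size l).
  by rewrite (size0nil l0).
rewrite !hsd_cons//.
have -> : dlt (hsd (fun k => f (b l :: k) - g (b l :: k))) l =
   dlt (hsd (fun k => f (b l :: k))) l - dlt (hsd (fun k => g (b l :: k))) l.
  rewrite -dltB.
  apply: (@dlt_ext _ _ (fun k => size k < size l)%N) => [i il|k kl].
    by rewrite size_del//; lia.
  exact: IH.
lia.
Qed.

Lemma sd_dlt l : forall f, sd (dlt f) l = dlt (sd f) l.
Proof.
elim/list_size_ind: l => l IH f; have [l0|l0] := posnP (size l).
  by rewrite (size0nil l0).
rewrite sd_cons//= [LHS](@dlt_ext _ _ (fun k => size k < size l)%N _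
    (fun k => sd f k - dlt (sd (fun k => f (b l :: k))) k)).
- by rewrite dltB dlt_dlt subr0.
- by move=> i il; rewrite size_del//; lia.
- by move=> k kl; rewrite sd_additive IH.
Qed.

Lemma hsd_dlt l : forall f, (0 < size l)%N ->
  hsd (dlt f) l + dlt (hsd f) l = f l - sd f l.
Proof.
elim/list_size_ind: l => l IH f l0.
rewrite hsd_cons//=; set g := fun k => f (b l :: k).
rewrite [X in _ - X + _](@dlt_ext _ _ (fun k => size k < size l)%N _
    (fun k => hsd f k - (if size k == 0 then 0 else g k - sd g k - dlt (hsd g) k))); last 2 first.
- by move=> i il; rewrite size_del//; lia.
- move=> k kl; rewrite hsd_additive; congr (_ - _).
  have [k0|k0] := eqVneq (size k) 0%N; first by rewrite (size0nil k0).
  by have := IH k kl g; rewrite lt0n k0 => /(_ isT); lia.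
(* The only face of a one-element list is empty and those of a longer list are not, so the
   conditional is resolved in each case; in the second, [dlt_dlt] removes [dlt (hsd g)]. *)
rewrite dltB [X in _ - (_ - X)](_ : _ = dlt g l - dlt (sd g) l); last first.
  case: l l0 IH @g => // v [|w l] _ IH g.
    by rewrite /= /sd /= subrr.
  rewrite [LHS](@dlt_ext _ _ (fun k => size k = (size l).+1) _
    (fun k => g k - sd g k - dlt (hsd g) k)).
  - by rewrite !dltB dlt_dlt subr0.
  - by move=> i il; rewrite size_del.
  - by move=> k ->.
by rewrite (sd_cons f l0) -/g; lia.
Qed.

End Subdivision.

(** * Free groups of finite rank *)

(** An arbitrary finite index type, rather than ['I_n], lets a product be indexed by a sigma type
    without renumbering. *)
Definition has_rank (A : zmodType) (n : nat) : Prop :=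
  exists (J : finType) (f : {additive A -> (J -> int)}), #|J| = n /\ bijective f.

Lemma bij_of (A B : Type) (f : A -> B) : injective f ->
  (forall y, exists x, f x = y) -> bijective f.
Proof.
move=> finj fsurj; pose g y := projT1 (cid (fsurj y)).
have gK : cancel g f by move=> y; rewrite /g; case: cid.
by exists g => // x; apply: finj; rewrite gK.
Qed.

Lemma has_rank_iso (A B : zmodType) (f : {additive A -> B}) n :
  bijective f -> has_rank A n -> has_rank B n.
Proof.
move=> [g fK gK] [J [h [Jn hbij]]].
have gB : zmod_morphism g by move=> x y; apply: (can_inj fK); rewrite raddfB !gK.
pose g' : {additive B -> A} := HB.pack g (GRing.isZmodMorphism.Build B A g gB).
exists J, (h \o g' : {additive B -> (J -> int)}); split => //.
by apply: bij_comp => //; exists f.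
Qed.

Lemma has_rank0 (A : zmodType) : has_rank A 0 -> forall x : A, x = 0.
Proof.
move=> [J [f [J0 fbij]]] x; apply: (bij_inj fbij); rewrite raddf0.
apply/funext => j; suff: false by [].
by have := card0_eq J0 j; rewrite inE.
Qed.

Lemma has_rank_torsion (A : zmodType) n (x y : A) m : has_rank A n ->
  (0 < m)%N -> x *+ m = y *+ m -> x = y.
Proof.
move=> [J [f [_ fbij]]] m0 xy; apply: (bij_inj fbij); apply/funext => j.
have := congr1 (fun u => f u j) xy; rewrite !raddfMn !natmulfctE /= => /eqP.
by rewrite -subr_eq0 -mulrnBl mulrn_eq0 subr_eq0 eqn0Ngt m0 => /eqP.
Qed.

Lemma fct_mulrz (I : Type) (w : I -> int) d i : (w *~ d) i = w i * d.
Proof.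
case: d => n; rewrite ?NegzE ?mulrNz -pmulrn natmulfctE /=.
  by rewrite -mulr_natr natz.
by rewrite [LHS]/GRing.opp/= -mulr_natr natz mulrN.
Qed.

(* By the adjugate matrix, the determinant annihilates the cokernel. *)
Lemma has_rank_surj (A B : zmodType) (f : {additive A -> B}) n :
  has_rank A n -> has_rank B n -> injective f ->
  (forall m z x, (0 < m)%N -> f x = z *+ m -> exists x', f x' = z) ->
  forall z, exists x, f x = z.
Proof.
move=> [J [a [Jn abij]]] [K [b [Kn bbij]]] finj fdiv z.
move: (abij) (bbij) => [a' aK a'K] [b' bK b'K].
have a'B x y : a' (x - y) = a' x - a' y by apply: (can_inj aK); rewrite raddfB !a'K.
pose vJ (v : 'rV[int]_n) : J -> int := fun j => v 0 (cast_ord Jn (enum_rank j)).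
pose wK (w : K -> int) : 'rV[int]_n := \row_k w (enum_val (cast_ord (esym Kn) k)).
pose g v := wK (b (f (a' (vJ v)))).
have gB : zmod_morphism g.
  move=> x y; rewrite /g; have -> : vJ (x - y) = vJ x - vJ y.
    by apply/funext => j; rewrite /vJ !mxE.
  by rewrite a'B !raddfB; apply/rowP => k; rewrite !mxE.
pose ga : {additive 'rV[int]_n -> 'rV[int]_n} := HB.pack g
  (GRing.isZmodMorphism.Build _ _ g gB).
pose M : 'M[int]_n := \matrix_(i, j) g (delta_mx 0 i) 0 j.
have gM v : g v = v *m M.
  rewrite {1}[v]row_sum_delta -[g _]/(ga _) raddf_sum mulmx_sum_row.
  apply: eq_bigr => i _; rewrite -[v 0 i]intz scaler_int raddfMz/=.
  by rewrite scaler_int; congr (_ *~ _); apply/rowP => j; rewrite !mxE.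
have wKinj : injective wK.
  move=> w w' /rowP ww; apply/funext => k.
  have := ww (cast_ord Kn (enum_rank k)).
  by rewrite !mxE cast_ordK enum_rankK.
have vJinj : injective vJ.
  move=> v w vw; apply/rowP => i.
  have := congr1 (fun h => h (enum_val (cast_ord (esym Jn) i))) vw.
  by rewrite /vJ enum_valK cast_ordKV.
have ginj : injective g.
  by move=> v w /wKinj/(bij_inj bbij)/finj/(can_inj a'K)/vJinj.
have dM : \det M != 0.
  apply/negP => /det0P[v v0 vM]; case/negP: v0; apply/eqP/ginj.
  by rewrite !gM vM mul0mx.
pose x := wK (b z) *m \adj M.
have gx : g x = wK (b z) *~ \det M.
  by rewrite gM -mulmxA mul_adj_mx mul_mx_scalar -scaler_int intz.
have fx : f (a' (vJ x)) = z *~ \det M.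
  apply: (can_inj bK); apply: wKinj; rewrite -/(g x) gx raddfMz.
  by apply/rowP => k; rewrite -scaler_int !mxE fct_mulrz intz mulrC.
have [m [m0 [x' fx']]] : exists m, (0 < m)%N /\ exists x', f x' = z *+ m.
  case: (\det M) dM fx => [m|m] m0 fx.
    by exists m; split; [rewrite lt0n; apply: contra m0 => /eqP->|eexists; exact: fx].
  exists m.+1; split => //; exists (- a' (vJ x)); rewrite raddfN fx.
  by rewrite NegzE mulrNz opprK.
exact: fdiv fx'.
Qed.

Lemma free_abelian_torsion (A : zmodType) (x : A) m :
  free_abelian A -> (0 < m)%N -> x *+ m = 0 -> x = 0.
Proof.
move=> [B [Bgen Bfree]] m0.
have [s [c [sB ->]]] := Bgen x.
(* The list [s] may repeat elements, while independence speaks of [uniq] lists only; multiplicities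
   are moved into the coefficients. *)
have uE (e : A -> int) : \sum_(b <- s) b *~ e b =
    \sum_(b <- undup s) b *~ (e b * (count_mem b s)%:Z).
  rewrite -big_undup_iterop_count; apply: eq_bigr => b _.
  by rewrite Monoid.iteropE iter_addr addr0 mulrzA.
move=> xm; rewrite uE big1_seq// => b /= bs.
suff -> : c b * (count_mem b s)%:Z = 0 by rewrite mulr0z.
have : c b * (count_mem b s)%:Z * m%:Z = 0.
  apply: (Bfree (undup s) (fun b => c b * (count_mem b s)%:Z * m%:Z)) => //.
  - exact: undup_uniq.
  - by move=> b'; rewrite mem_undup; exact: sB.
  - rewrite -[RHS]xm uE -sumrMnl; apply: eq_bigr => b1 _.
    by rewrite mulrzA -pmulrn.
by move/eqP; rewrite mulf_eq0 => /orP[/eqP//|]; lia.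
Qed.

Lemma dprodB (I : Type) (T : I -> zmodType) (x y : dprod T) i :
  (x - y) i = x i - y i.
Proof. by []. Qed.

Lemma dprodMn (I : Type) (T : I -> zmodType) (x : dprod T) n i :
  (x *+ n) i = x i *+ n.
Proof. by elim: n => [//|n IH]; rewrite !mulrS -IH. Qed.

Section ProductRank.
Variables (I : choiceType) (T : I -> zmodType) (r : I -> nat).
Hypothesis Tr : forall i, has_rank (T i) (r i).

Lemma has_rank_dprod (s : seq I) : uniq s -> (forall i, r i != 0%N -> i \in s) ->
  has_rank (dprod T) (\sum_(i <- s) r i).
Proof.
move=> us rs; pose J i := projT1 (cid (Tr i)).
have J' i := projT2 (cid (Tr i)); pose f i := projT1 (cid (J' i)).
have fP i : #|J i| = r i /\ bijective (f i) := projT2 (cid (J' i)).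
pose g (x : dprod T) : {i : seq_sub s & J (val i)} -> int :=
  fun p => f (val (tag p)) (x (val (tag p))) (tagged p).
have gB : zmod_morphism g.
  by move=> x y; apply/funext => p; rewrite /g dprodB raddfB.
pose ga : {additive dprod T -> ({i : seq_sub s & J (val i)} -> int)} := HB.pack g
  (GRing.isZmodMorphism.Build _ _ g gB).
exists {i : seq_sub s & J (val i)}, ga; split.
  rewrite card_tagged sumnE big_map big_enum /=.
  rewrite (eq_bigr (fun i : seq_sub s => r (val i))); last by move=> i _; rewrite (fP _).1.
  rewrite -(big_map val xpredT r); apply: perm_big; apply: uniq_perm => //.
    by rewrite map_inj_uniq ?index_enum_uniq//; exact: val_inj.
  move=> i; apply/mapP/idP => [[j _ ->]|si]; first exact: valP.
  by exists (SeqSub si) => //; rewrite mem_index_enum.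
have T0 i : i \notin s -> forall x : T i, x = 0.
  move=> si; apply: has_rank0; have := Tr i.
  by have -> : r i = 0%N by apply/eqP; apply: contraNT si => /rs.
apply: bij_of => [x y xy|y].
  apply: functional_extensionality_dep => i.
  have [si|si] := boolP (i \in s); last by rewrite (T0 _ si (x i)) (T0 _ si (y i)).
  apply: (bij_inj (fP i).2); apply/funext => j.
  exact: (congr1 (fun h => h (Tagged (fun i : seq_sub s => J (val i)) (j : J (val (SeqSub si))))) xy).
have fsurj (i : seq_sub s) : exists z : T (val i),
    f (val i) z = fun j => y (Tagged (fun i : seq_sub s => J (val i)) j).
  by have [h hK fK] := (fP (val i)).2; eexists; exact: fK.
exists (fun i => match pselect (i \in s) return T i with
  | left si => projT1 (cid (fsurj (SeqSub si))) | right _ => 0 end).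
apply/funext => -[[i si] j]; rewrite /= /g /=.
case: pselect => [si'|//]; rewrite (bool_irrelevance si' si).
exact: (congr1 (fun h => h j) (projT2 (cid (fsurj (SeqSub si))))).
Qed.

End ProductRank.

(** Passes from ranks in [nat] to the integers [rk] and to the finitely supported sums in which
    adequacy is expressed; [S] itself may be infinite. *)
Lemma has_rank_prod_on d (C : porderType d) (F : functor C) (S : set C)
    (r : C -> int) :
  (forall i, S i -> exists2 n, has_rank (F i) n & r i = n%:Z) ->
  finite_set [set i | S i /\ r i <> 0] ->
  exists2 n, has_rank (prod_on F S) n & \sum_(i \in S) r i = n%:Z.
Proof.
move=> rP fS; have rP' (i : S) : exists2 n, has_rank (F (val i)) n & r (val i) = n%:Z.
  exact: rP (set_mem (valP i)).
pose r' (i : S) := projT1 (cid2 (rP' i)).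
have r'r (i : S) : has_rank (F (val i)) (r' i) by rewrite /r'; case: cid2.
have r'E (i : S) : r (val i) = (r' i)%:Z by rewrite /r'; case: cid2.
have [s0 s0E] := (finite_seqP _).1 fS; pose s := undup s0.
have us : uniq s by exact: undup_uniq.
have sP i : (i \in s) = `[< S i /\ r i <> 0 >].
  have E : (S i /\ r i <> 0) = (i \in s0) by exact: (congr1 (fun A : set C => A i) s0E).
  by rewrite mem_undup; apply/idP/asboolP; rewrite E.
pose s' : seq S := pmap insub s.
have ss' : s = map val s'.
  rewrite pmap_filter; last exact: insubK.
  apply/esym/all_filterP/allP => i; rewrite sP => /asboolP[Si _].
  by rewrite /= isSome_insub; exact: mem_set.
exists (\sum_(i <- s') r' i)%N.
  apply: has_rank_dprod => //; first by rewrite pmap_sub_uniq.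
  move=> i ri0; rewrite mem_pmap_sub sP; apply/asboolP; split.
    exact: set_mem (valP i).
  by rewrite r'E => -[]; apply/eqP.
rewrite (@fsbigE _ _ _ _ _ s)//.
- rewrite ss' big_map (big_morph Posz PoszD (erefl _)).
  by apply: eq_big => [i|i _]; [exact: (valP i)|rewrite r'E].
- by move=> i /=; rewrite sP => /asboolP[].
- move=> i Si; rewrite sP => /asboolP ri; apply: contrapT => ri0.
  exact: ri.
Qed.

(** * The functors F_p *)

Section Functors.
Variables (d : Order.disp_t) (C : porderType d) (deg : C -> nat).

Lemma extend0_in (F : functor C) (S : set C) (x : prod_on F S) (i : S) :
  extend0 x (val i) = x i.
Proof.
rewrite /extend0; case: pselect => [h|]; last by move: (valP i).
by case: i h => i hi h; rewrite (bool_irrelevance h hi).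
Qed.

Lemma extend0_mem (F : functor C) (S : set C) (x : prod_on F S) i (Si : i \in S) :
  extend0 x i = x (exist _ i Si).
Proof. exact: (extend0_in x (exist _ i Si)). Qed.

Lemma extend0_out (F : functor C) (S : set C) (x : prod_on F S) i :
  ~ S i -> extend0 x i = 0.
Proof. by rewrite /extend0; case: pselect => // h; have := set_mem h. Qed.

Lemma fmap_irr (F : functor C) i j (h h' : (i <= j)%O) x : fmap F h x = fmap F h' x.
Proof. by rewrite (bool_irrelevance h h'). Qed.

(** Taking families on all of [C] avoids restricting dependent products; only the values on
    [above deg i p] matter, as [cls_eq] shows. *)
Definition cls (F : functor C) p i (x : dprod F) : next_functor deg F p i :=
  coker_pi (lambda deg F p i) (fun j => x (val j)).

Section Cls.
Variables (F : functor C) (p : nat).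

Lemma cls_surj i (u : next_functor deg F p i) : exists x, cls p i x = u.
Proof.
have [x <-] := coker_repr u; exists (fun j => extend0 x j); congr (coker_pi _ _).
by apply: functional_extensionality_dep => j; exact: extend0_in.
Qed.

Lemma cls_eq i (x x' : dprod F) : cls p i x = cls p i x' <->
  exists y : F i, forall j (h : (i <= j)%O), deg j = p -> fmap F h y = x j - x' j.
Proof.
split=> [/coker_piP[y yE]|[y yE]].
  exists y => j h dj; have ji : j \in above deg i p by apply/mem_set.
  have := congr1 (fun f : prod_on F (above deg i p) => f (exist _ j ji)) yE.
  by apply: etrans; exact: fmap_irr.
apply/coker_piP; exists y; apply: functional_extensionality_dep => j.
by apply: yE; have [] := set_mem (valP j).
Qed.

Lemma cls_map i j (h : (i <= j)%O) x :
  fmap (next_functor deg F p) h (cls p i x) = cls p j x.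
Proof. by rewrite /= next_mapE. Qed.

Lemma clsB i (x y : dprod F) : cls p i (x - y) = cls p i x - cls p i y.
Proof. by rewrite /cls -raddfB. Qed.

Lemma clsD i (x y : dprod F) : cls p i (x + y) = cls p i x + cls p i y.
Proof. by rewrite /cls -raddfD. Qed.

Lemma cls0 i : cls p i (0 : dprod F) = 0.
Proof. by rewrite -(subrr (0 : dprod F)) clsB subrr. Qed.

Lemma clsMn i (x : dprod F) n : cls p i (x *+ n) = cls p i x *+ n.
Proof.
elim: n => [|n IH]; first exact: cls0.
by rewrite !mulrS -IH -clsD.
Qed.

Lemma cls_eq0 i (x : dprod F) : cls p i x = 0 <->
  exists y : F i, forall j (h : (i <= j)%O), deg j = p -> fmap F h y = x j.
Proof.
rewrite -(cls0 i) cls_eq; split=> -[y yE]; exists y => j h dj; rewrite yE//.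
  exact: subr0.
by symmetry; exact: subr0.
Qed.

End Cls.

Variables (J : C -> nat -> set C).
Hypothesis graded : graded_poset deg.
Hypothesis adequate : adequate_covering_family deg J.

Local Notation F := (FF deg).

Lemma deg_le i j : (i <= j)%O -> (deg j <= deg i)%N.
Proof.
rewrite le_eqVlt => /orP[/eqP->//|ij].
exact: ltnW (deg_decreasing graded ij).
Qed.

Lemma deg_eq i j : (i <= j)%O -> deg i = deg j -> i = j.
Proof.
rewrite le_eqVlt => /orP[/eqP//|ij] e.
by have := deg_decreasing graded ij; rewrite e ltnn.
Qed.

(** If [deg i] is below the index of the product, the product is empty; if they agree, [above] is
    reduced to [i] and [lambda] is the identity, so the cokernel is trivial. *)
Lemma FF_low p i (x : F p i) : (deg i < p)%N -> x = 0.
Proof.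
case: p x => // p x; rewrite ltnS => dp.
have [y <-] := cls_surj x; apply/cls_eq0.
have [di|di] := eqVneq (deg i) p; last first.
  by exists 0 => j h; have := deg_le h; lia.
exists (y i) => j h dj; have e : i = j by apply: deg_eq => //; rewrite dj.
by case: _ / e h {dj} => h; rewrite fmap_id.
Qed.

(** The restriction of F_p(i) to the product of the F_p over [J i p] is an isomorphism. *)
Definition covered p i : Prop :=
  (forall x : F p i,
     (forall j (h : (i <= j)%O), J i p j -> fmap (F p) h x = 0) -> x = 0) /\
  (forall z : dprod (F p), exists x : F p i,
     forall j (h : (i <= j)%O), J i p j -> fmap (F p) h x = z j).

Lemma J_above p i j : (p <= deg i)%N -> J i p j -> (i <= j)%O /\ deg j = p.
Proof.
move=> pi; exact: (covering_sub (adequate_covering adequate) pi).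
Qed.

(** Since F_p(i) restricts isomorphically to the product over [J i p], the image of [lambda] is a
    complement of the families vanishing on [J i p]. These families, that is the product over [S],
    are thus isomorphic to F_(p+1)(i), and adequacy identifies [rk p.+1 i] with the sum over [S]. *)
Lemma has_rank_next p i : (p < deg i)%N ->
  (forall j, (p <= deg j)%N -> exists2 n, has_rank (F p j) n & rk deg p j = n%:Z) ->
  covered p i ->
  exists2 n, has_rank (F p.+1 i) n & rk deg p.+1 i = n%:Z.
Proof.
move=> pi Rp [Iinj Isurj].
have finA : finite_set (above deg i p) by exact: above_finite graded i p.
have JA : J i p `<=` above deg i p.
  by apply: (covering_sub (adequate_covering adequate)); exact: ltnW.
pose S := above deg i p `\` J i p.
have [n nS SE] : exists2 n, has_rank (prod_on (F p) S) n &
    \sum_(j \in S) rk deg p j = n%:Z.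
  apply: has_rank_prod_on => [j [[_ dj] _]|]; first by apply: Rp; rewrite dj.
  by apply: sub_finite_set finA => j [[]].
exists n; last first.
  rewrite /= -SE (adequate_rank adequate pi).
  rewrite (fsbigID (J i p)) // setIidr// addrAC subrr add0r.
  by apply: eq_fsbigl.
pose f (x : prod_on (F p) S) : F p.+1 i := cls p i (fun j => extend0 x j).
have fB : zmod_morphism f.
  move=> x y; rewrite /f -clsB; congr (cls _ _ _).
  by apply: functional_extensionality_dep => j; exact: extend0B.
pose fa : {additive prod_on (F p) S -> F p.+1 i} := HB.pack f
  (GRing.isZmodMorphism.Build _ _ f fB).
apply: (has_rank_iso (f := fa)) nS; apply: bij_of => [|u].
  apply: raddf_inj => x /cls_eq0[y yE].
  have y0 : y = 0.
    apply: Iinj => j h Jj; rewrite yE; last exact: (JA _ Jj).2.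
    by apply: extend0_out => -[].
  apply: functional_extensionality_dep => j.
  rewrite -extend0_in; have [[ij dj] _] := set_mem (valP j).
  by rewrite -(yE _ ij dj) y0 raddf0.
have [x <-] := cls_surj u; have [y yE] := Isurj x.
(* The element [y] agrees with [x] on [J i p]; subtracting its image keeps the class of [x] and
   makes the family vanish there. *)
pose z : dprod (F p) := fun j => if pselect (i <= j)%O is left h
  then x j - fmap (F p) h y else 0.
exists (fun j : S => z (val j)); apply/cls_eq.
exists (- y) => j h dj; rewrite raddfN.
have [Jj|Jj] := pselect (J i p j).
  by rewrite extend0_out ?sub0r ?yE// => -[].
have Sj : j \in S by apply/mem_set.
rewrite (extend0_mem _ Sj) /z /=; case: pselect => // h'.
by rewrite (fmap_irr h h') addrAC subrr add0r.
Qed.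

Lemma covered_next p i : (p.+1 < deg i)%N ->
  (forall j, (p < deg j)%N -> exists2 n, has_rank (F p.+1 j) n & rk deg p.+1 j = n%:Z) ->
  (forall j, (p < deg j)%N -> covered p j) ->
  covered p.+1 i.
Proof.
move=> pi Rp Ip.
have pi' : (p < deg i)%N by exact: ltnW.
(* For m = 0 this is injectivity; for m > 0 it is purity, which gives
   surjectivity since the ranks agree. *)
have key m (x : dprod (F p)) (z : C -> dprod (F p)) :
    (forall j, J i p.+1 j -> cls p j x = cls p j (z j) *+ m) ->
    exists w : dprod (F p), cls p i x = cls p i w *+ m.
  move=> xz; have [Iinj Isurj] := Ip i pi'; have [y yE] := Isurj x.
  (* Divisibility by [m] is checked at each [k] above [i], where (a) gives [j] in [J i p.+1] below
     [k]. On [above j p], [x] is the image of [yj] plus [m] times [z j]. By (b), [y] restricts to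
     [x] on [J j p], so injectivity at [j] gives that [y] restricts to [yj + t *+ m], where [t]
     lifts [z j]; the difference of [x] and [y] is then [m] times that of [z j] and [t]. *)
  have wP k : exists w : F p k, forall h : (i <= k)%O, deg k = p ->
      x k - fmap (F p) h y = w *+ m.
    have [ik|ik] := pselect (i <= k)%O; last by exists 0.
    have [dk|dk] := pselect (deg k = p); last by exists 0.
    have [j Jj [jk _]] : (\bigcup_(j in J i p.+1) above deg j p) k.
      by rewrite (covering_cover (adequate_covering adequate) pi').
    have [ij dj] := J_above pi' Jj.
    have := xz j Jj; rewrite -clsMn => /cls_eq[yj yjE].
    have [Jinj Jsurj] := Ip j (eq_ind_r (fun n => p < n)%N (leqnn _) dj).
    have [t tE] := Jsurj (z j).
    have e0 : fmap (F p) ij y - yj - t *+ m = 0.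
      apply: Jinj => l h Jl.
      have [jl dl] : (j <= l)%O /\ deg l = p by apply: J_above Jl; rewrite dj.
      rewrite !raddfB raddfMn -(fmap_comp ij h (le_trans ij h)) yE; last first.
        exact: (covering_mono (adequate_covering adequate) pi' Jj).
      by rewrite yjE// tE// dprodMn opprB addrCA subrr addr0 subrr.
    exists (z j k - fmap (F p) jk t) => h _.
    rewrite (fmap_comp ij jk h) (_ : fmap (F p) ij y = yj + t *+ m); last first.
      by apply/eqP; rewrite -subr_eq0 opprD addrA; apply/eqP.
    rewrite raddfD yjE// raddfMn dprodMn mulrnBl opprD opprB addrA.
    by rewrite [x k + _]addrC subrK.
  exists (fun k => projT1 (cid (wP k))); rewrite -clsMn; apply/cls_eq.
  exists y => k h dk; rewrite dprodMn.
  by rewrite -(projT2 (cid (wP k)) h dk) opprB addrCA subrr addr0.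
have JA : J i p.+1 `<=` above deg i p.+1.
  by apply: (covering_sub (adequate_covering adequate)); exact: ltnW.
have [n nS SE] : exists2 n, has_rank (prod_on (F p.+1) (J i p.+1)) n &
    \sum_(j \in J i p.+1) rk deg p.+1 j = n%:Z.
  apply: has_rank_prod_on => [j /JA[_ dj]|]; first by apply: Rp; rewrite dj.
  by apply: sub_finite_set (above_finite graded i p.+1) => j [/JA].
have [n' nF n'E] := Rp i pi'.
have {}nF : has_rank (F p.+1 i) n.
  suff -> : n = n' by [].
  by have := adequate_rank adequate pi; rewrite n'E SE => -[].
have le_J (j : J i p.+1) : (i <= val j)%O by have [] := JA _ (set_mem (valP j)).
pose f (x : F p.+1 i) : prod_on (F p.+1) (J i p.+1) :=
  fun j => fmap (F p.+1) (le_J j) x.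
have fB : zmod_morphism f.
  by move=> x y; apply: functional_extensionality_dep => j; exact: raddfB.
pose fa : {additive F p.+1 i -> prod_on (F p.+1) (J i p.+1)} := HB.pack f
  (GRing.isZmodMorphism.Build _ _ f fB).
have zP (z : dprod (F p.+1)) j : exists y, cls p j y = z j by exact: cls_surj.
have inj0 (x : F p.+1 i) :
    (forall j (h : (i <= j)%O), J i p.+1 j -> fmap (F p.+1) h x = 0) -> x = 0.
  have [y <-] := cls_surj x => y0.
  have [j Jj|w ->] := key 0%N y (fun=> 0); last by rewrite mulr0n.
  by rewrite mulr0n -(cls_map _ (JA _ Jj).1); exact: y0.
split=> // z.
have [|m u x m0 xu|x xz] := @has_rank_surj _ _ fa n nF nS _ _ (fun j => z (val j)).
- apply: raddf_inj => x x0; apply: inj0 => j h Jj.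
  have ji : j \in J i p.+1 by apply/mem_set.
  rewrite -[RHS](_ : (0 : prod_on (F p.+1) (J i p.+1)) (exist _ j ji) = 0)// -x0.
  exact: fmap_irr.
- have [y yx] := cls_surj x.
  have [|w wE] := key m y (fun j => projT1 (cid (zP (fun k => extend0 u k) j))).
    move=> j Jj; case: cid => z' /= ->.
    have ji : j \in J i p.+1 by apply/mem_set.
    rewrite (extend0_mem _ ji).
    transitivity ((u *+ m) (exist _ j ji)); last exact: dprodMn.
    by rewrite -xu -yx /= /f cls_map.
  exists (cls p i w); apply: (has_rank_torsion nS m0).
  by rewrite -raddfMn -wE yx xu.
- exists x => j h Jj; have ji : j \in J i p.+1 by apply/mem_set.
  have := congr1 (fun g : prod_on (F p.+1) (J i p.+1) => g (exist _ j ji)) xz.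
  by apply: etrans; exact: fmap_irr.
Qed.

Lemma covered_all p :
  (forall i, (p <= deg i)%N -> exists2 n, has_rank (F p i) n & rk deg p i = n%:Z) /\
  (forall i, (p < deg i)%N -> covered p i).
Proof.
elim: p => [|p [Rp Ip]]; last first.
  have Rp1 i : (p < deg i)%N ->
      exists2 n, has_rank (F p.+1 i) n & rk deg p.+1 i = n%:Z.
    by move=> pi; apply: has_rank_next => //; exact: Ip.
  by split=> // i pi; exact: covered_next.
split=> [i _|i i0].
  exists 1%N => //; exists unit; pose f (x : int) := fun _ : unit => x.
  have fB : zmod_morphism f by [].
  exists (HB.pack f (GRing.isZmodMorphism.Build _ _ f fB) : {additive int -> (unit -> int)}).
  rewrite card_unit; split=> //; exists (fun g => g tt) => // g.
  by apply/funext => -[].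
(* Ranks being 1 in index 0, adequacy counts the elements of [J i 0]: there is exactly one, which
   starts the induction. *)
have J1 : \sum_(j \in J i 0%N) (1 : int) = 1.
  by rewrite -(adequate_rank adequate i0).
have finJ : finite_set (J i 0%N).
  apply: sub_finite_set (above_finite graded i 0%N).
  exact: (covering_sub (adequate_covering adequate)).
have [j0 Jj0] : exists j, J i 0%N j.
  apply: contrapT => nJ; have := J1; rewrite fsbig1// => j Jj.
  by exfalso; apply: nJ; exists j.
have Jj j : J i 0%N j -> j = j0.
  move=> Jj; apply: contrapT => jj0; move: J1.
  rewrite (fsbigD1 j0)// (fsbigD1 j)//; last exact: finite_setD.
  move=> e; have : 0 <= \sum_(k \in J i 0%N `\ j0 `\ j) (1 : int).
    exact: fsumr_ge0.
  have : 1 + (1 + \sum_(k \in J i 0%N `\ j0 `\ j) (1 : int)) = 1 by exact: e.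
  by move: (\sum_(_ \in _) _) => s; lia.
split=> [x x0|z]; last first.
  exists (z j0) => j h /Jj e.
  by change ((z : C -> int) j0 = (z : C -> int) j); rewrite e.
by have [h _] := J_above (leq0n _) Jj0; exact: x0 h Jj0.
Qed.

(** Exactness on the left at every object: the group is 0 below degree p, [i] itself occurs in the
    product in degree p, and [covered] applies above it. *)
Lemma lambda_inj p i (x : F p i) :
  (forall j (h : (i <= j)%O), deg j = p -> fmap (F p) h x = 0) -> x = 0.
Proof.
move=> x0; have [dp|pd|dp] := ltngtP (deg i) p; first exact: FF_low.
  apply: ((covered_all p).2 i pd).1 => j h Jj; apply: x0.
  by have [] := J_above (ltnW pd) Jj.
by rewrite -(fmap_id (lexx i) x) x0.
Qed.

Definition is_compatible (G : functor C) (u : dprod G) : Prop :=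
  forall i j (h : (i <= j)%O), fmap G h (u i) = u j.

Lemma cls_compatible p x : @is_compatible (F p.+1) (fun i => cls p i x).
Proof. by move=> i j h; exact: cls_map. Qed.

(** The preimages under [lambda] chosen at the various objects are compatible because [lambda] is
    injective: lim F_p is the kernel of the map from the product over Ob_p to lim F_(p+1). *)
Lemma cls_ker p (x : dprod (F p)) : (forall i, cls p i x = 0) ->
  exists2 y, @is_compatible (F p) y & forall j, deg j = p -> y j = x j.
Proof.
move=> x0; have yP i := (cls_eq0 _ i x).1 (x0 i).
pose y i := projT1 (cid (yP i)).
have yE i j (h : (i <= j)%O) : deg j = p -> fmap (F p) h (y i) = x j.
  exact: (projT2 (cid (yP i))).
exists y => [i j h|j dj]; last by rewrite -(yE _ _ (lexx j) dj) fmap_id.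
apply/eqP; rewrite -subr_eq0; apply/eqP; apply: lambda_inj => k jk dk.
by rewrite raddfB -(fmap_comp h jk (le_trans h jk)) !yE// subrr.
Qed.

(** * Limits of the F_p and the global covering family *)

Variable (K : nat -> set C).
Hypothesis global : adequate_global_covering_family deg K.

Lemma restr_inj (G : functor C) (S : set C) (u : dprod G) :
  injective (limit_restr G S) -> is_compatible u -> (forall i, S i -> u i = 0) ->
  forall i, u i = 0.
Proof.
move=> inj uc u0 i.
have uP : u \in @compatible _ _ G by apply/asboolP.
have := inj (exist _ u uP) 0; rewrite raddf0 => H.
have /(congr1 val)/(congr1 (fun v : dprod G => v i)) // : exist _ u uP = 0 :> limit G.
apply: H; apply: functional_extensionality_dep => j.
exact: u0 (set_mem (valP j)).
Qed.

Lemma compatible_eq0 p (u : dprod (F p)) : is_compatible u ->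
  (forall i, K p i -> u i = 0) -> forall i, u i = 0.
Proof.
have [gl _ _] := global.
case: p u => [|p] u; apply: restr_inj; first exact: global_mono0 gl.
exact: (global_mono gl).
Qed.

(* The map is injective because the elements killed by all the classes form
   lim F_p, and it is pure between groups of equal rank. *)
Lemma global_map_surj p (z : prod_on (F p.+1) (K p.+1)) :
  exists x, global_map deg K p x = z.
Proof.
have [gl fin sumE] := global.
have Rp q i : ob deg q i -> exists2 n, has_rank (F q i) n & rk deg q i = n%:Z.
  by move=> di; apply: (covered_all q).1; rewrite di.
have [n nS SE] : exists2 n, has_rank (prod_on (F p) (ob deg p `\` K p)) n &
    \sum_(j \in ob deg p `\` K p) rk deg p j = n%:Z.
  apply: has_rank_prod_on => [j [/Rp//]|].
  by apply: sub_finite_set (fin p) => j [[oj _] rj].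
have [m mS mE] : exists2 n, has_rank (prod_on (F p.+1) (K p.+1)) n &
    \sum_(j \in K p.+1) rk deg p.+1 j = n%:Z.
  apply: has_rank_prod_on => [j /(global_sub gl)/Rp//|].
  by apply: sub_finite_set (fin p.+1) => j [/(global_sub gl) oj rj].
have {}mS : has_rank (prod_on (F p.+1) (K p.+1)) n.
  suff -> : n = m by [].
  have := sumE p; rewrite mE.
  pose A := [set i | ob deg p i /\ rk deg p i <> 0].
  (* Splitting a sum along [K p] requires a finite index set, whereas [ob deg p] may be infinite;
     hence the passage to the finite set [A] of objects of nonzero rank. *)
  have restr S : S `<=` ob deg p ->
      \sum_(j \in S) rk deg p j = \sum_(j \in A `&` S) rk deg p j.
    move=> Sob; symmetry; apply: fsbig_widen => [j []//|j [Sj nA] /=].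
    by apply: contrapT => rj; apply: nA; split=> //; split=> //; exact: Sob.
  rewrite (restr (ob deg p))// (restr (K p)); last exact: (global_sub gl).
  rewrite setIidl => [|j []//]; rewrite (fsbigID (K p)); last exact: fin.
  rewrite (_ : A `&` ~` K p = A `&` (ob deg p `\` K p)); last first.
    by apply/seteqP; split=> j [[oj rj] Kj]; split=> //; case: Kj.
  rewrite -(restr (ob deg p `\` K p)); last by move=> j [].
  by rewrite SE => e; have /addrI[] : _ + n%:Z = _ + m%:Z := e.
apply: (@has_rank_surj _ _ (global_map deg K p) n nS mS) => [|k u x k0 xu]; last first.
  have : coker_pi (global_map deg K p) u = 0.
    apply: (free_abelian_torsion (global_pure gl p) k0).
    rewrite -raddfMn -(raddf0 (coker_pi (global_map deg K p))).
    by apply/coker_piP; exists x; rewrite subr0.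
  rewrite -(raddf0 (coker_pi (global_map deg K p))) => /coker_piP[x' x'E].
  by exists x'; rewrite x'E subr0.
apply: raddf_inj => x x0.
have c0 : forall i, cls p i (fun j => extend0 x j) = 0.
  apply: (compatible_eq0 (@cls_compatible p _)) => i Ki.
  have iK : i \in K p.+1 by apply/mem_set.
  exact: (congr1 (fun g : prod_on (F p.+1) (K p.+1) => g (exist _ i iK)) x0).
have [y yc yE] := cls_ker c0.
have y0 : forall i, y i = 0.
  apply: (compatible_eq0 yc) => i Ki; rewrite yE; last exact: (global_sub gl).
  by apply: extend0_out => -[].
apply: functional_extensionality_dep => j; rewrite -extend0_in.
by rewrite -yE ?y0//; have [] := set_mem (valP j).
Qed.

(** Surjectivity of [global_map] lifts the values on [K p.+1], and an element of lim F_(p+1) is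
    determined by those values. This is the vanishing of the first derived limit of F_p. *)
Lemma limit_lift p (u : dprod (F p.+1)) : is_compatible u ->
  exists x : dprod (F p), forall i, u i = cls p i x.
Proof.
move=> uc; have [x xE] := @global_map_surj p (fun i => u (val i)).
exists (fun j => extend0 x j) => i; apply/eqP; rewrite -subr_eq0; apply/eqP.
have := @compatible_eq0 p.+1 (fun i => u i - cls p i (fun j => extend0 x j)).
apply=> {i} [i j h|i Ki]; first by rewrite raddfB uc cls_compatible.
have iK : i \in K p.+1 by apply/mem_set.
rewrite (congr1 (fun g : prod_on (F p.+1) (K p.+1) => g (exist _ i iK)) (esym xE)).
exact: subrr.
Qed.

(** On [K 1] the classes of [w] are also those of a family [x] that is 0 on [K 0]. The difference
    has all its classes equal to 0, so it comes from lim F_0, and it still agrees with [w] on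
    [K 0]. *)
Lemma locally_constant_extension (w : C -> int) :
  exists2 y : C -> int, (forall i j, (i <= j)%O -> y i = y j) &
    forall i, K 0%N i -> y i = w i.
Proof.
have [gl _ _] := global.
have [x xE] := @global_map_surj 0%N (fun i => cls 0%N (val i) (w : dprod (F 0))).
have c0 : forall i, cls 0%N i ((w : dprod (F 0)) - (fun j => extend0 x j)) = 0.
  apply: (compatible_eq0 (@cls_compatible 0%N _)) => i Ki.
  have iK : i \in K 1%N by apply/mem_set.
  rewrite clsB.
  rewrite (congr1 (fun g : prod_on (F 1) (K 1%N) => g (exist _ i iK)) (esym xE)).
  exact: subrr.
have [y yc yE] := cls_ker c0.
exists y => [i j h|i Ki]; first exact: yc i j h.
rewrite yE; last exact: (global_sub gl).
have -> : ((w : dprod (F 0)) - (fun j => extend0 x j)) i = w i - extend0 x i by [].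
by rewrite extend0_out ?subr0// => -[].
Qed.

Lemma locally_constant_unique (y : C -> int) :
  (forall i j, (i <= j)%O -> y i = y j) -> (forall i, K 0%N i -> y i = 0) ->
  forall i, y i = 0.
Proof.
by move=> yc y0; apply: (@compatible_eq0 0%N y) => // i j h; exact: yc.
Qed.

End Functors.

(** * Cochains on chains of the poset *)

Lemma mem_del (T : eqType) i (l : seq T) x : x \in del i l -> x \in l.
Proof. by rewrite mem_cat => /orP[/mem_take|/mem_drop]. Qed.

Section Chains.
Variables (d : Order.disp_t) (C : porderType d).

(** Neither order nor distinctness is imposed, so that the big vertices of the corners of a fine
    simplex qualify as they come. *)
Definition chainl (l : seq C) := {in l &, forall x y, (x >=< y)%O}.
Definition below (l : seq C) (i : C) := {in l, forall x, (x <= i)%O}.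

Lemma chainl_del i l : chainl l -> chainl (del i l).
Proof. by move=> cl x y /mem_del xl /mem_del yl; exact: cl. Qed.

Lemma below_del k l i : below l i -> below (del k l) i.
Proof. by move=> li x /mem_del; exact: li. Qed.

Lemma below_trans l i j : (i <= j)%O -> below l i -> below l j.
Proof. by move=> ij li x /li xi; exact: le_trans ij. Qed.

Lemma chainl_cons l i : chainl l -> below l i -> chainl (i :: l).
Proof.
move=> cl li x y; rewrite !inE => /orP[/eqP->|xl] /orP[/eqP->|yl].
- exact: comparablexx.
- by rewrite /Order.comparable li ?orbT.
- by rewrite /Order.comparable li.
- exact: cl.
Qed.

Lemma below_cons l i : below l i -> below (i :: l) i.
Proof. by move=> li x; rewrite inE => /orP[/eqP->|/li]. Qed.

Lemma chainl_max l : chainl l -> (0 < size l)%N -> exists2 m, m \in l & below l m.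
Proof.
elim: l => // x l IH cl _; have [l0|l0] := posnP (size l).
  by rewrite (size0nil l0); exists x; rewrite ?mem_head// => y; rewrite inE => /eqP->.
have [|m ml lm] := IH _ l0.
  by move=> y z yl zl; apply: cl; rewrite inE ?yl ?zl orbT.
have /orP[xm|mx] : (x >=< m)%O by apply: cl; rewrite inE ?eqxx// ml orbT.
  by exists m; [rewrite inE ml orbT|move=> y; rewrite inE => /orP[/eqP->|/lm]].
exists x; rewrite ?mem_head// => y; rewrite inE => /orP[/eqP->//|/lm ym].
exact: le_trans mx.
Qed.

(** These are the natural maps to [G] from the functor taking [i] to the free group on the chain
    tuples of size [k.+1] below [i]. A tuple has a largest element, so that functor is a sum of
    representables, and [dlt] computes the derived limits of [G]. *)
Definition natural (G : functor C) k (f : forall i, seq C -> G i) :=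
  forall i j (h : (i <= j)%O) l, chainl l -> size l = k.+1 -> below l i ->
    fmap G h (f i l) = f j l.

Lemma dlt_dprod (G : functor C) (f : seq C -> dprod G) l j :
  dlt f l j = dlt (fun k => f k j) l.
Proof. by elim: l f => [//|v l IH] f; rewrite /= dprodB IH. Qed.

Variables (deg : C -> nat) (J : C -> nat -> set C) (K : nat -> set C).
Hypothesis graded : graded_poset deg.
Hypothesis adequate : adequate_covering_family deg J.
Hypothesis global : adequate_global_covering_family deg K.

Local Notation F := (FF deg).

Definition cls_add p i : dprod (F p) -> F p.+1 i := cls deg p i.

Let cls_additive p i : zmod_morphism (@cls_add p i).
Proof. by move=> x y; exact: clsB. Qed.

HB.instance Definition _ p i := GRing.isZmodMorphism.Build (dprod (F p)) (F p.+1 i)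
  (@cls_add p i) (@cls_additive p i).

Lemma dlt_cls p i (x : seq C -> dprod (F p)) l :
  dlt (fun k => cls deg p i (x k) : F p.+1 i) l = cls deg p i (dlt x l).
Proof. by rewrite -(dlt_raddf (@cls_add p i)). Qed.

Section Shift.
Variables (n p : nat) (f : forall i, seq C -> F p i).
Hypothesis fnat : natural n.+1 f.
Hypothesis f0 : forall i l, chainl l -> below l i -> size l = n.+3 ->
  dlt (f i) l = 0.

(* The part of the product complex at [j] consists of cochains on the cone below
   [j], which prepending [j] contracts. *)
Definition cone (l : seq C) : dprod (F p) := fun j => f j (j :: l).

Lemma dlt_cone l j : chainl l -> below l j -> size l = n.+2 -> dlt cone l j = f j l.
Proof.
move=> cl lj sl; have := f0 (chainl_cons cl lj) (below_cons lj).
by rewrite /= sl => /(_ erefl)/subr0_eq ->; rewrite dlt_dprod.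
Qed.

(** [dlt cone l] is the image under [lambda] of [f i l]. The classes of [cone] therefore form a
    cocycle with values in F_(p+1), one degree below [f]: its preimage under the connecting map. *)
Lemma cls_dlt_cone i l : chainl l -> below l i -> size l = n.+2 ->
  cls deg p i (dlt cone l) = 0.
Proof.
move=> cl li sl; apply/cls_eq0; exists (f i l) => j h dj.
by rewrite fnat// dlt_cone//; exact: below_trans li.
Qed.

(** If the classes of [cone] lift to a closed [y], then [cone - y] comes through [lambda] from some
    [g], and injectivity of [lambda] turns the equality of the images of [dlt g] and [f] into
    [f = dlt g]. *)
Lemma exact_of_split (y : seq C -> dprod (F p)) :
  (forall i l, chainl l -> below l i -> size l = n.+1 ->
    cls deg p i (cone l) = cls deg p i (y l)) ->
  (forall l, chainl l -> size l = n.+2 -> dlt y l = 0) ->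
  exists2 g : forall i, seq C -> F p i, natural n g &
    forall i l, chainl l -> below l i -> size l = n.+2 -> f i l = dlt (g i) l.
Proof.
move=> gy y0.
have gP i l : exists x : F p i, chainl l -> below l i -> size l = n.+1 ->
    forall j (h : (i <= j)%O), deg j = p -> fmap (F p) h x = cone l j - y l j.
  have [cl|] := pselect (chainl l); last by exists 0.
  have [li|] := pselect (below l i); last by exists 0.
  have [sl|] := pselect (size l = n.+1); last by exists 0.
  by have /cls_eq[x xE] := gy i l cl li sl; exists x.
pose g i l := projT1 (cid (gP i l)).
have gE i l := projT2 (cid (gP i l)).
exists g => [i j h l cl sl li|i l cl li sl].
  apply/eqP; rewrite -subr_eq0; apply/eqP.
  apply: (lambda_inj graded adequate) => k jk dk.
  rewrite raddfB -(fmap_comp h jk (le_trans h jk)).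
  by rewrite !gE ?subrr//; exact: below_trans li.
apply/eqP; rewrite -subr_eq0; apply/eqP.
apply: (lambda_inj graded adequate) => j h dj.
rewrite raddfB fnat// dlt_raddf.
rewrite [X in _ - X](@dlt_ext _ _ (fun k => [/\ chainl k, below k i & size k = n.+1])
    _ (fun k => cone k j - y k j)); last 2 first.
- move=> k kl; split; [exact: chainl_del|exact: below_del|].
  by rewrite size_del// sl.
- by move=> k [ck ki sk]; exact: gE.
rewrite dltB -!dlt_dprod dlt_cone//; last exact: below_trans li.
by rewrite opprB addrCA subrr addr0 y0.
Qed.

End Shift.

(** Dimension shifting, with [p] generalized. For [n = 0] the shifted cocycle [u] is an element of
    lim F_(p+1), lifted by [limit_lift] to a constant cochain; otherwise [u] is a coboundary by
    induction and a lift of its primitive is used. *)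
Lemma cocycle_exact n : forall p (f : forall i, seq C -> F p i),
  natural n.+1 f ->
  (forall i l, chainl l -> below l i -> size l = n.+3 -> dlt (f i) l = 0) ->
  exists2 g : forall i, seq C -> F p i, natural n g &
    forall i l, chainl l -> below l i -> size l = n.+2 -> f i l = dlt (g i) l.
Proof.
elim: n => [|n IH] p f fnat f0; pose u i l : F p.+1 i := cls deg p i (cone f l).
  have c1 (i : C) : chainl [:: i].
    by move=> x y; rewrite !inE => /eqP -> /eqP ->; exact: comparablexx.
  have b1 (i j : C) : (i <= j)%O -> below [:: i] j.
    by move=> ij x; rewrite inE => /eqP ->.
  have uE i j : (i <= j)%O -> u j [:: i] = u j [:: j].
    move=> ij; have cl : chainl [:: j; i] by apply: chainl_cons => //; exact: b1.
    have lj : below [:: j; i] j by apply: below_cons; exact: b1.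
    have := cls_dlt_cone fnat f0 cl lj erefl.
    by rewrite -dlt_cls /= subr0 => /subr0_eq.
  have [|y yE] := limit_lift graded adequate global (u := fun i => u i [:: i]).
    by move=> i j h; rewrite -(uE i j h) /u cls_map.
  apply: (exact_of_split fnat f0 (y := fun=> y)) => [i [|x []]// _ li _|[|? [|? []]]//= _ _].
    by rewrite -yE -(uE x)//; apply: li; rewrite mem_head.
  by rewrite subr0 subrr.
have unat : natural n.+1 u by move=> i j h l cl sl li; rewrite /u cls_map.
have [|h hnat hE] := IH p.+1 u unat.
  by move=> i l cl li sl; rewrite dlt_cls (cls_dlt_cone fnat f0).
(* Lifting [h] at the largest element of [l] is enough: by naturality the same family lifts [h i l]
   at every [i] above [l]. *)
have yP l : exists y : dprod (F p), forall i, chainl l -> below l i ->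
    size l = n.+1 -> cls deg p i y = h i l.
  have [cl|] := pselect (chainl l); last by exists 0.
  have [sl|] := pselect (size l = n.+1); last by exists 0.
  have [|m ml lm] := chainl_max cl; first by rewrite sl.
  have [y yE] := cls_surj (h m l); exists y => i _ li _.
  by rewrite -(cls_map _ _ (li m ml)) yE; exact: hnat.
pose y l := projT1 (cid (yP l)); have yE l := projT2 (cid (yP l)).
apply: (exact_of_split fnat f0 (y := dlt y)) => [i l cl li sl|l cl sl].
  rewrite -[LHS]/(u i l) hE// -dlt_cls.
  apply: (@dlt_ext _ _ (fun k => [/\ chainl k, below k i & size k = n.+1])).
    move=> k kl; split; [exact: chainl_del|exact: below_del|].
    by rewrite size_del// sl.
  by move=> k [ck ki sk]; rewrite yE.
exact: dlt_dlt.
Qed.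

(** The primitive given by [cocycle_exact] depends on an object above the tuple. Evaluating it at
    the largest element removes the dependence, and naturality compares the choices made for [l] and
    for its faces. *)
Lemma chain_cocycle_exact n (f : seq C -> int) :
  (forall l, chainl l -> size l = n.+3 -> dlt f l = 0) ->
  exists g : seq C -> int, forall l, chainl l -> size l = n.+2 -> f l = dlt g l.
Proof.
move=> f0; have [||g gnat gE] := @cocycle_exact n 0%N (fun=> f).
- by move=> i j h l.
- by move=> i l cl _; exact: f0.
have mP l : exists m, chainl l -> (0 < size l)%N -> below l m /\ m \in l.
  have [cl|] := pselect (chainl l); last first.
    by case: (deg_zero graded) => m _; exists m.
  have [l0|l0] := posnP (size l); first by case: (deg_zero graded) => m _; exists m.
  by have [m ml lm] := chainl_max cl l0; exists m.
pose m l := projT1 (cid (mP l)); have mE l := projT2 (cid (mP l)).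
exists (fun l => g (m l) l) => l cl sl.
have [|lm _] := mE l cl; first by rewrite sl.
rewrite (gE (m l))//.
apply: (@dlt_ext _ _ (fun k => [/\ chainl k, below k (m l), size k = n.+1 &
   {subset k <= l}])) => k; last first.
  move=> [ck km sk kl]; have [|kmk point_of] := mE k ck; first by rewrite sk.
  by rewrite -(gnat _ _ (lm _ (kl _ point_of)) k ck sk kmk).
move=> kl; split; [exact: chainl_del|exact: below_del| |by move=> ? /mem_del].
by rewrite size_del// sl.
Qed.

End Chains.

(** * Barycentric coordinates on the realization *)

Section Coordinates.
Variables (R : realType) (d : Order.disp_t) (C : porderType d).
Local Notation X := (realization R C).

Definition realize (z : cells R C) : X := \pi_X%qT z.

Lemma realizeK (x : X) : exists z, realize z = x.
Proof. by exists (repr x); exact: reprK. Qed.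

Lemma realize_eq z z' : clos_refl_sym_trans _ (@glue R d C) z z' -> realize z = realize z'.
Proof. by move=> zz; apply/eqmodP/asboolP. Qed.

Lemma realize_eqP z z' : realize z = realize z' -> clos_refl_sym_trans _ (@glue R d C) z z'.
Proof. by move/eqmodP/asboolP. Qed.

(** A sum, because the simplices of the nerve may be degenerate and repeat a vertex. *)
Definition cell_coord (z : cells R C) (i : C) : R :=
  \sum_(j < (tag (tag z)).+1 | val (tagged (tag z)) j == i) val (tagged z) 0 j.

Lemma cell_coordE n (s : nerve C n) (t : simplex R n) i :
  cell_coord (cell s t) i = \sum_(j < n.+1 | val s j == i) val t 0 j.
Proof. by []. Qed.

Lemma cell_coord_glue z z' : glue z z' -> cell_coord z = cell_coord z'.
Proof.
case=> m n h hm s t; apply/funext => i; rewrite !cell_coordE /=.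
rewrite (partition_big h (fun k => val s k == i))//=.
apply: eq_bigr => k /eqP sk; rewrite mxE; apply: eq_bigl => j.
by have [->|] := eqVneq (h j) k; rewrite ?andbF// sk eqxx.
Qed.

Lemma cell_coord_realize z z' : realize z = realize z' -> cell_coord z = cell_coord z'.
Proof.
move/realize_eqP; elim=> [a b|a|a b _ ab|a b c _ ab _ bc1].
- exact: cell_coord_glue.
- by [].
- by rewrite ab.
- by rewrite ab.
Qed.

Definition bcoord (x : X) : C -> R := cell_coord (repr x).

Lemma coord_realize z : bcoord (realize z) = cell_coord z.
Proof. by apply: cell_coord_realize; exact: reprK. Qed.

Lemma simplex_ge0 n (t : simplex R n) j : 0 <= val t 0 j.
Proof. by have [] := set_mem (valP t). Qed.

Lemma simplex_sum1 n (t : simplex R n) : \sum_j val t 0 j = 1.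
Proof. by have [] := set_mem (valP t). Qed.

Lemma coord_ge0 x i : 0 <= bcoord x i.
Proof. by have [z <-] := realizeK x; rewrite coord_realize; apply: sumr_ge0 => j _; exact: simplex_ge0. Qed.

Definition strict (s : seq C) := sorted <%O s.

Lemma strict_nth s x0 i j : strict s -> (i <= j)%N -> (j < size s)%N ->
  (nth x0 s i <= nth x0 s j)%O.
Proof.
move=> ss ij js; have ls : sorted <=%O s by apply: sub_sorted ss => ? ?; exact: ltW.
apply: (sorted_leq_nth le_trans lexx _ ls) => //; rewrite inE //.
exact: leq_ltn_trans js.
Qed.

Definition supported (a : C -> R) (s : seq C) := forall i, i \notin s -> a i = 0.

Section Simplexes.
Variable (x0 : C).

Lemma nerve_of_subproof (s : seq C) n : strict s -> size s = n.+1 ->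
  (fun j : 'I_n.+1 => nth x0 s j) \in @nerve_set d C n.
Proof.
move=> ss sn; apply/mem_set => i j ij; apply: strict_nth => //.
by rewrite sn.
Qed.

Definition nerve_of s n (ss : strict s) (sn : size s = n.+1) : nerve C n :=
  exist (fun u => u \in @nerve_set d C n) _ (nerve_of_subproof ss sn).

Lemma cell_coord_nerve_of s n (ss : strict s) (sn : size s = n.+1) t j :
  cell_coord (cell (nerve_of ss sn) t) (nth x0 s (j : 'I_n.+1)) = val t 0 j.
Proof.
rewrite cell_coordE (big_pred1 j)// => k /=.
by rewrite nth_uniq ?sn// lt_sorted_uniq.
Qed.

Lemma cell_coord_nerve_of_out s n (ss : strict s) (sn : size s = n.+1) t :
  supported (cell_coord (cell (nerve_of ss sn) t)) s.
Proof.
move=> i si; rewrite cell_coordE big1// => k /= /eqP ki.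
by rewrite -ki mem_nth ?sn in si.
Qed.

Lemma simplex_of_subproof (s : seq C) n (a : C -> R) : strict s -> size s = n.+1 ->
  (forall i, 0 <= a i) -> \sum_(i <- s) a i = 1 ->
  (\row_(j < n.+1) a (nth x0 s j)) \in @std_simplex R n.
Proof.
move=> ss sn a0 a1; apply/mem_set; split=> [i|]; first by rewrite mxE.
rewrite -a1 (big_nth x0) big_mkord sn.
by apply: eq_bigr => i _; rewrite mxE.
Qed.

Definition simplex_of s n a (ss : strict s) (sn : size s = n.+1)
  (a0 : forall i, 0 <= a i) (a1 : \sum_(i <- s) a i = 1) : simplex R n :=
  exist (fun u => u \in @std_simplex R n) _ (simplex_of_subproof ss sn a0 a1).

Lemma cell_coord_simplex_of s n a (ss : strict s) (sn : size s = n.+1)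
  (a0 : forall i, 0 <= a i) (a1 : \sum_(i <- s) a i = 1) :
  supported a s -> cell_coord (cell (nerve_of ss sn) (simplex_of ss sn a0 a1)) = a.
Proof.
move=> sa; apply/funext => i; have [si|si] := boolP (i \in s); last first.
  by rewrite (cell_coord_nerve_of_out _ _ _ si) sa.
have ilt : (index i s < n.+1)%N by rewrite -sn index_mem.
rewrite -{1}(nth_index x0 si) (cell_coord_nerve_of ss sn _ (Ordinal ilt)).
by rewrite /= mxE nth_index.
Qed.

Lemma simplex_ext n (t t' : simplex R n) : (forall j, val t 0 j = val t' 0 j) -> t = t'.
Proof. by move=> tt; apply: val_inj; apply/rowP. Qed.

Lemma sum_posP n (s : nerve C n) (t : simplex R n) i :
  0 < cell_coord (cell s t) i <-> exists2 j, val s j = i & 0 < val t 0 j.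
Proof.
rewrite cell_coordE; split=> [si|[j sj tj]]; last first.
  rewrite (bigD1 j) ?sj//= ltr_wpDr//; apply: sumr_ge0 => k _.
  exact: simplex_ge0.
apply: contrapT => nj; suff s0 : \sum_(j < n.+1 | val s j == i) val t 0 j = 0.
  by rewrite s0 ltxx in si.
apply: big1 => j /eqP sj; apply/eqP; rewrite eq_le simplex_ge0 andbT leNgt.
by apply/negP => tj; apply: nj; exists j.
Qed.

(** Two identifications bring a cell to its support: the injection [h] drops the vertices whose
    coordinate is 0, then the monotone map [g] onto positions in [S] merges repeated vertices. *)
Lemma cell_normal n (s : nerve C n) (t : simplex R n) (S : seq C) m
  (sS : strict S) (Sm : size S = m.+1)
  (a1 : \sum_(i <- S) cell_coord (cell s t) i = 1) :
  (forall i, (i \in S) = (0 < cell_coord (cell s t) i)) ->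
  realize (cell s t) = realize (cell (nerve_of sS Sm)
    (simplex_of sS Sm (fun i => sumr_ge0 _ (fun j _ => simplex_ge0 t j)) a1)).
Proof.
move=> SE.
pose P := [seq j <- enum 'I_n.+1 | 0 < val t 0 j].
have uP : uniq P by rewrite filter_uniq// enum_uniq.
have PE j : (j \in P) = (0 < val t 0 j) by rewrite mem_filter mem_enum andbT.
have [k Pk] : exists k, size P = k.+1.
  case E : P => [|j P']; last by exists (size P').
  have : \sum_j val t 0 j = 0.
    apply: big1 => j _; apply/eqP; rewrite eq_le simplex_ge0 andbT leNgt -PE E.
    by [].
  by rewrite simplex_sum1 => /eqP; rewrite oner_eq0.
have Psort : sorted (fun i j : 'I_n.+1 => i < j)%N P.
  apply: sorted_filter; first by move=> ? ? ?; exact: ltn_trans.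
  by have := iota_ltn_sorted 0 n.+1; rewrite -val_enum_ord sorted_map.
pose h (j : 'I_k.+1) := nth ord0 P j.
have hmono : monotone h.
  move=> i j; rewrite leq_eqVlt => /orP[/eqP ij|ij]; first by rewrite /h ij.
  apply: ltnW; apply: (sorted_ltn_nth _ ord0 Psort) => //; rewrite ?inE ?Pk//.
  by move=> ? ? ?; exact: ltn_trans.
have hinj : injective h.
  move=> i j /eqP; rewrite nth_uniq ?Pk// => /eqP; exact: val_inj.
have hP j : 0 < val t 0 (h j) by rewrite -PE mem_nth// Pk.
have t'P : (\row_(j < k.+1) val t 0 (h j)) \in @std_simplex R k.
  apply/mem_set; split=> [i|]; first by rewrite mxE; exact: simplex_ge0.
  rewrite -(simplex_sum1 t) (bigID (fun j => j \in P)) /= [X in _ = _ + X]big1 ?addr0; last first.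
    move=> j jP; apply/eqP; rewrite eq_le simplex_ge0 andbT leNgt -PE //.
  rewrite -(big_uniq _ uP) /=.
  rewrite [RHS](big_nth ord0) big_mkord Pk.
  by apply: eq_bigr => i _; rewrite mxE.
pose t' : simplex R k := exist (fun u => u \in @std_simplex R k) _ t'P.
have ht : simplex_map h t' = t.
  apply: simplex_ext => j; rewrite /= mxE.
  have [jP|jP] := boolP (j \in P).
    have ilt : (index j P < k.+1)%N by rewrite -Pk index_mem.
    have hj : h (Ordinal ilt) = j by rewrite /h /= nth_index.
    rewrite (big_pred1 (Ordinal ilt)) ?mxE ?hj// => i /=.
    by rewrite -{1}hj (inj_eq hinj).
  rewrite big1; last by move=> i /eqP hij; rewrite -hij PE hP in jP.
  by apply/eqP; rewrite eq_le simplex_ge0 /= leNgt -PE.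
have shS j : val s (h j) \in S.
  by rewrite SE; apply/sum_posP; exists (h j).
have glt j : (index (val s (h j)) S < m.+1)%N by rewrite -Sm index_mem.
pose g j : 'I_m.+1 := Ordinal (glt j).
have gmono : monotone g.
  move=> i j ij /=; rewrite leqNgt; apply/negP => ji.
  have := sorted_ltn_index lt_trans sS _ _ (shS j) (shS i) ji.
  by move=> /lt_geF; rewrite (set_mem (valP s) _ _ (hmono _ _ ij)).
have E : nerve_map gmono (nerve_of sS Sm) = nerve_map hmono s.
  by apply: val_inj; apply/funext => j; apply: nth_index; exact: shS.
transitivity (realize (cell (nerve_map hmono s) t')).
  by rewrite -{1}ht; apply: realize_eq; apply: rst_sym; apply: rst_step; exact: Glue.
rewrite -E; transitivity (realize (cell (nerve_of sS Sm) (simplex_map g t'))).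
  by apply: realize_eq; apply: rst_step; exact: Glue.
congr (realize (cell _ _)); apply: simplex_ext => j.
rewrite -(cell_coord_nerve_of sS Sm (simplex_map g t')) -(cell_coord_glue (Glue gmono _ _)) E.
by rewrite (cell_coord_glue (Glue hmono _ _)) ht /= mxE.
Qed.

Lemma coord_sum x (S : seq C) : uniq S -> supported (bcoord x) S ->
  \sum_(i <- S) bcoord x i = 1.
Proof.
have [[[n s] t] <-] := realizeK x; rewrite coord_realize -[existT _ _ _]/(cell s t) => uS sS.
rewrite -(simplex_sum1 t) (exchange_big_dep xpredT)//=; apply: eq_bigr => j _.
have [sj|sj] := boolP (val s j \in S).
  rewrite (eq_bigl (pred1 (val s j))); last by move=> i /=; rewrite eq_sym.
  by rewrite -big_filter filter_pred1_uniq// big_seq1.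
rewrite big_seq_cond big1; last by move=> i /andP[iS /eqP e]; move: sj; rewrite (e : val s j = i) iS.
apply/eqP; rewrite eq_le simplex_ge0 andTb.
rewrite leNgt; apply/negP => tj.
suff : 0 < cell_coord (cell s t) (val s j) by rewrite (sS _ sj) ltxx.
by apply/sum_posP; exists j.
Qed.

Lemma coord_supp x : exists S, strict S /\ forall i, (i \in S) = (0 < bcoord x i).
Proof.
have [[[n s] t] <-] := realizeK x; rewrite coord_realize -[existT _ _ _]/(cell s t).
pose Q := undup [seq val s j | j <- enum 'I_n.+1].
exists [seq i <- Q | 0 < cell_coord (cell s t) i]; split; last first.
  move=> i; rewrite mem_filter andb_idr// => /sum_posP[j <- _].
  by rewrite mem_undup map_f// mem_enum.
apply: sorted_filter; first exact: lt_trans.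
rewrite lt_sorted_uniq_le undup_uniq /=.
apply: (subseq_sorted le_trans (undup_subseq _)); rewrite sorted_map.
have : sorted (fun i j : 'I_n.+1 => i < j)%N (enum 'I_n.+1).
  by have := iota_ltn_sorted 0 n.+1; rewrite -val_enum_ord sorted_map.
by apply: sub_sorted => i j /ltnW ij; apply: (set_mem (valP s)).
Qed.

(** Points with the same coordinates have the same support [S], hence the same normal form given by
    [cell_normal]. *)
Lemma coord_inj_pointed : injective bcoord.
Proof.
move=> x y xy; have [S [sS SE]] := coord_supp x.
have Ssupp z : bcoord z = bcoord x -> supported (bcoord z) S.
  move=> -> i; rewrite SE -leNgt => ci; apply/eqP.
  by rewrite eq_le ci coord_ge0.
have uS : uniq S by exact: lt_sorted_uniq.
have Sz z : bcoord z = bcoord x -> \sum_(i <- S) bcoord z i = 1.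
  by move=> zx; apply: coord_sum => //; exact: Ssupp.
have [m Sm] : exists m, size S = m.+1.
  case: (S) (Sz x erefl) => [|? S' _]; last by exists (size S').
  by rewrite big_nil => /esym/eqP; rewrite oner_eq0.
move: xy (Sz x) (Sz y) SE.
have [[[n s] t] <-] := realizeK x; rewrite coord_realize -[existT _ _ _]/(cell s t).
have [[[n' s'] t'] <-] := realizeK y; rewrite coord_realize -[existT _ _ _]/(cell s' t').
move=> E /(_ erefl) S1 /(_ (esym E)) S2 SE.
rewrite (cell_normal sS Sm S1)// (cell_normal sS Sm S2); last by rewrite -E.
by congr (realize (cell _ _)); apply: simplex_ext => j; rewrite /= !mxE; exact: (congr1 (fun a : C -> R => a (nth x0 S j)) E).
Qed.

End Simplexes.

Lemma coord_inj : injective bcoord.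
Proof.
move=> x y; have [[[n s] _] _] := realizeK x.
exact: (coord_inj_pointed (val s ord0)).
Qed.

End Coordinates.

(** * Topology of the realization *)

Lemma closed_seqU (T : topologicalType) (I : eqType) (s : seq I) (B : I -> set T) :
  (forall i, closed (B i)) -> closed [set x | exists2 i, i \in s & B i x].
Proof.
move=> cB; elim: s => [|i s IH].
  rewrite (_ : [set _ | _] = set0); first exact: closed0.
  by apply/seteqP; split=> x // -[].
rewrite (_ : [set _ | _] = B i `|` [set x | exists2 i, i \in s & B i x]).
  exact: closedU.
apply/seteqP; split=> x /=.
  by move=> [j]; rewrite inE => /orP[/eqP->|js]; [left|right; exists j].
move=> [Bx|[j js Bx]]; first by exists i; rewrite ?mem_head.
by exists j; rewrite // inE js orbT.
Qed.

Lemma closed_all (T : topologicalType) (I : Type) (B : I -> set T) :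
  (forall i, closed (B i)) -> closed [set x | forall i, B i x].
Proof.
move=> cB; have -> : [set x | forall i, B i x] = \bigcap_(i in setT) B i.
  by apply/seteqP; split=> x /= Bx; [move=> i _|move=> i]; exact: Bx.
by apply: closed_bigI => i _; exact: cB.
Qed.

Lemma continuous_row (R : realType) (Y : topologicalType) n (f : Y -> 'I_n -> R) :
  (forall j, continuous (fun y => f y j)) -> continuous (fun y => \row_j f y j).
Proof.
move=> cf y U [P nP sPU].
have Fy : Filter (nbhs y) by exact: nbhs_filter.
have Py j : nbhs y [set z | P 0 j (f z j)].
  by apply: cf; have := nP 0 j; rewrite mxE.
apply: filterS (filter_forall Fy Py) => z Pz; apply: sPU => i j.
by rewrite ord1 mxE; exact: Pz.
Qed.

Section Simplexes.
Variable R : realType.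

Lemma simplex_val_continuous n : continuous (val : simplex R n -> 'rV[R]_n.+1).
Proof. exact: initial_continuous. Qed.

Lemma simplex_coord_continuous n j : continuous (fun t : simplex R n => val t 0 j : R).
Proof.
move=> t; have vt := @simplex_val_continuous n t.
exact: (cvg_comp _ _ vt (@coord_continuous R 1 n.+1 0 j (val t))).
Qed.

Lemma continuous_sum (Y : topologicalType) (I : Type) (r : seq I) (P : pred I)
    (f : I -> Y -> R) :
  (forall i, continuous (f i)) -> continuous (fun y => \sum_(i <- r | P i) f i y).
Proof.
move=> cf y; apply: cvg_big => [|i _]; last exact: cf.
by move=> z; exact: add_continuous.
Qed.

Lemma continuous_to_simplex (Y : topologicalType) n (f : Y -> simplex R n) :
  (forall j, continuous (fun y => val (f y) 0 j : R)) -> continuous f.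
Proof.
move=> cf; apply: continuous_comp_initial.
rewrite (_ : _ \o f = fun y => \row_j (val (f y) 0 j : R)); last first.
  by apply/funext => y; apply/rowP => j; rewrite mxE.
exact: continuous_row.
Qed.

Lemma std_simplex_compact n : compact (@std_simplex R n).
Proof.
have H : compact [set v : 'rV[R]_n.+1 | forall i, v ord0 i \in `[(0 : R), 1]].
  apply: (@rV_compact _ _ (fun=> `[(0 : R), 1]%classic)).
  by move=> _; exact: segment_compact.
apply: (subclosed_compact _ H) => [|v [v0 v1] i]; last first.
  rewrite /= in_itv /= v0 /= -v1 (bigD1 i)//= ler_wpDr//.
  by apply: sumr_ge0.
rewrite (_ : @std_simplex R n = [set t | forall i, 0 <= t 0 i] `&`
    [set t | \sum_i t 0 i = 1]); last by [].
apply: closedI.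
  apply: closed_all => i.
  have cc := @coord_continuous R 1 n.+1 0 i.
  exact: ((continuous_closedP _).1 cc [set x | 0 <= x] (@closed_ge _ _)).
have cs : continuous (fun t : 'rV[R]_n.+1 => \sum_i t 0 i).
  by apply: continuous_sum => i; exact: coord_continuous.
exact: ((continuous_closedP _).1 cs [set x | x = 1] (@closed_eq _ _)).
Qed.

Lemma vertex_subproof n (i : 'I_n.+1) : (delta_mx 0 i : 'rV[R]_n.+1) \in @std_simplex R n.
Proof.
apply/mem_set; split=> [j|]; first by rewrite mxE ler0n.
by rewrite (bigD1 i)//= mxE !eqxx big1 ?addr0// => j ji; rewrite mxE (negbTE ji).
Qed.

Definition vertex n (i : 'I_n.+1) : simplex R n :=
  exist (fun u => u \in @std_simplex R n) _ (vertex_subproof i).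

Lemma simplex_open n (O : set (simplex R n)) : open O ->
  exists2 W : set 'rV[R]_n.+1, open W & forall t, O t <-> W (val t).
Proof. by move=> [W oW <-]; exists W. Qed.

Lemma simplex_cover n (I : choiceType) (f : I -> set (simplex R n)) :
  (forall i, open (f i)) -> (forall t, exists i, f i t) ->
  exists s : seq I, forall t, exists2 i, i \in s & f i t.
Proof.
move=> fo fc; have WP i := simplex_open (fo i).
pose W i := projT1 (cid2 (WP i)).
have Wo i : open (W i) by rewrite /W; case: cid2.
have fW i t : f i t <-> W i (val t) by rewrite /W; case: cid2.
have := @std_simplex_compact n; rewrite compact_cover => /(_ I setT W).
case=> [//|v Av|s _ sc].
  have vA : v \in @std_simplex R n by apply/mem_set.
  by have [i /fW Wi] := fc (exist _ v vA); exists i.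
exists (finmap.enum_fset s) => t; have [i is_ Wi] := sc _ (set_mem (valP t)).
by exists i => //; apply/fW.
Qed.

End Simplexes.

Section RealizationTopology.
Variables (R : realType) (d : Order.disp_t) (C : porderType d).
Local Notation X := (realization R C).

Lemma realize_continuous : continuous (@realize R d C).
Proof. exact: quotient_topology.pi_continuous. Qed.

Lemma cell_continuous n (s : nerve C n) :
  continuous (fun t : simplex R n => realize (cell s t)).
Proof.
move=> t; apply: (@continuous_comp _ _ _ (cell s) (@realize R d C)).
  exact: existT_continuous.
exact: realize_continuous.
Qed.

Lemma cell_coord_continuous n (s : nerve C n) i :
  continuous (fun t : simplex R n => cell_coord (cell s t) i : R).
Proof.
exact: (@continuous_sum R _ _ (index_enum _) (fun j => val s j == i)
  (fun j (t : simplex R n) => val t 0 j)) (@simplex_coord_continuous R n).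
Qed.

Lemma bcoord_continuous i : continuous (fun x : X => bcoord x i : R).
Proof.
apply/quotient_continuous.
rewrite (_ : _ \o _ = fun z => cell_coord z i); last first.
  by apply/funext => z; rewrite /= -[_ z]/(realize z) coord_realize.
by move=> [[n s] t]; exact: (@cell_coord_continuous _ s i t).
Qed.

(** The preimage of a closed set is the union over [L] of the parts mapped into one closed simplex,
    each closed because there the point depends continuously on its coordinates; finiteness of [L]
    keeps the union closed. *)
Lemma continuous_coord_criterion (Y : topologicalType) (f : Y -> X)
    (L : seq (seq C)) :
  (forall i, continuous (fun y => bcoord (f y) i : R)) ->
  (forall y, exists2 S, S \in L & strict S /\ supported (bcoord (f y)) S) ->
  continuous f.
Proof.
move=> cf fL; apply/continuous_closedP => F clF.
pose B S : set Y := [set y | [/\ strict S, supported (bcoord (f y)) S & F (f y)]].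
have -> : f @^-1` F = [set y | exists2 S, S \in L & B S y].
  apply/seteqP; split=> y /=; last by move=> [S _ []].
  by move=> Fy; have [S SL [sS Sy]] := fL y; exists S.
apply: closed_seqU => S.
have [sS|nS] := pselect (strict S); last first.
  rewrite (_ : B S = set0); first exact: closed0.
  by apply/seteqP; split=> y // -[].
have uS : uniq S := lt_sorted_uniq sS.
case: S => [|x0 S] in B sS uS *.
  rewrite (_ : B [::] = set0); first exact: closed0.
  apply/seteqP; split=> y // -[_ Sy _].
  by have := coord_sum (S := [::]) isT Sy; rewrite big_nil => /esym/eqP; rewrite oner_eq0.
have Sn : size (x0 :: S) = (size S).+1 by [].
set T := x0 :: S in B sS uS Sn *; set n := size S in Sn *.
pose G0 : set (simplex R n) := [set t | F (realize (cell (nerve_of x0 sS Sn) t))].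
have clG0 : closed G0 by exact: ((continuous_closedP _).1 (@cell_continuous _ _) F clF).
(* [W] expresses, on row vectors of coordinates, that the point of the closed simplex on [T] lies
   outside [F]. *)
have [W oW WE] := simplex_open (closed_openC clG0).
pose row y : 'rV[R]_n.+1 := \row_j bcoord (f y) (nth x0 T j).
have crow : continuous row by apply: continuous_row => j; exact: cf.
have -> : B T = [set y | forall i, i \notin T -> bcoord (f y) i = 0] `&`
    row @^-1` (~` W).
  apply/seteqP; split=> y /=.
    move=> [_ Sy Fy]; split=> // Wy.
    have t1 := coord_sum uS Sy.
    pose t := simplex_of x0 sS Sn (coord_ge0 (f y)) t1.
    suff : (~` G0) t by apply; rewrite /G0 /=; rewrite (_ : realize _ = f y)//;
      apply: coord_inj; rewrite coord_realize cell_coord_simplex_of.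
    exact/WE.
  move=> [Sy nW]; split=> //.
  have t1 := coord_sum uS Sy.
  pose t := simplex_of x0 sS Sn (coord_ge0 (f y)) t1.
  have -> : f y = realize (cell (nerve_of x0 sS Sn) t).
    by apply: coord_inj; rewrite coord_realize cell_coord_simplex_of.
  by apply: contrapT => nF; apply: nW; apply/(WE t).
apply: closedI; last first.
  by apply: ((continuous_closedP _).1 crow); exact: open_closedC.
apply: (@closed_all _ _ (fun i => [set y | i \notin T -> bcoord (f y) i = 0])) => i.
have [iT|iT] := boolP (i \in T).
  rewrite (_ : [set y | _] = setT); first exact: closedT.
  by apply/seteqP; split=> y //= _; rewrite iT.
rewrite (_ : [set y | _] = [set y | bcoord (f y) i = 0]).
  exact: ((continuous_closedP _).1 (cf i) [set x | x = 0] (@closed_eq _ _)).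
by apply/seteqP; split=> y //= H; exact: H.
Qed.

Definition supp (x : X) : seq C := projT1 (cid (coord_supp x)).

Lemma suppP x : strict (supp x) /\ forall i, (i \in supp x) = (0 < bcoord x i).
Proof. exact: (projT2 (cid (coord_supp x))). Qed.

Lemma supp_supported x : supported (bcoord x) (supp x).
Proof.
move=> i; rewrite (suppP x).2 -leNgt => ci; apply/eqP.
by rewrite eq_le ci coord_ge0.
Qed.

(* As [D] is arbitrary, these points form a discrete set, so that a compact set
   meets finitely many open cells only. *)
Lemma closed_points (D : set (seq C)) (g : seq C -> X) :
  (forall q, D q -> supp (g q) = q) -> closed [set x | exists2 q, D q & x = g q].
Proof.
move=> gD; rewrite -openC; apply/sigT_openP => -[n s].
rewrite [X in open X](_ : _ = ~` [set t | exists2 q, D q & realize (cell s t) = g q]) //.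
apply: closed_openC.
pose Q := undup [seq val s j | j <- enum 'I_n.+1].
have sQ : strict Q.
  rewrite /strict lt_sorted_uniq_le undup_uniq /=.
  apply: (subseq_sorted le_trans (undup_subseq _)); rewrite sorted_map.
  have : sorted (fun i j : 'I_n.+1 => i < j)%N (enum 'I_n.+1).
    by have := iota_ltn_sorted 0 n.+1; rewrite -val_enum_ord sorted_map.
  by apply: sub_sorted => i j /ltnW ij; apply: (set_mem (valP s)).
(* Supports of points of the cell are sublists of its vertex list [Q], so only finitely many [q]
   occur in it. *)
pose M := [seq mask (tval m) Q | m <- enum {: (size Q).-tuple bool}].
rewrite (_ : [set t | _] = [set t | exists2 q, q \in M &
    D q /\ realize (cell s t) = g q]); last first.
  apply/seteqP; split=> t /=; last by move=> [q _ []]; exists q.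
  move=> [q Dq tq]; exists q => //.
  have [sq qE] := suppP (g q); rewrite (gD _ Dq) in sq qE.
  have -> : q = mask (map_tuple (fun i => i \in q) (in_tuple Q)) Q.
    rewrite /= -filter_mask; apply: (irr_sorted_eq lt_trans ltxx) => // [|i].
      by apply: sorted_filter => //; exact: lt_trans.
    rewrite mem_filter andb_idr// qE -tq coord_realize => /sum_posP[j <- _].
    by rewrite mem_undup map_f// mem_enum.
  by apply: map_f; rewrite mem_enum.
apply: (@closed_seqU _ _ M (fun q => [set t | D q /\ realize (cell s t) = g q])) => q.
have [Dq|nD] := pselect (D q); last first.
  rewrite (_ : [set t | _] = set0); first exact: closed0.
  by apply/seteqP; split=> t // -[].
rewrite (_ : [set t | _] = [set t | forall i, cell_coord (cell s t) i = bcoord (g q) i]).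
  apply: closed_all => i.
  exact: ((continuous_closedP _).1 (@cell_coord_continuous _ s i) [set x | x = _] (@closed_eq _ _)).
apply/seteqP; split=> t /=; first by move=> [_ <-] i; rewrite coord_realize.
move=> ti; split=> //; apply: coord_inj.
by rewrite coord_realize; apply/funext.
Qed.

(** Pick one point for each support met. The open set [O q] avoids the picked points of all supports
    other than [q], so a finite subcover, in order to contain every picked point, must name every
    support. *)
Lemma finite_cells n (f : simplex R n -> X) : continuous f ->
  exists L : seq (seq C), forall t, supp (f t) \in L.
Proof.
move=> cf; pose g0 q : simplex R n := if pselect (exists t, supp (f t) = q) is left h
  then projT1 (cid h) else vertex R ord0.
have g0E t : supp (f (g0 (supp (f t)))) = supp (f t).
  rewrite /g0; case: pselect => [h|[]]; last by exists t.
  exact: (projT2 (cid h)).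
pose Q q := exists t, supp (f t) = q.
have QE q : Q q -> supp (f (g0 q)) = q by move=> [t <-]; exact: g0E.
pose P q := [set x | exists2 q', Q q' /\ q' <> q & x = f (g0 q')].
have cP q : closed (P q).
  by apply: (@closed_points [set q' | Q q' /\ q' <> q] (f \o g0)) => q' [/QE].
pose O q : set (simplex R n) := [set t | Q q /\ ~ P q (f t)].
have oO q : open (O q).
  have [Qq|nQ] := pselect (Q q); last first.
    rewrite (_ : O q = set0); first exact: open0.
    by apply/seteqP; split=> t // -[].
  rewrite (_ : O q = f @^-1` (~` P q)).
    by move/continuousP: cf; apply; exact: closed_openC.
  by apply/seteqP; split=> t //= -[].
have [|s sO] := simplex_cover oO.
  move=> t; have [Pt|nP] := pselect (exists2 q, Q q & f t = f (g0 q)).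
    have [q Qq tq] := Pt; exists q; split=> //; rewrite tq.
    move=> [q' [Qq' q'q]] /(congr1 supp); rewrite !QE// => e.
    by apply: q'q.
  exists (supp (f t)); split; first by exists t.
  by move=> [q' [Qq' _] e]; apply: nP; exists q'.
exists s => t; have Qt : Q (supp (f t)) by exists t.
have [q qs [Qq nP]] := sO (g0 (supp (f t))).
suff -> : supp (f t) = q by [].
by apply: contrapT => ne; apply: nP; exists (supp (f t)).
Qed.

(** A Lebesgue number argument, uniform in [i] as well: by [finite_cells] all coordinates outside
    the finite list [flatten L] vanish on the image of [f]. *)
Lemma coord_uniform n (f : simplex R n -> X) (e : R) : continuous f -> 0 < e ->
  exists2 r : R, 0 < r & forall t u : simplex R n, (forall j, `|val t 0 j - val u 0 j| < r) ->
    forall i, `|bcoord (f t) i - bcoord (f u) i| < e.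
Proof.
move=> cf e0; have e2 : 0 < e / 2 by rewrite divr_gt0.
have [L fL] := finite_cells cf.
have nb (t : simplex R n) : exists2 r : R, 0 < r & forall u : simplex R n, (forall j, `|val t 0 j - val u 0 j| < r) ->
    forall i, i \in flatten L -> `|bcoord (f t) i - bcoord (f u) i| < e / 2.
  have Ft : Filter (nbhs t) by exact: nbhs_filter.
  have : nbhs t [set u | forall i, i \in flatten L ->
      `|bcoord (f t) i - bcoord (f u) i| < e / 2].
    elim: (flatten L) => [|i0 l IH].
      by apply: filterS filterT => u _ i; rewrite in_nil.
    have N0 : nbhs t [set u | `|bcoord (f t) i0 - bcoord (f u) i0| < e / 2].
      have ci : (fun u => bcoord (f u) i0 : R) u @[u --> t] --> bcoord (f t) i0.
        apply: (@continuous_comp _ _ _ f (fun x => bcoord x i0 : R)); first exact: cf.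
        exact: bcoord_continuous.
      by have /cvgr_dist_lt/(_ _ e2) := ci.
    apply: filterS (filterI N0 IH) => u [H1 H2] i.
    by rewrite inE => /orP[/eqP->//|]; exact: H2.
  move=> [_ [[W oW <-] Wt WU]].
  have /nbhs_ballP[r r0 rW] : nbhs (val t) W by exact: open_nbhs_nbhs.
  exists r => // u ur; apply: WU; apply: rW; split=> // i j.
  by rewrite ord1; exact: ur.
pose r t := s2val (cid2 (nb t)).
have r0 t : 0 < r t := s2valP (cid2 (nb t)).
have rE (t u : simplex R n) : (forall j, `|val t 0 j - val u 0 j| < r t) -> forall i,
    i \in flatten L -> `|bcoord (f t) i - bcoord (f u) i| < e / 2.
  exact: (s2valP' (cid2 (nb t))).
(* Half the radius, so that a point close to one in the ball still lies within [r t] of its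
   centre. *)
pose O t : set (simplex R n) := [set u | ball (val t) (r t / 2) (val u)].
have oO t : open (O t).
  exists (ball (val t) (r t / 2)) => //; exact: ball_open.
have [|s sO] := simplex_cover oO.
  by move=> t; exists t; apply: ballxx; rewrite divr_gt0.
exists (\big[Num.min/1]_(t <- s) (r t / 2)).
  by elim/big_ind : _ => // [x y x0 y0|t _]; rewrite ?lt_min ?x0 ?divr_gt0.
move=> u v uv i; have [t ts [_ tu]] := sO u.
have big_vertices j : `|val u 0 j - val v 0 j| < r t / 2.
  apply: lt_le_trans (uv j) _; move: ts {tu uv}; elim: s {sO} => // t' s IH.
  rewrite inE big_cons ge_min => /orP[/eqP->|/IH ->]; first by rewrite lexx.
  by rewrite orbT.
have [il|il] := boolP (i \in flatten L); last first.
  have out w : bcoord (f w) i = 0.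
    apply: supp_supported; apply: contra il => iw.
    by apply/flattenP; exists (supp (f w)).
  by rewrite !out subrr normr0.
have A1 : `|bcoord (f t) i - bcoord (f u) i| < e / 2.
  apply: rE il => j; apply: lt_trans (tu 0 j) _.
  by have := r0 t; lra.
have A2 : `|bcoord (f t) i - bcoord (f v) i| < e / 2.
  apply: rE il => j; rewrite (splitr (r t)).
  apply: le_lt_trans (ler_distD (val u 0 j) _ _) _.
  by apply: ltrD; [exact: (tu 0 j)|exact: big_vertices].
apply: le_lt_trans (ler_distD (bcoord (f t) i) _ _) _.
by rewrite [X in _ < X](splitr e) distrC; exact: ltrD.
Qed.

End RealizationTopology.

(** * Affine simplices *)

Section Transport.
Variables (A B : eqType) (h : A -> B) (b : seq A -> A) (b' : seq B -> B) (P : A -> Prop).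
Hypothesis bP : forall l, (0 < size l)%N -> {in l, forall x, P x} ->
  P (b l) /\ b' (map h l) = h (b l).

Lemma in_list_del (l : seq A) i : {in l, forall x, P x} -> {in del i l, forall x, P x}.
Proof. by move=> lP x /mem_del; exact: lP. Qed.

Lemma in_list_cons (l : seq A) x : P x -> {in l, forall x, P x} -> {in x :: l, forall x, P x}.
Proof. by move=> Px lP y; rewrite inE => /orP[/eqP->//|/lP]. Qed.

(** Naturality under a map commuting with the barycentres. [P] will be membership in the standard
    simplex, outside which an extended singular simplex takes a default value. *)
Lemma sd_transport l : forall (f : seq A -> int) (g : seq B -> int),
  {in l, forall x, P x} ->
  (forall k, {in k, forall x, P x} -> size k = size l -> f k = g (map h k)) ->
  sd b f l = sd b' g (map h l).
Proof.
elim/list_size_ind: l => l IH f g lP fg; have [l0|l0] := posnP (size l).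
  by rewrite (size0nil l0) /sd /= fg.
have [Pb bE] := bP l0 lP.
rewrite !sd_cons ?size_map// dlt_map.
apply: (@dlt_ext _ _ (fun k => {in k, forall x, P x} /\ size k = (size l).-1)) => [i il|k [kP kl]].
  by split; [exact: in_list_del|exact: size_del].
apply: IH => // [|k' k'P k'k]; first by lia.
by rewrite bE fg//=; [exact: in_list_cons|lia].
Qed.

Lemma hsd_transport l : forall (f : seq A -> int) (g : seq B -> int),
  {in l, forall x, P x} ->
  (forall k, {in k, forall x, P x} -> size k = (size l).+1 -> f k = g (map h k)) ->
  hsd b f l = hsd b' g (map h l).
Proof.
elim/list_size_ind: l => l IH f g lP fg; have [l0|l0] := posnP (size l).
  by rewrite (size0nil l0).
have [Pb bE] := bP l0 lP.
rewrite !hsd_cons ?size_map// dlt_map bE fg//=; last exact: in_list_cons.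
congr (_ - _).
apply: (@dlt_ext _ _ (fun k => {in k, forall x, P x} /\ size k = (size l).-1)) => [i il|k [kP kl]].
  by split; [exact: in_list_del|exact: size_del].
apply: IH => // [|k' k'P k'k]; first by lia.
by rewrite fg//=; [exact: in_list_cons|lia].
Qed.

End Transport.

Lemma prism_ext (A : eqType) (P : A -> Prop) (l : seq (A * A)) :
  forall (f g : seq A -> int),
  (forall x, x \in l -> P x.1 /\ P x.2) ->
  (forall k, {in k, forall x, P x} -> size k = (size l).+1 -> f k = g k) ->
  prism f l = prism g l.
Proof.
elim: l => [//|[a b] l IH] f g lP fg /=.
have [Pa Pb] := lP _ (mem_head _ _).
have lP' : forall x, x \in l -> P x.1 /\ P x.2.
  by move=> x xl; apply: lP; rewrite inE xl orbT.
congr (_ - _).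
  apply: fg; last by rewrite /= size_map.
  apply: in_list_cons => //; apply: in_list_cons => // _ /mapP[x xl ->].
  exact: (lP' x xl).2.
by apply: IH => // k kP kl; apply: fg; [exact: in_list_cons|rewrite /= kl].
Qed.

(** * Points with given coordinates, and big vertices *)

Section Points.
Variables (R : realType) (d : Order.disp_t) (C : porderType d).
Local Notation X := (realization R C).
Variable xd : X.

Definition barycentric (l : seq C) (a : C -> R) :=
  [/\ chainl l, forall i, 0 <= a i, supported a l & \sum_(i <- undup l) a i = 1].

Definition sortl (l : seq C) := sort <=%O (undup l).

Lemma mem_sortl l : sortl l =i l.
Proof. by move=> x; rewrite mem_sort mem_undup. Qed.

Lemma strict_sortl l : chainl l -> strict (sortl l).
Proof.
move=> cl; rewrite /strict lt_sorted_uniq_le sort_uniq undup_uniq /=.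
apply: (@sort_sorted_in _ (mem l)) => [x y xl yl|].
  exact: cl.
by apply/allP => x; rewrite mem_undup.
Qed.

Lemma barycentric_exists l a : barycentric l a -> exists x : X, bcoord x = a.
Proof.
move=> [cl a0 al a1].
have S1 : \sum_(i <- sortl l) a i = 1.
  by rewrite -a1; apply: perm_big; rewrite perm_sort.
have sS := strict_sortl cl.
case E : (sortl l) => [|x0 S]; first by move: S1; rewrite E big_nil => /esym/eqP; rewrite oner_eq0.
have Sn : size (sortl l) = (size S).+1 by rewrite E.
exists (realize (cell (nerve_of x0 sS Sn) (simplex_of x0 sS Sn a0 S1))).
rewrite coord_realize; apply: cell_coord_simplex_of => i; rewrite mem_sortl; exact: al.
Qed.

Definition point_of (a : C -> R) : X :=
  match pselect (exists x : X, bcoord x = a) with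
  | left h => projT1 (cid h)
  | right _ => xd
  end.

Lemma bcoord_point_of l a : barycentric l a -> bcoord (point_of a) = a.
Proof.
move=> /barycentric_exists h; rewrite /point_of; case: pselect => [h'|//].
exact: (projT2 (cid h')).
Qed.

Lemma point_of_bcoord x : point_of (bcoord x) = x.
Proof.
rewrite /point_of; case: pselect => [h'|[]]; last by exists x.
by apply: coord_inj; exact: (projT2 (cid h')).
Qed.

Lemma continuous_point_of (Y : topologicalType) (f : Y -> C -> R) (L : seq (seq C)) :
  (forall i, continuous (fun y => f y i)) ->
  (forall y, exists2 l, l \in L & barycentric l (f y)) ->
  continuous (fun y => point_of (f y)).
Proof.
move=> cf fL; have fE y : bcoord (point_of (f y)) = f y.
  by have [l _ /bcoord_point_of] := fL y.
apply: (@continuous_coord_criterion _ _ _ _ _ (map sortl L)) => [i|y].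
  by rewrite (_ : (fun y => _) = (fun y => f y i))//; apply/funext => y; rewrite fE.
have [l lL [cl _ fl _]] := fL y; exists (sortl l); first exact: map_f.
split; first exact: strict_sortl.
by rewrite fE => i; rewrite mem_sortl; exact: fl.
Qed.

Lemma strict_chainl S : strict S -> @chainl d C S.
Proof.
move=> sS x y xS yS; rewrite /Order.comparable.
have [xy|/ltnW yx] := leqP (index x S) (index y S).
  by have := strict_nth x sS xy; rewrite !nth_index// index_mem => ->.
by have := strict_nth x sS yx; rewrite !nth_index// index_mem => ->//; rewrite orbT.
Qed.

Lemma sumr_lt_size (I : Type) (s : seq I) (f : I -> R) : (0 < size s)%N ->
  (forall i, f i < 1) -> \sum_(i <- s) f i < (size s)%:R.
Proof.
case: s => // i s _ f1; elim: s i => [|i' s IH] i; first by rewrite big_seq1.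
by rewrite big_cons [size _]/= -(natr1 (size (i' :: s))) addrC ltrD//; exact: IH.
Qed.

(** Averaging: the coordinates on the support sum to 1. The lower bound depends only on the size of
    the support, which [finite_cells] bounds along a singular simplex. *)
Lemma big_vertex_ex (x : X) : exists i : C, 1 <= bcoord x i *+ size (supp x).
Proof.
apply: contrapT => /forallNP H; have [sS _] := suppP x.
have S1 : \sum_(i <- supp x) bcoord x i = 1.
  by apply: coord_sum; [exact: lt_sorted_uniq|exact: supp_supported].
have S0 : (0 < size (supp x))%N.
  by case: (supp x) S1 => //; rewrite big_nil => /esym/eqP; rewrite oner_eq0.
suff : \sum_(i <- supp x) bcoord x i *+ size (supp x) < (size (supp x))%:R.
  by rewrite sumrMnl S1 ltxx.
by apply: sumr_lt_size => // i; rewrite ltNge; apply/negP; exact: H.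
Qed.

Definition big_vertex (x : X) : C := projT1 (cid (big_vertex_ex x)).

Lemma big_vertexP x : 1 <= bcoord x (big_vertex x) *+ size (supp x).
Proof. exact: (projT2 (cid (big_vertex_ex x))). Qed.

End Points.

(** * Affine combinations, vertices and barycentres *)

Section Affine.
Variable (R : realType).

Section Aff.
Variables (V : lmodType R) (n : nat).

Definition aff (l : seq V) (t : 'rV[R]_n.+1) : V := \sum_(i < n.+1) t 0 i *: l`_i.

Lemma aff_linear l : linear (aff l).
Proof.
move=> a u v; rewrite /aff scaler_sumr -big_split; apply: eq_bigr => i _.
by rewrite !mxE scalerDl scalerA.
Qed.

HB.instance Definition _ l := GRing.isLinear.Build R _ _ _ (aff l) (aff_linear l).
End Aff.

Lemma simplex_map_linear m n (h : 'I_m.+1 -> 'I_n.+1) :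
  linear (@simplex_map_fun R m n h).
Proof.
move=> a u v; apply/rowP => j; rewrite !mxE mulr_sumr -big_split.
by apply: eq_bigr => i _; rewrite !mxE.
Qed.

HB.instance Definition _ m n h := GRing.isLinear.Build R _ _ _
  (@simplex_map_fun R m n h) (@simplex_map_linear m n h).

Lemma simplex_map_delta m n (h : 'I_m.+1 -> 'I_n.+1) k :
  @simplex_map_fun R m n h (delta_mx 0 k) = delta_mx 0 (h k).
Proof.
apply/rowP => j; rewrite !mxE eqxx /= big_mkcond (bigD1 k)//= big1 ?addr0.
  by rewrite mxE !eqxx eq_sym; case: eqP.
by move=> i ik; rewrite mxE (negbTE ik) andbF if_same.
Qed.

Lemma aff_map (V W : lmodType R) (g : {linear V -> W}) n (l : seq V) (t : 'rV[R]_n.+1) :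
  aff (map g l) t = g (aff l t).
Proof.
rewrite /aff linear_sum; apply: eq_bigr => i _; rewrite linearZ; congr (_ *: _).
have [il|il] := ltnP i (size l); first by rewrite (nth_map 0).
by rewrite !nth_default ?size_map// linear0.
Qed.

Lemma aff_delta (V : lmodType R) n (l : seq V) (k : 'I_n.+1) :
  aff l (delta_mx 0 k : 'rV[R]_n.+1) = l`_k.
Proof.
rewrite /aff (bigD1 k)//= mxE !eqxx scale1r big1 ?addr0// => i ik.
by rewrite mxE (negbTE ik) andbF scale0r.
Qed.

Lemma row_lin_ext (W : lmodType R) n (f g : {linear 'rV[R]_n -> W}) :
  (forall k, f (delta_mx 0 k) = g (delta_mx 0 k)) -> f =1 g.
Proof.
move=> fg v; rewrite [v]row_sum_delta !linear_sum; apply: eq_bigr => i _.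
by rewrite !linearZ fg.
Qed.

Lemma nth_del (T : Type) (x0 : T) i l k :
  (i < size l)%N -> nth x0 (del i l) k = nth x0 l (bump i k).
Proof.
move=> il; rewrite /del nth_cat size_take il /bump.
have [ki|ik] := ltnP k i; first by rewrite add0n nth_take.
by rewrite nth_drop; congr nth; lia.
Qed.

Lemma aff_del (V : lmodType R) n (l : seq V) (i : 'I_n.+2) (t : 'rV[R]_n.+1) :
  size l = n.+2 -> aff (del i l) t = aff l (simplex_map_fun (lift i) t).
Proof.
move=> sl; move: t.
apply: (@row_lin_ext _ _ (aff (del i l)) (aff l \o simplex_map_fun (lift i))) => k.
by rewrite /= simplex_map_delta !aff_delta nth_del// sl.
Qed.

Definition verts n : seq 'rV[R]_n.+1 := [seq delta_mx 0 i | i <- enum 'I_n.+1].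

Lemma size_verts n : size (verts n) = n.+1.
Proof. by rewrite size_map size_enum_ord. Qed.

Lemma nth_verts n (k : 'I_n.+1) : (verts n)`_k = delta_mx 0 k.
Proof. by rewrite (nth_map ord0) ?size_enum_ord// nth_ord_enum. Qed.

Lemma aff_verts n t : aff (verts n) t = t.
Proof.
move: t; apply: (@row_lin_ext _ _ (aff (verts n)) idfun) => k.
by rewrite -[LHS]/(aff _ _) aff_delta nth_verts.
Qed.

Lemma verts_face n (i : 'I_n.+2) :
  map (simplex_map_fun (lift i)) (verts n) = del i (verts n.+1).
Proof.
apply: (@eq_from_nth _ 0) => [|k].
  by rewrite size_map size_del !size_verts.
rewrite size_map size_verts => kn.
rewrite (nth_map 0) ?size_verts// nth_del ?size_verts//.
rewrite (nth_verts (Ordinal kn)) simplex_map_delta -nth_verts.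
by [].
Qed.

Definition barycenter (V : lmodType R) (l : seq V) : V := (size l)%:R^-1 *: \sum_(v <- l) v.

Lemma barycenter_map (V W : lmodType R) (g : {linear V -> W}) (l : seq V) :
  barycenter (map g l) = g (barycenter l).
Proof.
rewrite /barycenter size_map big_map [RHS]linearZ_LR; congr (_ *: _).
by rewrite raddf_sum.
Qed.

Lemma aff_between n (l : seq R) (t : 'rV[R]_n.+1) lo hi :
  t \in @std_simplex R n -> (forall i, (i < n.+1)%N -> lo <= l`_i <= hi) ->
  lo <= aff (l : seq R^o) t <= hi.
Proof.
move=> /set_mem[t0 t1] lb; rewrite -[lo]mul1r -[hi]mul1r -t1 !mulr_suml.
by apply/andP; split; apply: ler_sum => i _; apply: ler_wpM2l => //;
  have /andP[] := lb i (ltn_ord i).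
Qed.

Lemma aff_entry m n (l : seq 'rV[R]_m) (t : 'rV[R]_n.+1) j :
  aff l t 0 j = aff ([seq (v : 'rV[R]_m) 0 j | v <- l] : seq R^o) t.
Proof.
rewrite /aff summxE; apply: eq_bigr => i _; rewrite mxE; congr (_ * _).
have [il|il] := ltnP i (size l); first by rewrite (nth_map 0).
by rewrite !nth_default ?size_map// mxE.
Qed.

Lemma barycenter_between (l : seq R^o) lo hi : (0 < size l)%N ->
  {in l, forall x, lo <= x <= hi} -> lo <= barycenter l <= hi.
Proof.
move=> l0 lb; have s0 : 0 < (size l)%:R :> R by rewrite ltr0n.
rewrite /barycenter /GRing.scale /= [_^-1 * _]mulrC ler_pdivlMr// ler_pdivrMr//.
elim: l {l0 s0} lb => [|x l IH] lb; first by rewrite big_nil !mulr0 lexx.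
rewrite big_cons /= -natr1 !mulrDr !mulr1 ![_ + lo]addrC ![_ + hi]addrC.
have /andP[x1 x2] := lb x (mem_head _ _).
have /andP[l1 l2] := IH (fun y yl => lb y (mem_behead (s := x :: l) yl)).
by rewrite !lerD.
Qed.

Lemma barycenter_entry m (l : seq 'rV[R]_m) j :
  barycenter l 0 j = barycenter ([seq (v : 'rV[R]_m) 0 j | v <- l] : seq R^o).
Proof. by rewrite /barycenter size_map big_map mxE summxE. Qed.

Definition in_simplex m (l : seq 'rV[R]_m.+1) := {in l, forall v, v \in @std_simplex R m}.

Lemma aff_in m n (l : seq 'rV[R]_m.+1) (t : 'rV[R]_n.+1) : in_simplex l -> size l = n.+1 ->
  t \in @std_simplex R n -> aff l t \in @std_simplex R m.
Proof.
move=> lS sl tS; apply/mem_set.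
have lP i : (i < n.+1)%N -> @std_simplex R m (l`_i).
  by move=> il; apply: set_mem; apply: lS; rewrite mem_nth// sl.
have [t0 t1] := set_mem tS; split=> [j|].
  rewrite /aff summxE; apply: sumr_ge0 => i _; rewrite mxE mulr_ge0//.
  by have [] := lP i (ltn_ord i).
under eq_bigr do rewrite /aff summxE.
rewrite exchange_big /= -t1; apply: eq_bigr => i _.
under eq_bigr do rewrite mxE.
by rewrite -mulr_sumr; have [_ ->] := lP i (ltn_ord i); rewrite mulr1.
Qed.

Lemma barycenter_in m (l : seq 'rV[R]_m.+1) : (0 < size l)%N -> in_simplex l ->
  barycenter l \in @std_simplex R m.
Proof.
move=> l0 lS; apply/mem_set; split=> [j|].
  rewrite barycenter_entry; have := @barycenter_between ([seq (v : 'rV[R]_m.+1) 0 j | v <- l] : seq R^o) 0 1.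
  rewrite size_map l0 => /(_ isT) H.
  suff /H/andP[] : {in ([seq (v : 'rV[R]_m.+1) 0 j | v <- l] : seq R^o),
    forall x : R, 0 <= x <= 1} by [].
  move=> _ /mapP[v /lS/set_mem[v0 v1] ->]; rewrite v0 /= -v1 (bigD1 j)//= lerDl.
  exact: sumr_ge0.
under eq_bigr do rewrite mxE summxE.
rewrite -mulr_sumr exchange_big /= (eq_big_seq (fun=> 1)); last first.
  by move=> v /lS/set_mem[].
by rewrite big_const_seq count_predT iter_addr_0 mulVf// pnatr_eq0 -lt0n.
Qed.

Lemma in_simplex_verts n : in_simplex (verts n).
Proof. by move=> _ /mapP[i _ ->]; exact: vertex_subproof. Qed.

End Affine.

(** * Subdivision of singular cochains *)

Section SingularChains.
Variables (R : realType) (X : topologicalType).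

(** Evaluation is made total by the value 0 on discontinuous maps, so that lists of points can be
    handled without carrying continuity proofs. *)
Definition cochain_at n (c : cochain R X n) (g : simplex R n -> X) : int :=
  match pselect (continuous g) with
  | left h => c (mkcts h : continuousType _ _)
  | right _ => 0
  end.

Lemma cochain_atE n (c : cochain R X n) (s : singular_simplex R X n) : cochain_at c s = c s.
Proof.
rewrite /cochain_at; case: pselect => [h|[]]; last exact: cts_fun.
by congr (c _); apply/continuousEP.
Qed.

Lemma singular_of n (g : simplex R n -> X) : continuous g ->
  exists s : singular_simplex R X n, g = s.
Proof. by move=> h; exists (mkcts h). Qed.

Lemma cochain_at_coboundary n (c : cochain R X n) (g : simplex R n.+1 -> X) : continuous g ->
  cochain_at (coboundary R X n c) g =
  \sum_(i < n.+2) (-1) ^+ i * cochain_at c (g \o simplex_map (lift i)).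
Proof.
move=> /singular_of[s ->]; rewrite cochain_atE; apply: eq_bigr => i _.
by rewrite -(cochain_atE c (face s i)).
Qed.

Lemma cochain_at0 n (g : simplex R n -> X) : cochain_at (0 : cochain R X n) g = 0.
Proof. by rewrite /cochain_at; case: pselect. Qed.

Section Evaluation.
Variables (V : lmodType R) (H : V -> X).

Definition cochain_on n (c : cochain R X n) (l : seq V) : int :=
  if size l == n.+1 then cochain_at c (fun t : simplex R n => H (aff l (val t))) else 0.

Lemma cochain_on_size n c (l : seq V) : size l = n.+1 ->
  @cochain_on n c l = cochain_at c (fun t : simplex R n => H (aff l (val t))).
Proof. by rewrite /cochain_on => ->; rewrite eqxx. Qed.

Lemma cochain_on_coboundary n (c : cochain R X n) (l : seq V) : size l = n.+2 ->
  continuous (fun t : simplex R n.+1 => H (aff l (val t))) ->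
  cochain_on (coboundary R X n c) l = dlt (cochain_on c) l.
Proof.
move=> sl cl; rewrite cochain_on_size// cochain_at_coboundary// dlt_sum sl.
apply: eq_bigr => i _; rewrite cochain_on_size ?size_del ?sl//; congr (_ * cochain_at c _).
by apply/funext => t; rewrite /= aff_del.
Qed.

End Evaluation.

Lemma cochain_on_map (V W : lmodType R) (H : W -> X) (G : V -> X) (g : {linear V -> W})
    n (c : cochain R X n) l (P : V -> Prop) :
  (forall t : simplex R n, size l = n.+1 -> P (aff l (val t))) ->
  (forall v, P v -> H (g v) = G v) ->
  cochain_on G c l = cochain_on H c (map g l).
Proof.
move=> lP HG; rewrite /cochain_on size_map; case: eqP => // sl.
by congr (cochain_at c _); apply/funext => t; rewrite aff_map HG//; exact: lP.
Qed.

(** Defined on the whole vector space so that [aff] can be composed with it; outside the standard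
    simplex the value is that at a vertex. *)
Definition extend n (s : simplex R n -> X) (v : 'rV[R]_n.+1) : X :=
  s (insubd (vertex R ord0) v).

Lemma extendE n (s : simplex R n -> X) (t : simplex R n) : extend s (val t) = s t.
Proof. by rewrite /extend valKd. Qed.

Lemma extend_continuous m n (s : simplex R m -> X) l : continuous s -> in_simplex l ->
  size l = n.+1 -> continuous (fun t : simplex R n => extend s (aff l (val t))).
Proof.
move=> cs lS sl.
pose f (t : simplex R n) : simplex R m :=
  exist (fun u => u \in @std_simplex R m) _ (aff_in lS sl (valP t)).
rewrite (_ : (fun t => _) = s \o f); last first.
  by apply/funext => t; rewrite /= -extendE.
have cf : continuous f.
  apply: continuous_to_simplex => j; rewrite /= /aff.
  rewrite (_ : (fun t => _) = fun t : simplex R n => \sum_(i < n.+1) val t 0 i * l`_i 0 j).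
    apply: continuous_sum => i t.
    exact: (cvgM (@simplex_coord_continuous R n i t) (cvg_cst _)).
  by apply/funext => t; rewrite summxE; apply: eq_bigr => i _; rewrite mxE.
by move=> t; apply: continuous_comp; [exact: cf|exact: cs].
Qed.

Lemma cochain_on_extend_coboundary m n (s : simplex R m -> X) (c : cochain R X n) l :
  continuous s -> in_simplex l -> size l = n.+2 ->
  cochain_on (extend s) (coboundary R X n c) l = dlt (cochain_on (extend s) c) l.
Proof. by move=> cs lS sl; apply: cochain_on_coboundary => //; exact: extend_continuous. Qed.

Lemma cochain_on_sub m n p (s : simplex R m -> X) (s' : simplex R n -> X)
    (A : {linear 'rV[R]_n.+1 -> 'rV[R]_m.+1}) (c : cochain R X p) l :
  (forall t : simplex R n, s' t = extend s (A (val t))) -> in_simplex l ->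
  cochain_on (extend s') c l = cochain_on (extend s) c (map A l).
Proof.
move=> s's lS; apply: (@cochain_on_map _ _ _ _ A _ c l (fun v => v \in @std_simplex R n)).
  by move=> t sl; apply: aff_in => //; exact: valP.
by move=> v vS; rewrite -[v]/(val (exist _ v vS : simplex R n)) extendE s's.
Qed.

Definition subdivide n (c : cochain R X n) : cochain R X n :=
  fun s => sd (@barycenter R _) (cochain_on (extend s) c) (verts R n).

Definition subdivide_homotopy n (c : cochain R X n.+1) : cochain R X n :=
  fun s => hsd (@barycenter R _) (cochain_on (extend s) c) (verts R n).

Lemma barycenter_transport m n (A : {linear 'rV[R]_n.+1 -> 'rV[R]_m.+1}) l :
  (0 < size l)%N -> in_simplex l ->
  (barycenter l \in @std_simplex R n) /\ barycenter (map A l) = A (barycenter l).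
Proof. by move=> l0 lS; split; [exact: barycenter_in|exact: barycenter_map]. Qed.

Lemma sd_id_transport m (f g : seq 'rV[R]_m.+1 -> int) l : in_simplex l ->
  (forall k, in_simplex k -> size k = size l -> f k = g k) ->
  sd (@barycenter R _) f l = sd (@barycenter R _) g l.
Proof.
move=> lS fg; rewrite -[l in RHS]map_id.
apply: (sd_transport (P := fun v => v \in @std_simplex R m)) => // [k k0 kS|k kS kl].
  by rewrite map_id; split=> //; exact: barycenter_in.
by rewrite map_id; exact: fg.
Qed.

Lemma hsd_id_transport m (f g : seq 'rV[R]_m.+1 -> int) l : in_simplex l ->
  (forall k, in_simplex k -> size k = (size l).+1 -> f k = g k) ->
  hsd (@barycenter R _) f l = hsd (@barycenter R _) g l.
Proof.
move=> lS fg; rewrite -[l in RHS]map_id.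
apply: (hsd_transport (P := fun v => v \in @std_simplex R m)) => // [k k0 kS|k kS kl].
  by rewrite map_id; split=> //; exact: barycenter_in.
by rewrite map_id; exact: fg.
Qed.

Lemma cochain_on_subdivide m n (s : simplex R m -> X) (c : cochain R X n) l :
  continuous s -> in_simplex l -> size l = n.+1 ->
  cochain_on (extend s) (subdivide c) l = sd (@barycenter R _) (cochain_on (extend s) c) l.
Proof.
move=> cs lS sl; rewrite cochain_on_size//.
have [s' s'E] := singular_of (extend_continuous cs lS sl).
rewrite s'E cochain_atE /subdivide.
have lE : l = map (aff l) (verts R n).
  apply: (@eq_from_nth _ 0) => [|k kl]; first by rewrite size_map size_verts.
  have kn : (k < n.+1)%N by rewrite -sl.
  rewrite (nth_map 0) ?size_verts// (nth_verts _ (Ordinal kn)).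
  by rewrite aff_delta.
transitivity (sd (@barycenter R _) (cochain_on (extend s) c) (map (aff l) (verts R n))); last by rewrite -lE.
apply: (sd_transport (P := fun v => v \in @std_simplex R n)).
- by move=> k k0 kS; exact: barycenter_transport.
- exact: in_simplex_verts.
- move=> k kS _; apply: cochain_on_sub => // t.
  by rewrite -s'E.
Qed.

Lemma face_sub n (s : singular_simplex R X n.+1) i (t : simplex R n) :
  face s i t = extend s (simplex_map_fun (lift i) (val t)).
Proof. exact: esym (extendE s (simplex_map (lift i) t)). Qed.

Lemma subdivide_coboundary n (c : cochain R X n) :
  subdivide (coboundary R X n c) = coboundary R X n (subdivide c).
Proof.
apply/funext => s; rewrite /subdivide.
rewrite (sd_id_transport (g := dlt (cochain_on (extend s) c))); last 2 first.
- exact: in_simplex_verts.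
- by move=> k kS; rewrite size_verts => sk; rewrite cochain_on_extend_coboundary//; exact: cts_fun.
rewrite sd_dlt dlt_sum size_verts; apply: eq_bigr => i _; congr (_ * _).
rewrite -verts_face.
symmetry; apply: (sd_transport (P := fun v => v \in @std_simplex R n)).
- by move=> k k0 kS; exact: barycenter_transport.
- exact: in_simplex_verts.
- by move=> k kS _; apply: cochain_on_sub => // t; exact: face_sub.
Qed.

Lemma subdivide_homotopyE n (c : cochain R X n.+1) :
  subdivide_homotopy (coboundary R X n.+1 c) + coboundary R X n (subdivide_homotopy c) = c - subdivide c.
Proof.
apply/funext => s.
have := @hsd_dlt _ (@barycenter R _) (verts R n.+1) (cochain_on (extend s) c).
rewrite size_verts => /(_ isT).
have -> : cochain_on (extend s) c (verts R n.+1) = c s.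
  rewrite cochain_on_size ?size_verts// -(cochain_atE c s); congr (cochain_at c _).
  by apply/funext => t; rewrite aff_verts extendE.
have -> : hsd (@barycenter R _) (dlt (cochain_on (extend s) c)) (verts R n.+1) =
    subdivide_homotopy (coboundary R X n.+1 c) s.
  symmetry; apply: hsd_id_transport; first exact: in_simplex_verts.
  by move=> k kS; rewrite size_verts => sk; rewrite cochain_on_extend_coboundary//; exact: cts_fun.
have -> : dlt (hsd (@barycenter R _) (cochain_on (extend s) c)) (verts R n.+1) = coboundary R X n (subdivide_homotopy c) s.
  rewrite dlt_sum size_verts; apply: eq_bigr => i _; congr (_ * _).
  rewrite -verts_face.
  symmetry; apply: (hsd_transport (P := fun v => v \in @std_simplex R n)).
  - by move=> k k0 kS; exact: barycenter_transport.
  - exact: in_simplex_verts.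
  - by move=> k kS _; apply: cochain_on_sub => // t; exact: face_sub.
by [].
Qed.

Definition near_list m (e : R) (l : seq 'rV[R]_m) :=
  {in l &, forall x y : 'rV[R]_m, forall j, `|x 0 j - y 0 j| <= e}.

(** Among the at most N+1 differences averaged, that of [x] with itself is 0, which leaves the
    factor N/(N+1). *)
Lemma barycenter_near m N e (l : seq 'rV[R]_m.+1) x j : (size l <= N.+1)%N -> x \in l ->
  near_list e l -> `|barycenter l 0 j - x 0 j| <= N%:R / N.+1%:R * e.
Proof.
move=> lN xl ne; have l0 : (0 < size l)%N by case: (l) xl.
have e0 : 0 <= e by apply: le_trans (ne x x xl xl j); exact: normr_ge0.
have s0 : 0 < (size l)%:R :> R by rewrite ltr0n.
have -> : barycenter l 0 j - x 0 j = (size l)%:R^-1 * \sum_(v <- l) (v 0 j - x 0 j).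
  rewrite sumrB mulrBr mxE summxE; congr (_ - _).
  have -> : \sum_(v <- l) x 0 j = (size l)%:R * x 0 j.
    by rewrite big_const_seq count_predT iter_addr_0 mulr_natl.
  by rewrite mulKf// gt_eqF.
rewrite normrM gtr0_norm ?invr_gt0//.
have H : `|\sum_(v <- l) (v 0 j - x 0 j)| <= (size l).-1%:R * e.
  apply: le_trans (ler_norm_sum _ _ _) _.
  rewrite (big_rem x)//= subrr normr0 add0r.
  have -> : (size l).-1 = size (rem x l) by rewrite size_rem.
  have : {in rem x l, forall v : 'rV[R]_m.+1, `|v 0 j - x 0 j| <= e}.
    by move=> v /mem_rem vl; exact: ne.
  elim: (rem x l) => [|v r IH] rb; first by rewrite big_nil mul0r.
  rewrite big_cons /= -natr1 mulrDl mul1r addrC lerD//.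
    by apply: IH => w wr; apply: rb; rewrite inE wr orbT.
  by apply: rb; rewrite mem_head.
apply: le_trans (ler_wpM2l _ H) _; first by rewrite invr_ge0 ltW.
rewrite mulrA ler_wpM2r// mulrC ler_pdivrMr// mulrAC ler_pdivlMr ?ltr0n//.
rewrite -!natrM ler_nat; move: lN l0; case: (size l) => // k; nia.
Qed.

Lemma barycenter_box m (l : seq 'rV[R]_m.+1) j lo hi : (0 < size l)%N ->
  {in l, forall x : 'rV[R]_m.+1, lo <= x 0 j <= hi} -> lo <= barycenter l 0 j <= hi.
Proof.
move=> l0 lb; rewrite barycenter_entry; apply: barycenter_between; first by rewrite size_map.
by move=> _ /mapP[x xl ->]; exact: lb.
Qed.

(** [N] stays fixed while the induction goes down to smaller faces. The clause on intervals keeps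
    subdivided points in the coordinate box of their face; applied to the box around the barycentre
    of [l], it shows that they are as close to it as the points of the face. *)
Lemma sd_mesh m N (l : seq 'rV[R]_m.+1) : forall e (f : seq 'rV[R]_m.+1 -> int),
  in_simplex l -> near_list e l -> (size l <= N.+1)%N ->
  (forall k, in_simplex k -> size k = size l -> near_list (N%:R / N.+1%:R * e) k ->
    (forall j lo hi, {in l, forall x : 'rV[R]_m.+1, lo <= x 0 j <= hi} ->
       {in k, forall x : 'rV[R]_m.+1, lo <= x 0 j <= hi}) -> f k = 0) ->
  sd (@barycenter R _) f l = 0.
Proof.
elim/list_size_ind: l => l IH e f lS ne lN f0; have [l0|l0] := posnP (size l).
  by rewrite (size0nil l0) /sd /= f0// l0.
rewrite sd_cons//; rewrite -(@dlt0 _ _ l).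
apply: (@dlt_ext _ _ (fun k => [/\ in_simplex k, near_list e k, size k = (size l).-1 &
    {subset k <= l}])).
  move=> i il; split; [by move=> x /mem_del; exact: lS| |exact: size_del|].
    by move=> x y /mem_del xl /mem_del yl; exact: ne.
  by move=> x /mem_del.
move=> k [kS nk kl kll]; apply: (IH k _ e) => //; [by lia|by lia|].
move=> k' k'S k'k nk' box; apply: f0.
- by move=> x; rewrite in_cons => /orP[/eqP->|/k'S//]; exact: (barycenter_in l0 lS).
- by rewrite /=; lia.
- have nb x j : x \in k' -> `|barycenter l 0 j - x 0 j| <= N%:R / N.+1%:R * e.
    move=> xk'; rewrite ler_distlC.
    have := box j (barycenter l 0 j - N%:R / N.+1%:R * e) (barycenter l 0 j + N%:R / N.+1%:R * e).
    move=> /(_ _ x xk'); apply => y yk.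
    have := barycenter_near j lN (kll _ yk) ne.
    by rewrite ler_distlC.
  move=> x y; rewrite !inE => /orP[/eqP->|xk'] /orP[/eqP->|yk'] j.
  - have [z zl] : exists z, z \in l by case: (l) l0 => // z ? _; exists z; exact: mem_head.
    by rewrite subrr normr0; apply: le_trans (barycenter_near j lN zl ne).
  - exact: nb.
  - by rewrite distrC; exact: nb.
  - exact: nk'.
- move=> j lo hi lb x; rewrite inE => /orP[/eqP->|xk']; first exact: barycenter_box.
  by apply: (box j lo hi) => // y yk; apply: lb; exact: kll.
Qed.

Lemma iter_subdivide_small m n (s : simplex R m -> X) (c : cochain R X n) M :
  continuous s -> forall e,
  (forall k, in_simplex k -> size k = n.+1 -> near_list ((n%:R / n.+1%:R) ^+ M * e) k ->
    cochain_on (extend s) c k = 0) ->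
  forall l, in_simplex l -> size l = n.+1 -> near_list e l ->
    cochain_on (extend s) (iter M (@subdivide n) c) l = 0.
Proof.
move=> cs; elim: M => [|M IH] e small l lS sl nl.
  by apply: small => //; rewrite expr0 mul1r.
rewrite iterS cochain_on_subdivide//; apply: (@sd_mesh m n l e) => //; first by rewrite sl.
move=> k kS kl nk _; apply: (IH (n%:R / n.+1%:R * e)) => //; last by rewrite kl.
by move=> k' k'S k'k nk'; apply: small => //; rewrite exprSr -mulrA.
Qed.

End SingularChains.

(** * Fine simplices *)

Lemma geometric_small (R : realType) n (r : R) : 0 < r ->
  exists M, forall m, (M <= m)%N -> (n%:R / n.+1%:R : R) ^+ m < r.
Proof.
move=> r0; have q1 : `|n%:R / n.+1%:R : R| < 1.
  rewrite ger0_norm ?divr_ge0// ltr_pdivrMr ?ltr0n// mul1r ltr_nat//.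
have /cvgrPdist_lt/(_ r r0)[M _ HM] := cvg_expr q1.
exists M => m mM; have := HM m mM; rewrite sub0r normrN ger0_norm//.
Qed.

Section Fine.
Variables (R : realType) (d : Order.disp_t) (C : porderType d).
Local Notation X := (realization R C).

(* The big vertices of the corners then span a simplex of the nerve, as in
   simplicial approximation; asking it at every point [u], and not only at the
   corners, makes the condition stable under subdivision. *)
Definition fine_simplex n (s : simplex R n -> X) :=
  forall t u : simplex R n, 0 < bcoord (s t) (big_vertex (s u)).

Lemma fine_near n (s : simplex R n -> X) : continuous s ->
  exists2 r : R, 0 < r & forall p l e, in_simplex l -> size l = p.+1 -> near_list e l -> e < r ->
    fine_simplex (fun t : simplex R p => extend s (aff l (val t))).
Proof.
move=> cs; have [L sL] := finite_cells cs.
(* A big coordinate is at least 1/N, hence at least 1/(N+1), where no division by 0 can occur; a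
   variation smaller than 1/(N+1) leaves it positive. *)
pose N := (\max_(S <- L) size S)%N.
have N0 : 0 < N.+1%:R^-1 :> R by rewrite invr_gt0 ltr0n.
have [r r0 rE] := coord_uniform cs N0.
exists r => // p l e lS sl nl er t u.
pose pt (t : simplex R p) : simplex R n :=
  exist (fun u => u \in @std_simplex R n) _ (aff_in lS sl (valP t)).
rewrite -[aff l (val t)]/(val (pt t)) -[aff l (val u)]/(val (pt u)) !extendE.
set v := big_vertex _.
have vN : N.+1%:R^-1 <= bcoord (s (pt u)) v.
  have := big_vertexP (s (pt u)); rewrite -/v => v1.
  rewrite -[X in X <= _]mul1r ler_pdivrMr ?ltr0n// mulr_natr.
  apply: le_trans v1 _; apply: ler_wpMn2l; first exact: coord_ge0.
  by apply: leqW; apply: leq_bigmax_seq (sL _) _.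
have close j : `|val (pt t) 0 j - val (pt u) 0 j| <= e.
  rewrite /= !aff_entry distrC ler_distlC; apply: (aff_between (valP t)) => i ip.
  have il : (i < size l)%N by rewrite sl.
  rewrite (nth_map 0)//.
  suff : (l`_i : 'rV[R]_n.+1) 0 j - e <= aff ([seq (v : 'rV[R]_n.+1) 0 j | v <- l] : seq R^o) (val u)
    <= (l`_i : 'rV[R]_n.+1) 0 j + e by move=> /andP[]; lra.
  apply: (aff_between (valP u)) => k kp.
  have kl : (k < size l)%N by rewrite sl.
  rewrite (nth_map 0)//.
  have := nl _ _ (mem_nth 0 il) (mem_nth 0 kl) j.
  by rewrite ler_distlC.
have := rE (pt t) (pt u) (fun j => le_lt_trans (close j) er) v.
by rewrite ltr_distlC => /andP[_ h]; move: h vN; set a := bcoord _ _; set b := bcoord _ _; set x := _^-1; lra.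
Qed.

Lemma near_list1 m (l : seq 'rV[R]_m.+1) : in_simplex l -> near_list 1 l.
Proof.
move=> lS; have H x : x \in l -> forall j, 0 <= x 0 j <= 1.
  move=> /lS/set_mem[x0 x1] j; rewrite x0 /= -x1 (bigD1 j)//= lerDl.
  exact: sumr_ge0.
move=> x y /H xH /H yH j; have /andP[a1 a2] := xH j; have /andP[b1 b2] := yH j.
by rewrite ler_distlC; apply/andP; split; lra.
Qed.

Section Vanishing.
Variables (n : nat) (c : cochain R X n).
Hypothesis cfine : forall s : singular_simplex R X n, fine_simplex s -> c s = 0.

Lemma iter_subdivide_vanish m (s : simplex R m -> X) : continuous s ->
  exists M, forall k, (M <= k)%N -> forall l, in_simplex l -> size l = n.+1 ->
    cochain_on (extend s) (iter k (@subdivide R X n) c) l = 0.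
Proof.
move=> cs; have [r r0 rE] := fine_near cs; have [M MP] := geometric_small n r0.
exists M => k Mk l lS sl; apply: (iter_subdivide_small cs (e := 1)) => //; last exact: near_list1.
move=> k' k'S sk' nk'; rewrite mulr1 in nk'.
have fk := rE n k' _ k'S sk' nk' (MP k Mk).
rewrite cochain_on_size//; have [s' s'E] := singular_of (extend_continuous cs k'S sk').
by rewrite s'E cochain_atE; apply: cfine; rewrite -s'E.
Qed.

End Vanishing.

Lemma subdivide_homotopy_eq0 n (c : cochain R X n.+1) (s : singular_simplex R X n) :
  (forall k, in_simplex k -> size k = n.+2 -> cochain_on (extend s) c k = 0) -> subdivide_homotopy c s = 0.
Proof.
move=> c0; rewrite /subdivide_homotopy (hsd_id_transport (g := fun=> 0)).
- have := hsd_additive (@barycenter R _) (verts R n) (fun=> 0) (fun=> 0).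
  by rewrite [X in _ = X]subrr => e; rewrite -[RHS]e; apply: eq_hsd => k; rewrite subrr.
- exact: in_simplex_verts.
- by move=> k kS; rewrite size_verts; exact: c0.
Qed.

Lemma subdivide0 n : subdivide (0 : cochain R X n) = 0.
Proof.
apply/funext => s; rewrite /subdivide (sd_id_transport (g := fun=> 0)).
- have := sd_additive (@barycenter R _) (verts R n) (fun=> 0) (fun=> 0).
  by rewrite [X in _ = X]subrr => e; rewrite -[RHS]e; apply: eq_sd => k; rewrite subrr.
- exact: in_simplex_verts.
- by move=> k kS sk; rewrite /cochain_on; case: ifP => // _; exact: cochain_at0.
Qed.

Lemma cocycle_iter_subdivide n (c : cochain R X n) k : coboundary R X n c = 0 ->
  coboundary R X n (iter k (@subdivide R X n) c) = 0.
Proof.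
by move=> c0; elim: k => [//|k IH]; rewrite iterS -subdivide_coboundary IH subdivide0.
Qed.

(** The homotopies of the first [k] subdivisions; for a cocycle, their coboundaries telescope. *)
Fixpoint hsum n (c : cochain R X n.+1) k : cochain R X n :=
  if k is k'.+1 then hsum c k' + subdivide_homotopy (iter k' (@subdivide R X n.+1) c) else 0.

Lemma coboundary_hsum n (c : cochain R X n.+1) k : coboundary R X n.+1 c = 0 ->
  coboundary R X n (hsum c k) = c - iter k (@subdivide R X n.+1) c.
Proof.
move=> c0; elim: k => [|k IH]; first by rewrite raddf0 subrr.
rewrite /= raddfD /= IH; have := subdivide_homotopyE (iter k (@subdivide R X n.+1) c).
rewrite cocycle_iter_subdivide//; have -> : subdivide_homotopy (0 : cochain R X n.+2) = 0.
  apply/funext => s; apply: subdivide_homotopy_eq0 => l lS sl.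
  by rewrite /cochain_on; case: ifP => // _; exact: cochain_at0.
by rewrite add0r => ->; rewrite addrA subrK.
Qed.

(** On a given simplex all terms of [hsum] beyond [M] vanish, so cutting the sum at [M n s], a bound
    depending on [s], defines a cochain. *)
Lemma fine_cocycle_exact n (c : cochain R X n.+1) : coboundary R X n.+1 c = 0 ->
  (forall s : singular_simplex R X n.+1, fine_simplex s -> c s = 0) ->
  exists b, coboundary R X n b = c.
Proof.
move=> c0 cfine.
have MP m (s : singular_simplex R X m) := iter_subdivide_vanish cfine (@cts_fun _ _ s).
pose M m (s : singular_simplex R X m) := projT1 (cid (MP m s)).
have ME m s := projT2 (cid (MP m s)).
have hsum_stable (s : singular_simplex R X n) k : (M n s <= k)%N ->
    hsum c k s = hsum c (M n s) s.
  move=> /subnK <-; elim: (k - _)%N => [//|j IH]; rewrite addSn.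
  rewrite -IH -[RHS]addr0; congr (_ + _).
  by apply: subdivide_homotopy_eq0; apply: ME; exact: leq_addl.
exists (fun s => hsum c (M n s) s); apply/funext => s.
(* One bound for [s] and all its faces, so that [coboundary_hsum] applies with a single number of
   subdivisions. *)
pose B := (M n.+1 s + \sum_(i < n.+2) M n (face s i))%N.
have MB i : (M n (face s i) <= B)%N.
  by rewrite /B (bigD1 i)//= addnCA leq_addr.
transitivity (coboundary R X n (hsum c B) s).
  by apply: eq_bigr => i _; rewrite hsum_stable.
rewrite coboundary_hsum//.
suff e : iter B (@subdivide R X n.+1) c s = 0.
  by rewrite -[RHS]subr0 -e.
have := ME n.+1 s B (leq_addr _ _) (verts R n.+1) (@in_simplex_verts R n.+1) (size_verts R n.+1).
rewrite cochain_on_size ?size_verts// => <-; rewrite -(cochain_atE _ s); congr (cochain_at _ _).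
by apply/funext => t; rewrite aff_verts extendE.
Qed.

Lemma coboundary_coboundary n (b : cochain R X n) :
  coboundary R X n.+1 (coboundary R X n b) = 0.
Proof.
apply/funext => s; rewrite -(cochain_atE _ s).
have -> : cochain_at (coboundary R X n.+1 (coboundary R X n b)) s =
    cochain_on (extend s) (coboundary R X n.+1 (coboundary R X n b)) (verts R n.+2).
  rewrite cochain_on_size ?size_verts//; congr (cochain_at _ _).
  by apply/funext => t; rewrite aff_verts extendE.
have cs : continuous s by exact: cts_fun.
rewrite cochain_on_extend_coboundary ?size_verts//; last exact: in_simplex_verts.
rewrite -[RHS](dlt_dlt (cochain_on (extend s) b) (verts R n.+2)).
apply: (@dlt_ext _ _ (fun k => in_simplex k /\ size k = n.+2)) => [i il|k [kS kl]].
  by split; [move=> x /mem_del; exact: in_simplex_verts|rewrite size_del// size_verts].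
exact: cochain_on_extend_coboundary.
Qed.

(* The homotopy is evaluated on constant edges only, where it vanishes. *)
Lemma fine_cocycle0 (c : cochain R X 0) :
  (forall s : singular_simplex R X 1, fine_simplex s -> coboundary R X 0 c s = 0) ->
  coboundary R X 0 c = 0.
Proof.
move=> cfine; set c1 := coboundary R X 0 c.
have c1E k : iter k (@subdivide R X 1) c1 = coboundary R X 0 (iter k (@subdivide R X 0) c).
  by elim: k => [//|k IH]; rewrite !iterS IH subdivide_coboundary.
have h0 (b : cochain R X 0) : subdivide_homotopy (coboundary R X 0 b) = 0.
  apply/funext => s; have cs : continuous s by exact: cts_fun.
  rewrite /subdivide_homotopy (hsd_id_transport (g := dlt (cochain_on (extend s) b))); last 2 first.
  - exact: in_simplex_verts.
  - by move=> k kS; rewrite size_verts => sk; rewrite cochain_on_extend_coboundary.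
  have : size (verts R 0) = 1%N by rewrite size_verts.
  case: (verts R 0) => [//|x [|//]] _.
  rewrite /hsd /= subr0 /barycenter /= big_seq1 invr1 scale1r.
  by rewrite subr0 subrr.
apply/funext => s; have [M MP] := iter_subdivide_vanish cfine (@cts_fun _ _ s).
have e : c1 - iter M (@subdivide R X 1) c1 = 0.
  rewrite -coboundary_hsum; last exact: coboundary_coboundary.
  have -> : hsum c1 M = 0.
    elim: (M) => [//|k IH]; rewrite /= IH add0r c1E; exact: h0.
  by rewrite raddf0.
have /subr0_eq -> := e.
have := MP M (leqnn _) (verts R 1) (@in_simplex_verts R 1) (size_verts R 1).
rewrite cochain_on_size ?size_verts// => E; apply: etrans E; rewrite -(cochain_atE _ s); congr (cochain_at _ _).
by apply/funext => t; rewrite aff_verts extendE.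
Qed.

End Fine.

(** * Straightening fine simplices *)

Lemma map_lift_enum n (i : 'I_n.+2) : map (lift i) (enum 'I_n.+1) = del i (enum 'I_n.+2).
Proof.
apply: (@eq_from_nth _ ord0) => [|k].
  by rewrite size_map size_del !size_enum_ord.
rewrite size_map size_enum_ord => kn; apply: val_inj.
rewrite (nth_map ord0) ?size_enum_ord// nth_del ?size_enum_ord//=.
rewrite (nth_ord_enum ord0 (Ordinal kn)) nth_enum_ord//.
by rewrite /bump; case: leqP => //; lia.
Qed.

(** * The cylinder over a standard simplex *)

Section PrismSpace.
Variable R : realType.

Definition cyl n : lmodType R := ('rV[R]_n.+1 * R^o)%type.

Lemma aff_fst n k (l : seq (cyl n)) (t : 'rV[R]_k.+1) : (aff l t).1 = aff (map fst l) t.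
Proof.
rewrite /aff (big_morph (@fst _ _) (fun _ _ => erefl) erefl).
apply: eq_bigr => i _ /=; have [il|il] := ltnP i (size l); first by rewrite (nth_map 0).
by rewrite !nth_default ?size_map.
Qed.

Lemma aff_snd n k (l : seq (cyl n)) (t : 'rV[R]_k.+1) :
  (aff l t).2 = aff (map snd l : seq R^o) t.
Proof.
rewrite /aff (big_morph (@snd _ _) (fun _ _ => erefl) erefl).
apply: eq_bigr => i _ /=; have [il|il] := ltnP i (size l); first by rewrite (nth_map 0).
by rewrite !nth_default ?size_map.
Qed.

Definition cyl_face n (i : 'I_n.+2) (v : cyl n) : cyl n.+1 :=
  (simplex_map_fun (lift i) v.1, v.2).

Lemma cyl_face_linear n (i : 'I_n.+2) : linear (@cyl_face n i).
Proof. by move=> a [u x] [v y]; rewrite /cyl_face /= linearP. Qed.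

HB.instance Definition _ n i := GRing.isLinear.Build R _ _ _ (@cyl_face n i)
  (@cyl_face_linear n i).

Definition in_cyl n (v : cyl n) : Prop := (v.1 \in @std_simplex R n) /\ 0 <= (v.2 : R) <= 1.

Lemma aff_in_cyl n k (l : seq (cyl n)) (t : simplex R k) : {in l, forall v, in_cyl v} ->
  size l = k.+1 -> in_cyl (aff l (val t)).
Proof.
move=> lP sl; split.
  rewrite aff_fst; apply: aff_in; rewrite ?size_map//; last exact: valP.
  by move=> _ /mapP[v /lP[vS _] ->].
rewrite aff_snd; apply: (aff_between (valP t)) => i ik.
rewrite (nth_map 0) ?sl//.
have vl : l`_i \in l by rewrite mem_nth// sl.
by have [] := lP _ vl.
Qed.

Definition cyl_verts n : seq (cyl n * cyl n) :=
  [seq ((v, 0 : R^o), (v, 1 : R^o)) | v <- verts R n].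

Lemma cyl_verts_face n (i : 'I_n.+2) :
  map (fun ab => (cyl_face i ab.1, cyl_face i ab.2)) (cyl_verts n) =
  del i (cyl_verts n.+1).
Proof. by rewrite /cyl_verts del_map -verts_face -!map_comp. Qed.

Lemma size_cyl_verts n : size (cyl_verts n) = n.+1.
Proof. by rewrite size_map size_verts. Qed.

Lemma cyl_verts_fst_fst n : map fst (map fst (cyl_verts n)) = verts R n.
Proof. by rewrite /cyl_verts; elim: (verts R n) => //= v s ->. Qed.

Lemma cyl_verts_fst_snd n : map fst (map snd (cyl_verts n)) = verts R n.
Proof. by rewrite /cyl_verts; elim: (verts R n) => //= v s ->. Qed.

Lemma aff_cyl_verts_bottom n (t : 'rV[R]_n.+1) : aff (map fst (cyl_verts n)) t = (t, 0).
Proof.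
rewrite [LHS]surjective_pairing aff_fst aff_snd cyl_verts_fst_fst aff_verts.
have -> : map snd (map fst (cyl_verts n)) = [seq (0 : R^o) | _ <- verts R n].
  by rewrite /cyl_verts; elim: (verts R n) => //= v s ->.
have -> : aff [seq (0 : R^o) | _ <- verts R n] t = 0; last by [].
apply: big1 => k _; rewrite (nth_map 0) ?size_verts//; exact: scaler0.
Qed.

Lemma aff_cyl_verts_top n (t : simplex R n) :
  aff (map snd (cyl_verts n)) (val t) = (val t, 1).
Proof.
rewrite [LHS]surjective_pairing aff_fst aff_snd cyl_verts_fst_snd aff_verts.
have -> : map snd (map snd (cyl_verts n)) = [seq (1 : R^o) | _ <- verts R n].
  by rewrite /cyl_verts; elim: (verts R n) => //= v s ->.
have -> : aff [seq (1 : R^o) | _ <- verts R n] (val t) = 1; last by [].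
rewrite -[RHS](simplex_sum1 t); apply: eq_bigr => k _.
by rewrite (nth_map 0) ?size_verts//; exact: mulr1.
Qed.

Lemma cyl_verts_in_cyl n x : x \in cyl_verts n -> in_cyl x.1 /\ in_cyl x.2.
Proof.
move=> /mapP[v /(@in_simplex_verts R n) vS ->].
by split; split=> //=; rewrite ?lexx ?ler01.
Qed.

End PrismSpace.

Section Straightening.
Variables (R : realType) (d : Order.disp_t) (C : porderType d).
Local Notation X := (realization R C).
Variable xd : X.

(** The vertices of |C| as vectors of a function space, so that [aff] spans simplices in barycentric
    coordinates. *)
Definition ind (x : C) : C -> R^o := fun i => (x == i)%:R.

Definition big_vertices n (s : simplex R n -> X) : seq C :=
  [seq big_vertex (s (vertex R k)) | k <- enum 'I_n.+1].

Lemma size_big_vertices n (s : simplex R n -> X) : size (big_vertices s) = n.+1.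
Proof. by rewrite size_map size_enum_ord. Qed.

Lemma vertex_face n (i : 'I_n.+2) (k : 'I_n.+1) :
  simplex_map (lift i) (vertex R k) = vertex R (lift i k).
Proof. by apply: val_inj; exact: simplex_map_delta. Qed.

Lemma big_vertices_face n (s : singular_simplex R X n.+1) i : big_vertices (face s i) = del i (big_vertices s).
Proof.
rewrite /big_vertices del_map -map_lift_enum -map_comp; apply: eq_map => k /=.
by rewrite vertex_face.
Qed.

Lemma big_vertices_supp n (s : simplex R n -> X) t : fine_simplex s -> {subset big_vertices s <= supp (s t)}.
Proof. by move=> fs _ /mapP[k _ ->]; rewrite (suppP (s t)).2. Qed.

Lemma big_vertices_chain n (s : simplex R n -> X) : fine_simplex s -> chainl (big_vertices s).
Proof.
move=> fs x y /(big_vertices_supp (vertex R ord0) fs) xs /(big_vertices_supp (vertex R ord0) fs) ys.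
by apply: (strict_chainl (suppP _).1 xs ys).
Qed.

(* In barycentric coordinates, the straight line from [s] (level 0) to the affine
   simplex on its big vertices (level 1), at level [v.2]. *)
Definition line n (s : simplex R n -> X) (v : cyl R n) (i : C) : R :=
  (1 - v.2) * bcoord (extend s v.1) i +
  v.2 * \sum_(k < n.+1) v.1 0 k * ind (big_vertex (s (vertex R k))) i.

Definition cyl_map n (s : simplex R n -> X) (v : cyl R n) : X := point_of xd (line s v).

Lemma sum_ind (S : seq C) x : uniq S -> x \in S -> \sum_(i <- S) ind x i = 1.
Proof.
move=> uS xS; rewrite (bigD1_seq x)//= /ind eqxx big1 ?addr0// => i ix.
by rewrite eq_sym (negbTE ix).
Qed.

(** Fineness puts all the big vertices of the corners in the support of [s t], so the segment stays
    in the closed simplex that carries [s t]. *)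
Lemma barycentric_line n (s : simplex R n -> X) (t : simplex R n) (v : cyl R n) :
  fine_simplex s -> in_cyl v -> v.1 = val t -> barycentric (supp (s t)) (line s v).
Proof.
move=> fs [_ /andP[v0 v1]] vt; have [sS sE] := suppP (s t).
have uS : uniq (supp (s t)) by exact: lt_sorted_uniq.
have vS k : big_vertex (s (vertex R k)) \in supp (s t).
  by apply: big_vertices_supp => //; apply: map_f; rewrite mem_enum.
rewrite /line vt extendE; split.
- exact: strict_chainl.
- move=> i; rewrite addr_ge0// mulr_ge0// ?subr_ge0 ?coord_ge0//.
  by apply: sumr_ge0 => k _; rewrite mulr_ge0 ?ler0n//; exact: simplex_ge0.
- move=> i iS; rewrite (supp_supported iS) mulr0 add0r big1 ?mulr0// => k _.
  rewrite /ind; case: eqP => [e|_]; last by rewrite mulr0.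
  by rewrite -e vS in iS.
rewrite undup_id// big_split /= -!mulr_sumr coord_sum//; last exact: supp_supported.
rewrite exchange_big /=; under eq_bigr do rewrite -mulr_sumr sum_ind// mulr1.
by rewrite simplex_sum1 !mulr1 subrK.
Qed.

Lemma cyl_map_continuous n k (s : simplex R n -> X) (l : seq (cyl R n)) :
  continuous s -> fine_simplex s -> {in l, forall v, in_cyl v} -> size l = k.+1 ->
  continuous (fun t : simplex R k => cyl_map s (aff l (val t))).
Proof.
move=> cs fs lP sl; have [L sL] := finite_cells cs.
have lS : in_simplex (map fst l) by move=> _ /mapP[v /lP[vS _] ->].
have sl1 : size (map fst l) = k.+1 by rewrite size_map.
refine (@continuous_point_of R d C xd (simplex R k) (fun t => line s (aff l (val t))) L _ _).
  move=> i.
  have c1 : continuous (fun t : simplex R k => (aff l (val t)).2 : R).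
    rewrite (_ : (fun t => _) = fun t : simplex R k => \sum_(j < k.+1) val t 0 j * (l`_j).2).
      apply: continuous_sum => j t.
      exact: (cvgM (@simplex_coord_continuous R k j t) (cvg_cst _)).
    apply/funext => t; rewrite /aff (big_morph (@snd _ _) (fun _ _ => erefl) erefl).
    by [].
  have c2 : continuous (fun t : simplex R k => bcoord (extend s (aff l (val t)).1) i : R).
    rewrite (_ : (fun t => _) = (fun x : X => bcoord x i : R) \o
        (fun t : simplex R k => extend s (aff (map fst l) (val t)))).
      move=> t; apply: continuous_comp; first exact: extend_continuous.
      exact: bcoord_continuous.
    by apply/funext => t; rewrite /= aff_fst.
  have c3 j : continuous (fun t : simplex R k => (aff l (val t)).1 0 j : R).
    rewrite (_ : (fun t => _) = fun t : simplex R k =>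
        \sum_(m < k.+1) val t 0 m * (l`_m).1 0 j).
      apply: continuous_sum => m t.
      exact: (cvgM (@simplex_coord_continuous R k m t) (cvg_cst _)).
    apply/funext => t; rewrite /aff (big_morph (@fst _ _) (fun _ _ => erefl) erefl).
    by rewrite summxE; apply: eq_bigr => m _; rewrite mxE.
  have c4 : continuous (fun t : simplex R k => \sum_(j < n.+1)
      (aff l (val t)).1 0 j * ind (big_vertex (s (vertex R j))) i : R).
    apply: continuous_sum => j t; exact: (cvgM (c3 j t) (cvg_cst _)).
  move=> t; rewrite /line.
  apply: (cvgD (cvgM (cvgB (cvg_cst _) (c1 t)) (c2 t)) (cvgM (c1 t) (c4 t))).
move=> t; have aP := aff_in_cyl t lP sl.
exists (supp (s (exist (fun u => u \in @std_simplex R n) _ aP.1))); first exact: sL.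
exact: barycentric_line.
Qed.

Lemma cochain_on_cyl_coboundary n k (s : simplex R n -> X) (c : cochain R X k) l :
  continuous s -> fine_simplex s -> {in l, forall v, in_cyl v} -> size l = k.+2 ->
  cochain_on (cyl_map s) (coboundary R X k c) l = dlt (cochain_on (cyl_map s) c) l.
Proof. by move=> *; apply: cochain_on_coboundary => //; exact: cyl_map_continuous. Qed.

Lemma cyl_map_face n (s : singular_simplex R X n.+1) i v : in_cyl v ->
  cyl_map s (cyl_face i v) = cyl_map (face s i) v.
Proof.
case: v => p x [pS _]; rewrite /cyl_map; congr (point_of _ _); apply/funext => j.
rewrite /line /=; congr (_ * bcoord _ _ + _ * _).
  by rewrite -[p]/(val (exist _ p pS : simplex R n)) extendE face_sub.
rewrite (eq_bigr (fun k => \sum_(m | lift i m == k) p 0 m * ind (big_vertex (s (vertex R k))) j)); last first.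
  by move=> k _; rewrite mxE mulr_suml.
rewrite (exchange_big_dep xpredT)//=; apply: eq_bigr => m _.
by rewrite (big_pred1 (lift i m)) ?vertex_face// => k; rewrite /= eq_sym.
Qed.

Definition prismC n (c : cochain R X n.+1) : cochain R X n :=
  fun s => prism (cochain_on (cyl_map s) c) (cyl_verts R n).

(** Restriction of a singular cochain to tuples of the poset. It is meaningful when [chainl l]
    holds; otherwise [point_of] may fall back on [xd]. *)
Definition spanned n (c : cochain R X n) (l : seq C) : int :=
  cochain_on (point_of xd) c (map ind l).

Lemma aff_ind n l (t : 'rV[R]_n.+1) i0 i : size l = n.+1 ->
  aff (map ind l) t i = \sum_(k < n.+1) t 0 k * ind (nth i0 l k) i.
Proof.
move=> sl; rewrite /aff fct_sumE; apply: eq_bigr => k _.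
by rewrite (nth_map i0) ?sl.
Qed.

Lemma barycentric_aff_ind n l (t : simplex R n) : chainl l -> size l = n.+1 ->
  barycentric l (aff (map ind l) (val t)).
Proof.
move=> cl sl; have [i0 _] : exists i0 : C, true by case: (l) sl => // i0; exists i0.
have aE i := aff_ind (val t) i0 i sl; split=> // [i|i il|].
- by rewrite aE; apply: sumr_ge0 => k _; rewrite mulr_ge0 ?ler0n//; exact: simplex_ge0.
- rewrite aE big1// => k _; rewrite /ind; case: eqP => [e|_]; last by rewrite mulr0.
  by rewrite -e mem_nth ?sl in il.
under eq_bigr do rewrite aE.
rewrite exchange_big /=; under eq_bigr => k _.
  rewrite -mulr_sumr sum_ind ?undup_uniq//; last by rewrite mem_undup mem_nth// sl.
  rewrite mulr1; over.
exact: simplex_sum1.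
Qed.

Lemma spanned_continuous n l : chainl l -> size l = n.+1 ->
  continuous (fun t : simplex R n => point_of xd (aff (map ind l) (val t))).
Proof.
move=> cl sl.
refine (@continuous_point_of R d C xd (simplex R n)
  (fun t => aff (map ind l) (val t)) [:: l] _ _) => [i|t].
  have [i0 _] : exists i0 : C, true by case: (l) sl => // i0; exists i0.
  rewrite (_ : (fun t => _) = fun t : simplex R n =>
    \sum_(k < n.+1) val t 0 k * ind (nth i0 l k) i).
    apply: continuous_sum => k t.
    exact: (cvgM (@simplex_coord_continuous R n k t) (cvg_cst _)).
  by apply/funext => t; rewrite (aff_ind _ i0).
by exists l; [rewrite mem_head|exact: barycentric_aff_ind].
Qed.

Lemma spanned_coboundary n (c : cochain R X n) l : chainl l -> size l = n.+2 ->
  spanned (coboundary R X n c) l = dlt (spanned c) l.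
Proof.
move=> cl sl; rewrite /spanned -dlt_map; apply: cochain_on_coboundary; first by rewrite size_map.
exact: spanned_continuous.
Qed.

Lemma spanned0 n l : spanned (0 : cochain R X n) l = 0.
Proof. by rewrite /spanned /cochain_on; case: ifP => // _; exact: cochain_at0. Qed.

Lemma spannedB n (c c' : cochain R X n) l : spanned (c - c') l = spanned c l - spanned c' l.
Proof.
rewrite /spanned /cochain_on; case: ifP => _; last by rewrite subrr.
by rewrite /cochain_at; case: pselect => // _; rewrite subrr.
Qed.

Lemma big_vertex_in l a : barycentric l a -> big_vertex (point_of xd a) \in l.
Proof.
move=> al; have := big_vertexP (point_of xd a); rewrite (bcoord_point_of _ al) => v1.
by apply: contraLR v1 => vl; case: al => _ _ /(_ _ vl) -> _; rewrite mul0rn ler10.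
Qed.

(** The point with coordinates [ind k] has support [k] alone, so its big vertex is [k]. *)
Lemma spanned1 (c : cochain R X 0) (y : C -> int) k :
  (forall s : singular_simplex R X 0, c s = y (big_vertex (s (vertex R ord0)))) ->
  spanned c [:: k] = y k.
Proof.
move=> cE; have ck : chainl [:: k].
  by move=> a b; rewrite !inE => /eqP-> /eqP->; exact: comparablexx.
have [s sE] := singular_of (spanned_continuous (n := 0) ck erefl).
rewrite /spanned cochain_on_size// sE cochain_atE cE -sE.
have := big_vertex_in (@barycentric_aff_ind 0 _ (vertex R ord0) ck erefl).
by rewrite inE => /eqP ->.
Qed.

Lemma cochain_on_cyl_bottom n (s : singular_simplex R X n) (c : cochain R X n) : fine_simplex s ->
  cochain_on (cyl_map s) c (map fst (cyl_verts R n)) = c s.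
Proof.
move=> fs; rewrite cochain_on_size; last by rewrite size_map size_cyl_verts.
transitivity (cochain_at c s); last exact: cochain_atE.
congr (cochain_at c _); apply/funext => t; rewrite /cyl_map -[RHS](point_of_bcoord xd); congr (point_of _ _).
apply/funext => i; rewrite /line aff_cyl_verts_bottom /= extendE.
by rewrite subr0 mul1r mul0r addr0.
Qed.

Lemma cochain_on_cyl_top n (s : singular_simplex R X n) (c : cochain R X n) : fine_simplex s ->
  cochain_on (cyl_map s) c (map snd (cyl_verts R n)) = spanned c (big_vertices s).
Proof.
move=> fs; rewrite /spanned [LHS]cochain_on_size; last by rewrite size_map size_cyl_verts.
rewrite cochain_on_size; last by rewrite size_map size_big_vertices.
congr (cochain_at c _); apply/funext => t; rewrite /cyl_map; congr (point_of _ _).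
apply/funext => i; rewrite (aff_ind _ (big_vertex (s (vertex R ord0)))) ?size_big_vertices//.
rewrite /line aff_cyl_verts_top /= extendE subrr mul0r add0r mul1r.
apply: eq_bigr => k _.
by rewrite (nth_map ord0) ?size_enum_ord// nth_ord_enum.
Qed.

(** [prism_dlt] on the cylinder from [s] to the affine simplex on its big vertices: the cocycle
    condition kills one term, and compatibility of [cyl_map] with faces makes the other the
    coboundary of [prismC c]. *)
Lemma straighten n (c : cochain R X n.+1) (s : singular_simplex R X n.+1) :
  coboundary R X n.+1 c = 0 -> fine_simplex s ->
  c s = spanned c (big_vertices s) - coboundary R X n (prismC c) s.
Proof.
move=> c0 fs; have cs : continuous s by exact: cts_fun.
have := prism_dlt (cochain_on (cyl_map s) c) (cyl_verts R n.+1).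
rewrite cochain_on_cyl_bottom// cochain_on_cyl_top//.
have -> : prism (dlt (cochain_on (cyl_map s) c)) (cyl_verts R n.+1) = 0.
  have pr0 : prism (fun=> 0) (cyl_verts R n.+1) = 0.
    have := prismB (fun=> 0) (fun=> 0) (cyl_verts R n.+1).
    by rewrite [X in _ = X]subrr => e; rewrite -[RHS]e; apply: eq_prism => k; rewrite subrr.
  rewrite -[RHS]pr0; apply: (@prism_ext _ (@in_cyl R n.+1)).
    exact: cyl_verts_in_cyl.
  move=> k kP; rewrite size_cyl_verts => sk.
  rewrite -cochain_on_cyl_coboundary// c0 /cochain_on; case: ifP => // _; exact: cochain_at0.
have -> : dlt (prism (cochain_on (cyl_map s) c)) (cyl_verts R n.+1) = coboundary R X n (prismC c) s.
  rewrite dlt_sum size_cyl_verts; apply: eq_bigr => i _; congr (_ * _).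
  rewrite -cyl_verts_face -prism_map /prismC.
  symmetry; apply: (@prism_ext _ (@in_cyl R n)); first exact: cyl_verts_in_cyl.
  move=> k kP sk; apply: (@cochain_on_map _ _ _ _ _ _ (@cyl_face R n i) _ c k (@in_cyl R n)).
    by move=> t kn; exact: aff_in_cyl.
  by move=> v vP; exact: cyl_map_face.
rewrite add0r => ->; lia.
Qed.

(** In degree 0, [dlt] evaluates the prism at the empty list, where it is 0, so no correction term
    remains. *)
Lemma straighten0 (c : cochain R X 0) (s : singular_simplex R X 0) :
  coboundary R X 0 c = 0 -> fine_simplex s -> c s = spanned c (big_vertices s).
Proof.
move=> c0 fs; have cs : continuous s by exact: cts_fun.
have := prism_dlt (cochain_on (cyl_map s) c) (cyl_verts R 0).
rewrite cochain_on_cyl_bottom// cochain_on_cyl_top//.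
have -> : prism (dlt (cochain_on (cyl_map s) c)) (cyl_verts R 0) = 0.
  have pr0 : prism (fun=> 0) (cyl_verts R 0) = 0.
    have := prismB (fun=> 0) (fun=> 0) (cyl_verts R 0).
    by rewrite [X in _ = X]subrr => e; rewrite -[RHS]e; apply: eq_prism => k; rewrite subrr.
  rewrite -[RHS]pr0; apply: (@prism_ext _ (@in_cyl R 0)).
    exact: cyl_verts_in_cyl.
  move=> k kP; rewrite size_cyl_verts => sk.
  rewrite -cochain_on_cyl_coboundary// c0 /cochain_on; case: ifP => // _; exact: cochain_at0.
have : size (cyl_verts R 0) = 1%N by rewrite size_cyl_verts.
by case: (cyl_verts R 0) => [//|[a b] [|//]] _ /=; lia.
Qed.

Lemma fine_simplex_dim0 (s : singular_simplex R X 0) : fine_simplex s.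
Proof.
move=> t u; have -> : t = u.
  apply: simplex_ext => j; have H (w : simplex R 0) : val w 0 j = 1.
    by rewrite -(simplex_sum1 w) (big_pred1 j)// => i; rewrite /= (ord1 i) (ord1 j) eqxx.
  by rewrite !H.
have := big_vertexP (s u); set a := bcoord _ _ => a1.
rewrite lt_neqAle coord_ge0 andbT; apply/eqP => a0.
by move: a1; rewrite -a0 mul0rn ler10.
Qed.

End Straightening.

(** * The two sides of the equivalence *)

Section Main.
Variables (R : realType) (d : Order.disp_t) (C : porderType d) (deg : C -> nat).
Variables (J : C -> nat -> set C) (K : nat -> set C).
Hypothesis graded : graded_poset deg.
Hypothesis adequate : adequate_covering_family deg J.
Hypothesis global : adequate_global_covering_family deg K.
Local Notation X := (realization R C).

Lemma realization_inhabited : exists x : X, True.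
Proof.
have [i0 _] := deg_zero graded.
have [|x _] := @barycentric_exists R d C [:: i0] (ind R i0); last by exists x.
split=> [a b|i|i|].
- by rewrite !inE => /eqP-> /eqP->; exact: comparablexx.
- exact: ler0n.
- by rewrite inE /ind eq_sym => /negbTE ->.
- by rewrite sum_ind ?undup_uniq// mem_undup mem_head.
Qed.

Lemma cocycle_is_coboundary n (c : cochain R X n.+1) : coboundary R X n.+1 c = 0 ->
  exists b, coboundary R X n b = c.
Proof.
move=> c0; have [xd _] := realization_inhabited.
have [l cl sl|g gE] := chain_cocycle_exact graded adequate global (n := n) (f := spanned xd c).
  by rewrite -spanned_coboundary// c0 spanned0.
(* By [straighten], subtracting the coboundary of [b0] makes [c] vanish on fine simplices. *)
pose g1 : cochain R X n := fun s => g (big_vertices s).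
pose b0 : cochain R X n := g1 - prismC xd c.
have c'0 : coboundary R X n.+1 (c - coboundary R X n b0) = 0.
  by rewrite raddfB /= c0 coboundary_coboundary subrr.
have [s fs|b bE] := fine_cocycle_exact c'0.
  have bE : coboundary R X n b0 s =
      coboundary R X n g1 s - coboundary R X n (prismC xd c) s.
    exact: (congr1 (fun h => h s) (raddfB (coboundary R X n) g1 (prismC xd c))).
  rewrite -[LHS]/(c s - coboundary R X n b0 s) (straighten xd c0 fs) bE.
  rewrite gE ?size_big_vertices//; last exact: big_vertices_chain.
  suff -> : coboundary R X n g1 s = dlt g (big_vertices s) by rewrite subrr.
  by rewrite dlt_sum size_big_vertices; apply: eq_bigr => i _; rewrite /g1 big_vertices_face.
by exists (b + b0); rewrite raddfD /= bE subrK.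
Qed.

Lemma realization_acyclic : acyclic R X.
Proof.
move=> j; case: j => [//|m] _ x.
have [z <-] : exists z, \pi_(cohomology R X m.+1)%qT z = x.
  by exists (repr x); exact: reprK.
have zP : coboundary R X m.+1 (val z) = 0 by apply/eqP; exact: (valP z).
rewrite -[RHS](raddf0 (\pi_(cohomology R X m.+1)%qT)).
apply/eqP; rewrite -Quotient.idealrBE subr0; apply/asboolP => /=.
exact: cocycle_is_coboundary.
Qed.

Lemma zigzag_constant (y : C -> int) i j : (forall i j, (i <= j)%O -> y i = y j) ->
  zigzag setT i j -> y i = y j.
Proof.
move=> yc; elim=> [a b [_ _ /yc]|a|a b _ ab|a b c _ ab _ bc1] //.
by rewrite ab.
Qed.

(** Extending the indicator of one element of [K 0] to a locally constant function separates it from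
    the others, hence injectivity. The indicator of a component missed by [K 0] would vanish on
    [K 0] without being 0, hence surjectivity. *)
Lemma card_components : K 0%N #= components C.
Proof.
pose f (i : C) : set C := [set j | zigzag setT i j].
have zz i j : zigzag setT i j -> f i = f j.
  move=> ij; apply/seteqP; split=> k /= ik.
    exact: rst_trans (rst_sym _ _ _ _ ij) ik.
  exact: rst_trans ij ik.
apply/card_set_bijP; exists f; split.
- by move=> i _; exists i.
- move=> i j /set_mem Ki /set_mem Kj fij.
  have zij : zigzag setT i j.
    by have : f j j by [exact: rst_refl]; rewrite -fij.
  have [y yc yE] := locally_constant_extension graded adequate global
    (fun k => (k == i)%:Z).
  have := zigzag_constant yc zij; rewrite !yE// eqxx.
  by case: eqP.
move=> A [i ->]; apply: contrapT => nK.
pose y (j : C) : int := (`[< zigzag setT i j >] : bool)%:Z.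
have yc a b : (a <= b)%O -> y a = y b.
  move=> ab; have zab : zigzag setT a b by apply: rst_step.
  congr (Posz (nat_of_bool _)); apply/asboolP/asboolP => h.
    exact: rst_trans zab.
  by apply: rst_trans h _; exact: rst_sym.
have yK k : K 0%N k -> y k = 0.
  move=> Kk; rewrite /y; case: asboolP => // ik.
  by exfalso; apply: nK; exists k => //; rewrite -(zz _ _ ik).
have := locally_constant_unique global yc yK i.
by rewrite /y; case: asboolP => // -[]; exact: rst_refl.
Qed.

Let pi0 : {additive kernel (coboundary R X 0) -> cohomology R X 0} :=
  \pi_(cohomology R X 0)%qT.

(** In degree 0 the only coboundary is 0, so a class is a single cocycle. *)
Lemma pi0_inj z z' : pi0 z = pi0 z' -> val z = val z'.
Proof.
move=> /eqP; rewrite -Quotient.idealrBE => /asboolP /= h.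
by apply/eqP; rewrite -subr_eq0; apply/eqP.
Qed.

(** A class is evaluated at the vertices in [K 0]. The values of a 0-cocycle at the vertices form a
    locally constant function, which determines it by [straighten0] and is itself determined on
    [K 0]. *)
Lemma cohomology0_iso : isomorphic (cohomology R X 0) (K 0%N -> int).
Proof.
have [xd _] := realization_inhabited.
pose f (x : cohomology R X 0) : K 0%N -> int :=
  fun k => spanned xd (val (repr x) : cochain R X 0) [:: val k].
have fE z k : f (pi0 z) k = spanned xd (val z) [:: val k].
  by rewrite /f (@pi0_inj (repr (pi0 z)) z)//; exact: reprK.
have pi0K x : pi0 (repr x) = x by exact: reprK.
have fB : zmod_morphism f.
  move=> x y; apply/funext => k; rewrite -[x]pi0K -[y]pi0K -raddfB !fE.
  by rewrite raddfB spannedB -!fE.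
exists (HB.pack f (GRing.isZmodMorphism.Build _ _ f fB) :
  {additive cohomology R X 0 -> (K 0%N -> int)}).
apply: bij_of => [|w].
  apply: raddf_inj => x /= fx; rewrite -[x]pi0K.
  have cP : coboundary R X 0 (val (repr x)) = 0 by apply/eqP; exact: (valP (repr x)).
  set c := val (repr x) in cP.
  have y0 : forall i, spanned xd c [:: i] = 0.
    apply: (locally_constant_unique global
      (y := fun i => spanned xd c [:: i])) => [i j ij|i Ki].
      have cl : chainl [:: i; j].
        move=> a b; rewrite !inE => /orP[]/eqP-> /orP[]/eqP->;
          by rewrite /Order.comparable ?lexx ?ij ?orbT.
      have := spanned_coboundary xd c cl erefl.
      rewrite cP spanned0 /= subr0 => /esym/subr0_eq e.
      exact: esym e.
    have iK : i \in K 0%N by apply/mem_set.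
    exact: (congr1 (fun g => g (exist _ i iK)) fx).
  have -> : repr x = 0.
    apply: val_inj; rewrite -/c raddf0; apply/funext => s.
    rewrite (straighten0 xd cP (@fine_simplex_dim0 _ _ _ s)).
    have := size_big_vertices s; case: (big_vertices s) => [//|i [|//]] _.
    exact: y0.
  exact: raddf0.
pose w' i : int := match pselect (i \in K 0%N) with
  | left h => w (exist _ i h) | right _ => 0 end.
have [y yc yE] := locally_constant_extension graded adequate global w'.
(* The preimage of [w] reads the extended function at the big vertex of a point. On a fine 1-simplex
   the big vertices of the ends are comparable, so [y] agrees there, and [fine_cocycle0] takes care
   of all other 1-simplices. *)
pose c : cochain R X 0 := fun s => y (big_vertex (s (vertex R ord0))).
have [i0 _] := deg_zero graded.
have cvs (s : singular_simplex R X 0) : c s = y (nth i0 (big_vertices s) 0).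
  rewrite /big_vertices (nth_map ord0) ?size_enum_ord//.
  by rewrite /c; congr (y (big_vertex (s (vertex R _)))); apply: val_inj; rewrite /= nth_enum_ord.
have cP : coboundary R X 0 c = 0.
  apply: fine_cocycle0 => s fs.
  have -> : coboundary R X 0 c s = dlt (fun l => y (nth i0 l 0)) (big_vertices s).
    by rewrite dlt_sum size_big_vertices; apply: eq_bigr => i _; rewrite cvs big_vertices_face.
  have := big_vertices_chain fs; have := size_big_vertices s.
  case: (big_vertices s) => [//|a [//|b [|//]]] _ cl /=; rewrite subr0.
  have /orP[ab|ba] : (a >=< b)%O by apply: cl; rewrite !inE eqxx ?orbT.
    by rewrite (yc _ _ ab) subrr.
  by rewrite (yc _ _ ba) subrr.
have zP : c \in @ker_pred _ _ (coboundary R X 0) by apply/eqP.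
exists (pi0 (exist _ c zP)); apply/funext => k; rewrite /= fE /=.
rewrite (@spanned1 _ _ _ xd c y)// yE; last exact: (set_mem (valP k)).
rewrite /w'; case: pselect => [h|[]]; last exact: (valP k).
by congr w; exact: val_inj.
Qed.

End Main.

Theorem theorem19 (R : realType) (d : Order.disp_t) (C : porderType d)
    (deg : C -> nat) (J : C -> nat -> set C) (K : nat -> set C) :
  graded_poset deg -> bounded_below deg ->
  adequate_covering_family deg J ->
  adequate_global_covering_family deg K ->
  (acyclic R (realization R C) <-> K 0%N #= components C) /\
  (acyclic R (realization R C) ->
   isomorphic (cohomology R (realization R C) 0) (K 0%N -> int)).
Proof.
move=> graded _ adequate global; split; last first.
  by move=> _; exact: cohomology0_iso graded adequate global.
split=> _; first exact: card_components graded adequate global.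
exact: realization_acyclic graded adequate global.
Qed.
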